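(* Let $\mathrm{k}$ be any algebraically closed field of characteristic $\neq 2,3$. There are exactly $35$ isomorphism classes of minimal algebras $(\Lambda V,d)$ over $\mathrm{k}$ generated in degree $1$, with $\dim_{\mathrm{k}} V=8$, whose characteristic filtration $W_0\subset W_1\subset\cdots\subset V$ satisfies $W_1=V$ (that is, $d(V)\subset \Lambda^2\ker(d|_V)$).
   Context: A minimal algebra generated in degree $1$ over a field $\mathrm{k}$ is a pair $(\Lambda V,d)$ where $V$ is a finite-dimensional $\mathrm{k}$-vector space placed in degree $1$, $\Lambda V$ is its exterior algebra, and $d$ is a differential of degree $+1$ (a linear map with $d^2=0$ and $d(xy)=(dx)y+(-1)^{|x|}x(dy)$ for homogeneous $x,y$) such that there is an ordered basis $x_1,\dots,x_n$ of $V$ with each $dx_k$ lying in $\Lambda^2\langle x_1,\dots,x_{k-1}\rangle$. Its dimension means $\dim V$. Two such algebras $(\Lambda V,d)$ and $(\Lambda V',d')$ are isomorphic if there is a linear isomorphism $V\cong V'$ whose induced algebra map $\Lambda V\cong\Lambda V'$ commutes with the differentials. The characteristic filtration is $W_0=\ker(d\colon V\to\Lambda^2V)$ and $W_k=\{v\in V: dv\in\Lambda^2W_{k-1}\}$ for $k\ge1$. The algebra with $d=0$ is included. *)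

(* Defs.v *)
From HB Require Import structures.
From mathcomp Require Import all_boot all_order all_algebra all_field.

Set Implicit Arguments.
Unset Strict Implicit.
Unset Printing Implicit Defensive.

Import GRing.Theory.

Local Open Scope ring_scope.

(* The exterior algebra of V, in the coordinates given by [vbasis {:V}]: the   *)
(* vector [ext_elt S] is the product of the basis vectors [vcoord i], i \in S, *)
(* in increasing order ([ext_eltE]). That this is the exterior algebra is      *)
(* [ext_inc_sq] with the universal property [ext_lift_inc],                    *)
(* [ext_lift_monoid_morphism] and [ext_lift_unique].                           *)
Definition exterior (k : fieldType) (V : vectType k) : Type :=
  {ffun {set 'I_(\dim {:V})} -> k^o}.

HB.instance Definition _ (k : fieldType) (V : vectType k) :=
  Vector.on (exterior V).

Section Exterior.

Variables (k : fieldType) (V : vectType k).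
Local Notation n := (\dim {:V}).
Local Notation E := (exterior V).
Implicit Types (S T U : {set 'I_n}) (u v w : E).

Definition ext_elt S : E := [ffun T => (T == S)%:R].

(* The sign of the shuffle sorting S followed by T. *)
Definition ext_sign S T : k :=
  if [disjoint S & T] then (-1) ^+ (\sum_(i in S) \sum_(j in T) (j < i)%N)
  else 0.

Definition ext_one : E := ext_elt set0.
Definition ext_mul u v : E :=
  \sum_S \sum_T (u S * v T * ext_sign S T) *: ext_elt (S :|: T).

Lemma ext_decomp u : u = \sum_S u S *: ext_elt S.
Proof.
apply/ffunP=> T; rewrite sum_ffunE (bigD1 T) //= big1 => [|S neST].
  by rewrite !ffunE eqxx addr0 [RHS]mulr1.
by rewrite !ffunE eq_sym (negPf neST) [LHS]mulr0.
Qed.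

Fact ext_mul_linear u : linear (ext_mul u).
Proof.
move=> a v w; rewrite /ext_mul scaler_sumr -big_split; apply: eq_bigr => S _.
rewrite scaler_sumr -big_split; apply: eq_bigr => T _ /=.
rewrite scalerA -scalerDl !ffunE /=; congr (_ *: _).
by rewrite mulrDr mulrDl !mulrA [a * u S]mulrC -!mulrA.
Qed.

Fact ext_mul_linearl v : linear (ext_mul^~ v).
Proof.
move=> a u w; rewrite /ext_mul scaler_sumr -big_split; apply: eq_bigr => S _.
rewrite scaler_sumr -big_split; apply: eq_bigr => T _ /=.
rewrite scalerA -scalerDl !ffunE /=; congr (_ *: _).
by rewrite !mulrDl !mulrA.
Qed.

Let mull v : {linear E -> E} := HB.pack (ext_mul^~ v)
  (GRing.isLinear.Build k E E *:%R (ext_mul^~ v) (ext_mul_linearl v)).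
Let mulr u : {linear E -> E} := HB.pack (ext_mul u)
  (GRing.isLinear.Build k E E *:%R (ext_mul u) (ext_mul_linear u)).

Fact ext_mul_suml (a : {set 'I_n} -> k) (F : {set 'I_n} -> E) v :
  ext_mul (\sum_S a S *: F S) v = \sum_S a S *: ext_mul (F S) v.
Proof.
rewrite -[LHS]/(mull v _) linear_sum.
by apply: eq_bigr => S _; rewrite -[LHS]/(mull v _) linearZ.
Qed.

Fact ext_mul_sumr (a : {set 'I_n} -> k) (F : {set 'I_n} -> E) u :
  ext_mul u (\sum_S a S *: F S) = \sum_S a S *: ext_mul u (F S).
Proof.
rewrite -[LHS]/(mulr u _) linear_sum.
by apply: eq_bigr => S _; rewrite -[LHS]/(mulr u _) linearZ.
Qed.

Fact ext_mul_elt S T :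
  ext_mul (ext_elt S) (ext_elt T) = ext_sign S T *: ext_elt (S :|: T).
Proof.
rewrite /ext_mul (bigD1 S) //= [X in _ + X]big1 ?addr0 => [|S' neS].
  rewrite (bigD1 T) //= big1 ?addr0 => [|T' neT].
    by rewrite !ffunE !eqxx !mul1r.
  by rewrite !ffunE (negPf neT) mulr0 mul0r scale0r.
by apply: big1 => T' _; rewrite !ffunE (negPf neS) !mul0r scale0r.
Qed.

Fact ext_sign0l T : ext_sign set0 T = 1.
Proof. by rewrite /ext_sign -setI_eq0 set0I eqxx big_set0. Qed.

Fact ext_sign0r S : ext_sign S set0 = 1.
Proof. by rewrite /ext_sign -setI_eq0 setI0 eqxx big1 // => i _; rewrite big_set0. Qed.

Fact ext_signA S T U :
  ext_sign S T * ext_sign (S :|: T) U = ext_sign T U * ext_sign S (T :|: U).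
Proof.
rewrite /ext_sign -!setI_eq0 setIUl setIUr !setU_eq0.
have [ST | _] := eqVneq (S :&: T) set0; last by rewrite mul0r mulr0.
have [TU | _] := eqVneq (T :&: U) set0; last by rewrite andbF mul0r mulr0.
have [SU | _] := eqVneq (S :&: U) set0; last by rewrite !mulr0.
rewrite /= -!exprD; congr (_ ^+ _).
have dST : [disjoint S & T] by rewrite -setI_eq0 ST.
have dTU : [disjoint T & U] by rewrite -setI_eq0 TU.
have sumU (A B : {set 'I_n}) (F : 'I_n -> nat) : [disjoint A & B] ->
    \sum_(i in A :|: B) F i = (\sum_(i in A) F i + \sum_(i in B) F i)%N.
  by move=> dAB; rewrite -bigU //; apply: eq_bigl => i; rewrite !inE.
rewrite sumU // [in RHS]addnC addnA; congr (_ + _)%N.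
by rewrite -big_split; apply: eq_bigr => i _; rewrite sumU.
Qed.

Fact ext_mulA : associative ext_mul.
Proof.
move=> u v w; rewrite (ext_decomp u) !ext_mul_suml; apply: eq_bigr => S _.
congr (_ *: _); rewrite (ext_decomp v) ext_mul_suml !ext_mul_sumr ext_mul_suml.
apply: eq_bigr => T _; congr (_ *: _); rewrite (ext_decomp w) !ext_mul_sumr.
apply: eq_bigr => U _; congr (_ *: _); rewrite !ext_mul_elt.
rewrite -[LHS]/(mulr _ _) linearZ -[RHS]/(mull _ _) linearZ /= !ext_mul_elt.
by rewrite !scalerA setUA ext_signA.
Qed.

Fact ext_mul1l : left_id ext_one ext_mul.
Proof.
move=> u; rewrite [u in LHS]ext_decomp ext_mul_sumr [RHS]ext_decomp.
by apply: eq_bigr => S _; rewrite ext_mul_elt ext_sign0l set0U scale1r.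
Qed.

Fact ext_mul1r : right_id ext_one ext_mul.
Proof.
move=> u; rewrite [u in LHS]ext_decomp ext_mul_suml [RHS]ext_decomp.
by apply: eq_bigr => S _; rewrite ext_mul_elt ext_sign0r setU0 scale1r.
Qed.

Fact ext_mulDl : left_distributive ext_mul +%R.
Proof. by move=> u v w; exact: (linearD (mull w)). Qed.

Fact ext_mulDr : right_distributive ext_mul +%R.
Proof. by move=> u v w; exact: (linearD (mulr u)). Qed.

Fact ext_one_neq0 : ext_one != 0.
Proof.
apply/eqP=> /ffunP/(_ set0); rewrite !ffunE eqxx => /eqP.
by rewrite oner_eq0.
Qed.

HB.instance Definition _ := GRing.Zmodule_isNzRing.Build E
  ext_mulA ext_mul1l ext_mul1r ext_mulDl ext_mulDr ext_one_neq0.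

Fact ext_scaleAl (a : k) u v : a *: (u * v) = (a *: u) * v.
Proof. by rewrite -[RHS]/(mull v _) linearZ. Qed.
HB.instance Definition _ := GRing.Lmodule_isLalgebra.Build k E ext_scaleAl.

Fact ext_scaleAr (a : k) u v : a *: (u * v) = u * (a *: v).
Proof. by rewrite -[RHS]/(mulr u _) linearZ. Qed.
HB.instance Definition _ := GRing.Lalgebra_isAlgebra.Build k E ext_scaleAr.

HB.instance Definition _ := Algebra_isFalgebra.Build k E.

Definition vcoord (i : 'I_n) : V := (vbasis {:V})`_i.

Definition ext_inc_fun (x : V) : E :=
  \sum_i coord (vbasis {:V}) i x *: ext_elt [set i].

Fact ext_inc_linear : linear ext_inc_fun.
Proof.
move=> a x y; rewrite scaler_sumr -big_split; apply: eq_bigr => i _ /=.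
by rewrite linearP scalerDl scalerA.
Qed.
HB.instance Definition _ :=
  GRing.isLinear.Build k V E *:%R ext_inc_fun ext_inc_linear.

Definition ext_inc : 'Hom(V, E) := linfun ext_inc_fun.

(* The subspace of the exterior algebra spanned by p-fold products of vectors  *)
(* of W, i.e. the p-th exterior power of W.                                    *)
Definition ext_pow (W : {vspace V}) (p : nat) : {vspace E} :=
  ((ext_inc @: W) ^+ p)%VS.

Lemma ext_inc_vcoord i : ext_inc (vcoord i) = ext_elt [set i].
Proof.
have freeB := basis_free (vbasisP {:V}).
rewrite lfunE /= /ext_inc_fun (bigD1 i) //= big1 ?addr0 ?coord_free ?eqxx ?scale1r // => j ne.
by rewrite coord_free // eq_sym (negPf ne) scale0r.
Qed.

Lemma vcoord_decomp (x : V) : x = \sum_i coord (vbasis {:V}) i x *: vcoord i.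
Proof. exact: coord_vbasis (memvf x). Qed.

Fact ext_inc_anticomm i j :
  ext_inc (vcoord i) * ext_inc (vcoord j) =
  - (ext_inc (vcoord j) * ext_inc (vcoord i)).
Proof.
rewrite !ext_inc_vcoord [LHS]ext_mul_elt [X in - X]ext_mul_elt setUC.
rewrite -scaleNr; congr (_ *: _); rewrite /ext_sign !disjoints1 !in_set1 eq_sym.
have [_ | neij] := eqVneq i j; first by rewrite oppr0.
rewrite /= !big_set1; case: (ltngtP i j) => [||/val_inj/eqP eij].
- by rewrite expr0 expr1 opprK.
- by rewrite expr0 expr1.
by rewrite eij in neij.
Qed.

Lemma ext_inc_sq (x : V) : ext_inc x * ext_inc x = 0.
Proof.
have anti i (y : V) :
    ext_inc (vcoord i) * ext_inc y = - (ext_inc y * ext_inc (vcoord i)).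
  rewrite [y]vcoord_decomp linear_sum mulr_sumr mulr_suml -sumrN.
  apply: eq_bigr => j _; rewrite linearZ /= -scalerAr -scalerAl.
  by rewrite ext_inc_anticomm scalerN.
have {}anti (y z : V) : ext_inc y * ext_inc z = - (ext_inc z * ext_inc y).
  rewrite [y]vcoord_decomp linear_sum mulr_sumr mulr_suml -sumrN.
  apply: eq_bigr => i _; rewrite linearZ /= -scalerAr -scalerAl.
  by rewrite anti scalerN.
rewrite [x]vcoord_decomp; elim/big_ind: _ => [|y z yy zz|i _].
- by rewrite linear0 mulr0.
- by rewrite linearD mulrDl !mulrDr yy zz add0r addr0 anti addNr.
rewrite linearZ /= -scalerAr -scalerAl ext_inc_vcoord [_ * _]ext_mul_elt.
by rewrite /ext_sign disjoints1 set11 scale0r !scaler0.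
Qed.

End Exterior.

Section UniversalProperty.

Variables (k : fieldType) (V : vectType k) (A : algType k).
Variable (g : {linear V -> A}).
Local Notation n := (\dim {:V}).
Implicit Types (S T : {set 'I_n}) (i j m : 'I_n).

Definition ext_lift (u : exterior V) : A :=
  \sum_(S : {set 'I_n}) (u S : k) *: \prod_(i <- enum S) g (vcoord i).

Fact ext_lift_linear : linear ext_lift.
Proof.
move=> a u v; rewrite /ext_lift scaler_sumr -big_split; apply: eq_bigr => S _.
by rewrite /= !ffunE scalerA -scalerDl.
Qed.
HB.instance Definition _ :=
  GRing.isLinear.Build k (exterior V) A *:%R ext_lift ext_lift_linear.

Lemma ext_lift_elt S : ext_lift (ext_elt S) = \prod_(i <- enum S) g (vcoord i).
Proof.
rewrite /ext_lift (bigD1 S) //= ffunE eqxx scale1r [X in _ + X]big1 ?addr0 //.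
by move=> T ne; rewrite ffunE (negPf ne) scale0r.
Qed.

Lemma ext_lift_inc x : ext_lift (ext_inc V x) = g x.
Proof.
rewrite [x]vcoord_decomp !linear_sum; apply: eq_bigr => i _.
by rewrite !linearZ /= ext_inc_vcoord ext_lift_elt enum_set1 big_seq1.
Qed.

Hypothesis gg0 : forall x, g x * g x = 0.

Fact ext_lift_anticomm x y : g x * g y = - (g y * g x).
Proof.
apply/eqP; rewrite -addr_eq0; apply/eqP.
have := gg0 (x + y); rewrite linearD mulrDl !mulrDr !gg0 add0r addr0.
by [].
Qed.

Let P (S : {set 'I_n}) := \prod_(i <- enum S) g (vcoord i).

Fact ext_prod_min m S : (forall i, i \in S -> (m < i)%N) ->
  P (m |: S) = g (vcoord m) * P S.
Proof.
move=> mS; rewrite /P; suff -> : enum (m |: S) = m :: enum S by rewrite big_cons.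
have ltn_ordtr : transitive (fun i j : 'I_n => (i < j)%N).
  by move=> a b c; apply: ltn_trans.
have senum (T : {set 'I_n}) : sorted (fun i j : 'I_n => (i < j)%N) (enum T).
  have -> : enum T = [seq i <- enum 'I_n | i \in T] by rewrite enumT.
  apply: sorted_filter => //.
  by have := iota_ltn_sorted 0 n; rewrite -val_enum_ord sorted_map.
apply: (irr_sorted_eq ltn_ordtr) => //; first by move=> i; apply: ltnn.
  rewrite /= path_min_sorted //; apply/allP=> i; rewrite mem_enum; exact: mS.
by move=> i; rewrite inE !mem_enum in_setU1.
Qed.

Fact ext_min_set (S : {set 'I_n}) : S != set0 ->
  exists m, exists2 S', S = m |: S' & forall i, i \in S' -> (m < i)%N.
Proof.
case/set0Pn=> i0 Si0; case: (@arg_minnP _ i0 [in S] val Si0) => m Sm minm.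
exists m, (S :\ m); first by rewrite setD1K.
by move=> i /setD1P[ne /minm]; rewrite leq_eqVlt eq_sym (inj_eq val_inj) (negPf ne).
Qed.

Fact ext_prod_insert j S :
  g (vcoord j) * P S = ext_sign [set j] S *: P (j |: S).
Proof.
have [c] := ubnP #|S|; elim: c S => // c IHc S ltSc.
have [-> | S0] := eqVneq S set0.
  by rewrite ext_sign0r scale1r setU0 /P enum_set0 enum_set1 big_nil big_seq1 mulr1.
have [m [S' defS mS']] := ext_min_set S0.
have mS : m \notin S' by apply/negP=> /mS'; rewrite ltnn.
have {ltSc}/IHc IH : (#|S'| < c)%N by move: ltSc; rewrite defS cardsU1 mS.
case: (ltngtP j m) => [ltjm | ltmj | /val_inj->].
- have jS i : i \in S -> (j < i)%N.
    by rewrite defS => /setU1P[-> // | /mS']; apply: ltn_trans.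
  rewrite ext_prod_min // /ext_sign.
  have -> : [disjoint [set j] & S].
    by rewrite disjoints1; apply/negP=> /jS; rewrite ltnn.
  rewrite big_set1 big1 ?expr0 ?scale1r // => i /jS ltji.
  by rewrite ltnNge ltnW.
- rewrite defS ext_prod_min // mulrA ext_lift_anticomm mulNr -mulrA IH.
  rewrite -scalerAr -ext_prod_min => [|i /setU1P[-> // | /mS' //]].
  rewrite setUCA -scaleNr; congr (_ *: _); rewrite /ext_sign !disjoints1 in_setU1.
  have -> /= : (j == m) = false by apply/negbTE; rewrite -(inj_eq val_inj) gtn_eqF.
  case: ifP => _; last by rewrite oppr0.
  by rewrite !big_set1 big_setU1 //= ltmj exprS mulN1r.
rewrite defS ext_prod_min // mulrA gg0 mul0r /ext_sign disjoints1.
by rewrite setU11 scale0r.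
Qed.

Fact ext_prodM S T : P S * P T = ext_sign S T *: P (S :|: T).
Proof.
have [c] := ubnP #|S|; elim: c S => // c IHc S ltSc.
have [-> | S0] := eqVneq S set0.
  by rewrite ext_sign0l scale1r set0U {1}/P enum_set0 big_nil mul1r.
have [m [S' defS mS']] := ext_min_set S0.
have mS : m \notin S' by apply/negP=> /mS'; rewrite ltnn.
have {ltSc}/IHc IH : (#|S'| < c)%N by move: ltSc; rewrite defS cardsU1 mS.
rewrite defS ext_prod_min // -mulrA IH -scalerAr ext_prod_insert scalerA.
rewrite -setUA -ext_signA; congr (_ *: _).
rewrite {1}/ext_sign disjoints1 mS big_set1 big1 ?mul1r // => i /mS' ltmi.
by rewrite ltnNge ltnW.
Qed.

Lemma ext_lift_monoid_morphism : monoid_morphism ext_lift.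
Proof.
split=> [|u v]; first by rewrite ext_lift_elt enum_set0 big_nil.
rewrite [u]ext_decomp [v]ext_decomp mulr_suml !linear_sum mulr_suml.
apply: eq_bigr => S _; rewrite mulr_sumr !linear_sum mulr_sumr.
apply: eq_bigr => T _; rewrite -scalerAl -scalerAr !linearZ /= -scalerAl -scalerAr.
congr (_ *: (_ *: _)); rewrite [_ * _]ext_mul_elt linearZ /= !ext_lift_elt.
by rewrite ext_prodM.
Qed.

End UniversalProperty.

Lemma ext_eltE (k : fieldType) (V : vectType k) (S : {set 'I_(\dim {:V})}) :
  ext_elt S = \prod_(i <- enum S) ext_inc V (vcoord i).
Proof.
have [c] := ubnP #|S|; elim: c S => // c IHc S ltSc.
have [-> | S0] := eqVneq S set0; first by rewrite enum_set0 big_nil.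
have [m [S' defS mS']] := ext_min_set S0.
have mS : m \notin S' by apply/negP=> /mS'; rewrite ltnn.
rewrite defS (ext_prod_min _ mS') -IHc; last first.
  by move: ltSc; rewrite defS cardsU1 mS.
rewrite /= ext_inc_vcoord [RHS]ext_mul_elt /ext_sign disjoints1 mS big_set1.
by rewrite big1 ?scale1r // => i /mS' ltmi; rewrite ltnNge ltnW.
Qed.

Lemma ext_lift_unique (k : fieldType) (V : vectType k) (A : algType k)
    (g : {linear V -> A}) (h : {lrmorphism exterior V -> A}) :
  (forall x, h (ext_inc V x) = g x) -> h =1 ext_lift g.
Proof.
move=> hg u; rewrite [u in LHS]ext_decomp linear_sum; apply: eq_bigr => S _.
rewrite linearZ /= ext_eltE rmorph_prod; congr (_ *: _).
by apply: eq_bigr => i _; exact: hg.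
Qed.

Section ExteriorMap.

Variables (k : fieldType) (V V' : vectType k) (f : 'Hom(V, V')).

Definition ext_map : exterior V -> exterior V' :=
  ext_lift (ext_inc V' \o f)%VF.

HB.instance Definition _ := GRing.Linear.on ext_map.

Fact ext_map_monoid_morphism : monoid_morphism ext_map.
Proof.
by apply: ext_lift_monoid_morphism => x; rewrite /= comp_lfunE ext_inc_sq.
Qed.
HB.instance Definition _ :=
  GRing.isMonoidMorphism.Build (exterior V) (exterior V') ext_map
    ext_map_monoid_morphism.

Lemma ext_map_inc x : ext_map (ext_inc V x) = ext_inc V' (f x).
Proof. by apply: etrans (ext_lift_inc _ _) _; rewrite /= comp_lfunE. Qed.

End ExteriorMap.

(* The vectors X`_0, ..., X`_(n - 1) are x_1, ..., x_n, so that [take i X]     *)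
(* lists the vectors strictly before X`_i.                                     *)
Record minimal_algebra (k : fieldType) := MinimalAlgebra {
  gens : vectType k;
  diff : 'End(exterior gens);
  diff_degree : forall p u,
    u \in ext_pow {:gens} p -> diff u \in ext_pow {:gens} p.+1;
  diff_sq0 : forall u, diff (diff u) = 0;
  diff_leibniz : forall p q u v,
    u \in ext_pow {:gens} p -> v \in ext_pow {:gens} q ->
    diff (u * v) = diff u * v + (-1) ^+ p * u * diff v;
  diff_minimal : exists2 X : (\dim {:gens}).-tuple gens, basis_of {:gens} X &
    forall i : 'I_(\dim {:gens}),
      diff (ext_inc gens X`_i) \in ext_pow <<take i X>> 2
}.

Section MinimalAlgebras.

Variable k : fieldType.
Implicit Types L M : minimal_algebra k.

Definition isomorphic L M : Prop :=
  exists2 f : 'Hom(gens L, gens M), bijective f &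
    forall u, ext_map f (diff L u) = diff M (ext_map f u).

Definition diff_gens L : 'Hom(gens L, exterior (gens L)) :=
  (diff L \o ext_inc (gens L))%VF.

Fixpoint char_filtration L (m : nat) : {vspace gens L} :=
  if m is m'.+1 then (diff_gens L @^-1: ext_pow (char_filtration L m') 2)%VS
  else lker (diff_gens L).

End MinimalAlgebras.

(* Main.v *)
(* The algebra is determined up to isomorphism by the subspace d(V) of the exterior square of
   ker d, modulo GL(ker d).  If m = dim (ker d), this subspace has dimension 8 - m, which must be at
   most m (m - 1) / 2, so m >= 4, and it can be viewed as a space U of alternating m x m matrices.

   U is brought to a normal form by distinguishing whether it contains a decomposable form e1 e2.
   If it does, the other generators are reduced modulo the ideal generated by e1 and e2; for m = 4
   this is always so, since the Pfaffian has a zero on every pencil.  A space without decomposable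
   forms is a line, a pencil with m = 6, or a net with m = 5; such a net is reduced starting from a
   pencil in it, all indecomposable pencils in five variables being equivalent.

   The normal forms are told apart as follows.  If d x_i corresponds to the matrix C_i, the
   dimension of the space of matrices X such that
     a * (sum over j of X_ij C_j) = X^T C_i + c * C_i X    for all i
   is an isomorphism invariant.  Its values for (a, c) = (1, 1), (0, 1) and (0, -1) separate the 35
   algebras.  They are computed by eliminating over the integers with pivots that are products of 2
   and 3, so that they are the same in every characteristic different from 2 and 3. *)
Require Import Defs.
From HB Require Import structures.
From mathcomp Require Import all_boot all_order all_algebra all_field.
From mathcomp Require Import ring.
From Stdlib Require Import Classical_Prop.

Set Implicit Arguments.
Unset Strict Implicit.
Unset Printing Implicit Defensive.

Import GRing.Theory.
Local Open Scope ring_scope.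

(** The reductions are phrased with spans only: a list of vectors spans the space, the span of a
    list of forms contains [U]. As the lists have the length prescribed by the dimension, spanning
    already makes them bases. A change of basis is then a pair of coefficient tables, and its
    correctness is a polynomial or rational identity in the entries of the vectors. The closed field
    supplies zeros of quadratic Pfaffians and determinants, the root of one cubic, and one
    eigenvalue. Halves serve to identify alternating matrices with elements of the exterior square
    and to complete squares. The matrices X of the invariant are, for (1, 1), the derivations of
    degree 0 that commute with d; for (0, 1), those that kill d(V); for (0, -1), the endomorphisms
    that are self-adjoint for every form C_i. These are linear conditions with integer coefficients,
    so one integral elimination determines their ranks over all the fields considered. *)

Section LinearCombinations.

Variables (k : fieldType) (V : vectType k).
Implicit Types (x y : V) (s S X Z : seq V) (cs : seq k).

(** Missing coefficients count as 0, so the coefficient tables below omit trailing zeros. *)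
Fixpoint lc cs s : V :=
  match cs, s with
  | c :: cs', x :: s' => c *: x + lc cs' s'
  | _, _ => 0
  end.

Lemma lc_span cs s : lc cs s \in <<s>>%VS.
Proof.
elim: s cs => [|x s IHs] [|c cs] /=; rewrite ?mem0v // span_cons.
by apply: memv_add => //; apply: memvZ; apply: memv_line.
Qed.

Lemma spanP x s : x \in <<s>>%VS -> exists2 cs, size cs = size s & x = lc cs s.
Proof.
elim: s x => [|y s IHs] x.
  by rewrite span_nil memv0 => /eqP->; exists [::].
rewrite span_cons => /memv_addP[_ /vlineP[c ->]] [z /IHs[cs szcs ->] ->].
by exists (c :: cs); rewrite /= ?szcs.
Qed.

(** The certificate behind every change of basis: the rows of [T] are the coordinates of [s] over
    [s'], and one equality of lists remains to be checked. *)
Lemma span_lc (T : seq (seq k)) s s' :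
  s = [seq lc cs s' | cs <- T] -> (<<s>> <= <<s'>>)%VS.
Proof.
by move->; apply/span_subvP=> _ /mapP[cs _ ->]; apply: lc_span.
Qed.

Lemma steinitz X S : free X -> (<<X>> <= <<S>>)%VS ->
  exists2 Z, (size X + size Z)%N = size S & (<<S>> <= <<X ++ Z>>)%VS.
Proof.
move=> freeX sXS; pose D := (<<S>> :\: <<X>>)%VS.
have dXD : (\dim <<X>> + \dim D = \dim <<S>>)%N.
  by rewrite addnC -(dimv_cap_compl <<S>>%VS <<X>>%VS) (capv_idPr sXS) addnC.
have dX : \dim <<X>> = size X by apply/eqP.
have leXD : (size X + \dim D <= size S)%N by rewrite -dX dXD dim_span.
(* If [S] is dependent, a basis of the complement is too short; the zero vectors restore the exact
   count. *)
exists (vbasis D ++ nseq (size S - (size X + \dim D)) 0).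
  by rewrite size_cat size_tuple size_nseq addnA subnKC.
rewrite catA [X in (_ <= X)%VS]span_cat (subv_trans _ (addvSl _ _)) //.
rewrite span_cat (span_basis (vbasisP D)) -(addv_diff_cap <<S>>%VS <<X>>%VS).
by rewrite addvC addvS // capvSr.
Qed.

Lemma free1 x : x != 0 -> free [:: x].
Proof. by move=> x0; rewrite seq1_free. Qed.

Lemma dep2 x y : ~~ free [:: x; y] ->
  exists z : V, [/\ z \in <<[:: x; y]>>%VS, exists a, x = a *: z & exists b, y = b *: z].
Proof.
have [-> _ | y0] := eqVneq y 0.
  exists x; split; first by apply: memv_span; rewrite inE eqxx.
    by exists 1; rewrite scale1r.
  by exists 0; rewrite scale0r.
rewrite free_cons seq1_free y0 andbT negbK span_seq1 => /vlineP[a ->].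
exists y; split; first by apply: memv_span; rewrite !inE eqxx orbT.
  by exists a.
by exists 1; rewrite scale1r.
Qed.

End LinearCombinations.

(** * Alternating matrices as elements of the exterior square *)

Section Wedge.

Variables (k : fieldType) (m : nat).
Hypothesis char_neq2 : 2%N \notin [pchar k].
Local Notation W := 'rV[k]_m.
Local Notation M := 'M[k]_m.
Implicit Types (u v w x y : W) (A B : M) (S X Z : seq W) (U : {vspace M}).

Definition wedge u v : M := \matrix_(i, j) (u 0 i * v 0 j - u 0 j * v 0 i).

Lemma wedgeDr u v w : wedge u (v + w) = wedge u v + wedge u w.
Proof. by apply/matrixP=> i j; rewrite !mxE; ring. Qed.
Lemma wedgeZr a u v : wedge u (a *: v) = a *: wedge u v.
Proof. by apply/matrixP=> i j; rewrite !mxE; ring. Qed.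
Lemma wedge_linear u : linear (wedge u).
Proof. by move=> a v w; rewrite wedgeDr wedgeZr. Qed.
HB.instance Definition _ u :=
  GRing.isLinear.Build k W M *:%R (wedge u) (wedge_linear u).

(** The exterior square of [<<S>>], built so that one generator at a time can be split off; by
    [ext2S] it depends only on the span. *)
Fixpoint ext2 S : {vspace M} :=
  if S is x :: S' then (<<[seq wedge x y | y <- S']>> + ext2 S')%VS else 0%VS.

Lemma lc_wedge x cs S : lc cs [seq wedge x y | y <- S] = wedge x (lc cs S).
Proof.
elim: S cs => [|y S IHS] [|c cs] /=; rewrite ?linear0 //.
by rewrite IHS linearD linearZ.
Qed.

Lemma ext2_consP x S A : A \in ext2 (x :: S) ->
  exists y B, [/\ y \in <<S>>%VS, B \in ext2 S & A = wedge x y + B].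
Proof.
case/memv_addP=> _ /spanP[cs _ ->] [B BS ->].
by exists (lc cs S), B; rewrite lc_wedge lc_span.
Qed.

Lemma wedge_ext2 S u v :
  u \in <<S>>%VS -> v \in <<S>>%VS -> wedge u v \in ext2 S.
Proof.
elim: S u v => [|x S IHS] u v.
  rewrite span_nil !memv0 => /eqP-> /eqP->.
  by rewrite linear0.
rewrite span_cons => /memv_addP[_ /vlineP[a ->]] [u' u'S ->].
move=> /memv_addP[_ /vlineP[b ->]] [v' v'S ->].
have -> : wedge (a *: x + u') (b *: x + v') =
          wedge x (a *: v' - b *: u') + wedge u' v'.
  by apply/matrixP=> i j; rewrite !mxE; ring.
apply: memv_add; last exact: IHS.
have /spanP[cs _ ->] : a *: v' - b *: u' \in <<S>>%VS by rewrite memvB ?memvZ.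
by rewrite -lc_wedge lc_span.
Qed.

Lemma ext2S S S' : (<<S>> <= <<S'>>)%VS -> (ext2 S <= ext2 S')%VS.
Proof.
elim: S => [|x S IHS] sSS' /=; first exact: sub0v.
have sS : (<<S>> <= <<S'>>)%VS.
  by apply: subv_trans sSS'; rewrite span_cons addvSr.
rewrite subv_add IHS // andbT; apply/span_subvP=> _ /mapP[y yS ->].
apply: wedge_ext2; last by apply: (subvP sS); apply: memv_span.
by apply: (subvP sSS'); apply: memv_span; rewrite inE eqxx.
Qed.

Lemma two_neq0 : 2%:R != 0 :> k.
Proof. by move: char_neq2; rewrite !inE. Qed.

(** An antisymmetric [A] is half the sum of the A i j times the wedge of the i-th and j-th unit
    vectors. *)
Lemma alt_ext2 S A : (fullv <= <<S>>)%VS -> A^T = - A -> A \in ext2 S.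
Proof.
move=> fullS altA.
have -> : A = \sum_i \sum_j (2%:R^-1 * A i j) *: wedge (delta_mx 0 i) (delta_mx 0 j).
  have dE i j : wedge (delta_mx 0 i) (delta_mx 0 j) =
      delta_mx i j - (delta_mx i j)^T :> M.
    by apply/matrixP=> s t; rewrite !mxE /= -!natrM !mulnb.
  under eq_bigr => i _ do under eq_bigr => j _ do rewrite dE -scalerA.
  under eq_bigr => i _ do rewrite -scaler_sumr.
  rewrite -scaler_sumr; apply: (scalerI two_neq0).
  rewrite scalerA mulfV ?two_neq0 // scale1r.
  under eq_bigr => i _ do under eq_bigr => j _ do rewrite scalerBr.
  under eq_bigr => i _ do rewrite sumrB.
  rewrite sumrB -matrix_sum_delta.
  have <- : A^T = \sum_i \sum_j A i j *: (delta_mx i j)^T.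
    rewrite {1}(matrix_sum_delta A) linear_sum; apply: eq_bigr => i _.
    by rewrite linear_sum; apply: eq_bigr => j _; rewrite linearZ.
  by rewrite altA opprK scaler_nat.
apply: memv_suml => i _; apply: memv_suml => j _; apply: memvZ.
by apply: wedge_ext2; apply: (subvP fullS); rewrite memvf.
Qed.

End Wedge.

(* Vector and matrix identities are checked entry by entry: the entries of the vectors act as
   indeterminates of an identity for [ring] or [field]. *)
Tactic Notation "entrywise" tactic3(tac) := apply/matrixP=> ? ?; rewrite !mxE; tac.
Ltac eq_lists tac :=
  lazymatch goal with
  | |- @eq (seq _) (cons _ _) _ => refine (f_equal2 cons _ _); [tac | eq_lists tac]
  | |- _ => reflexivity
  end.

Ltac fld := field; repeat (apply/andP; split); done.

Tactic Notation "lists" "by" tactic3(tac) := simpl; eq_lists ltac:(entrywise tac).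

(** * Codes and the tools of reduction *)

Section Codes.

Variables (k : fieldType) (m : nat).
Local Notation W := 'rV[k]_m.
Local Notation M := 'M[k]_m.
Implicit Types (u v w x y : W) (A B : M) (S X Z E g : seq W) (U : {vspace M}).

Definition wform g (f : seq (nat * nat)) : M :=
  foldr (fun p A => wedge g`_p.1 g`_p.2 + A) 0 f.

(** Inclusions suffice: [g] has m vectors and spans, hence is a basis, and [U] is the whole span of
    the forms as soon as [c] has [\dim U] entries. *)
Definition has_code U (c : seq (seq (nat * nat))) :=
  exists g, [/\ size g = m, (fullv <= <<g>>)%VS & (U <= <<map (wform g) c>>)%VS].

(** [T1] inverts the substitution, writing the known spanning list [E] in the new vectors [g]; [T2]
    writes the known generators [F] in the forms of the code. *)
Lemma has_code_lc g T1 T2 E (F : seq M) U c :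
    (fullv <= <<E>>)%VS -> (U <= <<F>>)%VS -> size g = m ->
    E = [seq lc cs g | cs <- T1] ->
    F = [seq lc cs (map (wform g) c) | cs <- T2] ->
  has_code U c.
Proof.
move=> fullE UF szg EE FE; exists g; split=> //.
  by apply: subv_trans fullE _; apply: span_lc EE.
by apply: subv_trans UF _; apply: span_lc FE.
Qed.

Lemma has_codeE g T2 (F : seq M) U c :
    (fullv <= <<g>>)%VS -> (U <= <<F>>)%VS -> size g = m ->
    F = [seq lc cs (map (wform g) c) | cs <- T2] ->
  has_code U c.
Proof.
move=> fullg UF szg FE; exists g; split=> //.
by apply: subv_trans UF _; apply: span_lc FE.
Qed.

Lemma span_catS (V : vectType k) (X S S' : seq V) :
  (<<S>> <= <<S'>>)%VS -> (<<X ++ S>> <= <<X ++ S'>>)%VS.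
Proof. by move=> sS; rewrite !span_cat addvS. Qed.

Lemma span_Scat (V : vectType k) (S S' X : seq V) :
  (<<S>> <= <<S'>>)%VS -> (<<S ++ X>> <= <<S' ++ X>>)%VS.
Proof. by move=> sS; rewrite !span_cat addvS. Qed.

Lemma few_generators (F : seq M) U : (U <= <<F>>)%VS -> (size F < \dim U)%N -> False.
Proof.
move=> UF; apply/negP; rewrite -leqNgt.
by apply: leq_trans (dimvS UF) (dim_span _).
Qed.

Lemma span_eqU (F : seq M) U : (U <= <<F>>)%VS -> size F = \dim U -> U = <<F>>%VS.
Proof.
move=> UF szF; apply/eqP; rewrite eqEdim UF /=.
by rewrite -szF dim_span.
Qed.

Definition indecomposable U := forall u v, wedge u v \in U -> wedge u v = 0.

(** The decomposable generator must vanish, and then fewer than [\dim U] generators are left. *)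
Lemma indecomposable_absurd U u v (F : seq M) : indecomposable U ->
  (size F).+1 = \dim U -> (U <= <<wedge u v :: F>>)%VS -> False.
Proof.
move=> indecU szF UF; have UE := span_eqU UF szF.
have uv0 : wedge u v = 0.
  by apply: indecU; rewrite UE; apply: memv_span; apply: mem_head.
apply: (@few_generators F U); last by rewrite -szF.
apply: subv_trans UF _; rewrite uv0 span_cons subv_add subvv andbT.
  by rewrite -memvE mem0v.
Qed.

Lemma steinitz1 (V : vectType k) (x : V) (S : seq V) : x != 0 -> x \in <<S>>%VS ->
  exists2 Z, (size Z).+1 = size S & (<<S>> <= <<x :: Z>>)%VS.
Proof.
move=> x0 xS; have sx : (<<[:: x]>> <= <<S>>)%VS by rewrite span_seq1 -memvE.
by have [Z szZ SZ] := steinitz (free1 x0) sx; exists Z.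
Qed.

Lemma steinitz2 (V : vectType k) (x y : V) (S : seq V) :
    free [:: x; y] -> x \in <<S>>%VS -> y \in <<S>>%VS ->
  exists2 Z, (size Z).+2 = size S & (<<S>> <= <<[:: x, y & Z]>>)%VS.
Proof.
move=> fxy xS yS; have sxy : (<<[:: x; y]>> <= <<S>>)%VS.
  by apply/span_subvP=> v; rewrite !inE => /orP[]/eqP->.
by have [Z szZ SZ] := steinitz fxy sxy; exists Z.
Qed.

Lemma ext2_pair p q A : A \in ext2 [:: p; q] -> exists d, A = d *: wedge p q.
Proof.
by rewrite /= !span_nil !addv0 span_seq1 => /vlineP.
Qed.

Lemma split2 e1 e2 z A : A \in ext2 (e1 :: e2 :: z) ->
  exists c x y B, [/\ x \in <<z>>%VS, y \in <<z>>%VS, B \in ext2 z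
    & A = c *: wedge e1 e2 + wedge e1 x + wedge e2 y + B].
Proof.
case/ext2_consP=> y [B [yz /ext2_consP[x [C [xz Cz ->]]] ->]].
move: yz; rewrite span_cons => /memv_addP[_ /vlineP[c ->]] [y' y'z ->].
exists c, y', x, C; split=> //.
by rewrite linearD linearZ addrA.
Qed.

(** A nonzero row extends to a matrix of determinant 1. The left side is kept a single monomial so
    that [ring: E] can use the equation as a rewriting rule. *)
Lemma sl2_complete (a b : k) : (a != 0) || (b != 0) ->
  exists c d, a * d = 1 + b * c.
Proof.
have [-> /= b0 | a0 _] := eqVneq a 0.
  by exists (- b^-1), 0; field.
by exists 0, a^-1; field.
Qed.

(** This turns e1 x + e2 y into the single product (a e1 + b e2) z. Determinant 1 makes a e1 + b e2,
    c e1 + d e2 a basis of the same plane with the same wedge product; z is 0 only if x and y both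
    are. *)
Lemma dep2_unimodular x y : ~~ free [:: x; y] ->
  exists a b c d z, [/\ a * d = 1 + b * c, z \in <<[:: x; y]>>%VS, x = a *: z & y = b *: z].
Proof.
case/dep2=> z [zxy [a xE] [b yE]].
have [/sl2_complete[c [d E]] |] := boolP ((a != 0) || (b != 0)).
  by exists a, b, c, d, z.
rewrite negb_or !negbK => /andP[/eqP a0 /eqP b0].
by exists 1, 0, 0, 1, 0; rewrite mem0v xE yE a0 b0 !scale0r scaler0; split=> //; ring.
Qed.

Lemma wedge_free u v : wedge u v != 0 -> free [:: u; v].
Proof.
apply: contraR => /dep2[z [_ [a ->] [b ->]]]; apply/eqP.
by entrywise ring.
Qed.

Lemma span_consP x y S : x \in <<y :: S>>%VS ->
  exists a x', x' \in <<S>>%VS /\ x = a *: y + x'.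
Proof.
by rewrite span_cons => /memv_addP[_ /vlineP[a ->]] [x' xS ->]; exists a, x'.
Qed.

(** The Darboux normal form of rank 2r. *)
Fixpoint std r S : M :=
  match r, S with
  | r'.+1, x :: y :: S' => wedge x y + std r' S'
  | _, _ => 0
  end.

Lemma std_rcons r S x : (r.*2 <= size S)%N -> std r (rcons S x) = std r S.
Proof.
elim: r S => [|r IHr] [|y [|z S]] //=.
by rewrite doubleS !ltnS => /IHr->.
Qed.

(** Darboux reduction. Write A = x y + B; if y is nonzero, complete it to a spanning list y, Z and
    split B = y z + C with C on Z. Then A = (x - z) y + C, and the induction continues with C, which
    involves two vectors fewer. If y = 0, the vector x moves to the end of the list. *)
Lemma ext2_std S A : A \in ext2 S ->
  exists r S', [/\ size S' = size S, (<<S>> <= <<S'>>)%VS, (r.*2 <= size S)%N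
    & A = std r S'].
Proof.
have [n] := ubnP (size S); elim: n S A => // n IHn [|x S] A /= ltSn.
  by rewrite memv0 => /eqP->; exists 0, [::].
case/ext2_consP=> y [B [yS BS ->]].
have [-> | y0] := eqVneq y 0.
  have [r [S' [szS' SS' ler ->]]] := IHn _ _ ltSn BS.
  exists r, (rcons S' x); split; rewrite ?size_rcons ?szS' ?(leqW ler) //.
    rewrite -cats1 span_cat span_cons span_seq1 addvC.
    by apply: addvS.
  by rewrite linear0 add0r std_rcons ?szS'.
have sy : (<<[:: y]>> <= <<S>>)%VS by rewrite span_seq1 -memvE.
have [Z szZ SZ] := steinitz (free1 y0) sy.
have /ext2_consP[z [C [zZ CZ ->]]] := subvP (ext2S SZ) _ BS.
have ltZ : (size Z < n)%N by rewrite -ltnS (leq_trans _ ltSn) // -szZ.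
have [r [S' [szS' SS' ler ->]]] := IHn _ _ ltZ CZ.
exists r.+1, (x - z :: y :: S'); split=> /=.
- by rewrite szS' -szZ.
- rewrite span_cons subv_add; apply/andP; split.
    rewrite -memvE -[X in X \in _](subrK z x); apply: memvD.
      by apply: memv_span; apply: mem_head.
    rewrite 2!span_cons; apply: subvP zZ.
    by apply: subv_trans SS' (subv_trans (addvSr _ _) (addvSr _ _)).
  apply: subv_trans SZ _; apply: (@subv_trans _ _ <<y :: S'>>%VS).
    by rewrite /= !span_cons addvS.
  by rewrite [X in (_ <= X)%VS]span_cons addvSr.
- by rewrite doubleS -szZ !ltnS.
by entrywise ring.
Qed.

End Codes.

(* The form [:: (a, b); (a', b')] stands for e_a e_b + e_a' e_b', for a basis e_0, ..., e_(m-1) of k^m;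
   the codes for m list the (8 - m)-dimensional spaces of alternating forms up to GL_m. *)
Definition codes m : seq (seq (seq (nat * nat))) :=
  match m with
  | 4 => [:: [:: [:: (0, 1)]; [:: (0, 2)]; [:: (0, 3)]; [:: (1, 2)]];
             [:: [:: (0, 1)]; [:: (0, 2)]; [:: (1, 3)]; [:: (2, 3)]];
             [:: [:: (0, 1)]; [:: (0, 2)]; [:: (0, 3); (1, 2)]; [:: (1, 3)]]]
  | 5 => [:: [:: [:: (0, 1)]; [:: (0, 2)]; [:: (0, 3)]];
             [:: [:: (0, 1)]; [:: (0, 2)]; [:: (1, 2)]];
             [:: [:: (0, 1)]; [:: (0, 2)]; [:: (0, 3); (1, 2)]];
             [:: [:: (0, 1)]; [:: (0, 2)]; [:: (1, 3)]];
             [:: [:: (0, 1)]; [:: (0, 2)]; [:: (0, 3); (1, 4)]];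
             [:: [:: (0, 1)]; [:: (0, 2); (1, 3)]; [:: (0, 3); (1, 4)]];
             [:: [:: (0, 1)]; [:: (0, 2); (1, 3)]; [:: (2, 3)]];
             [:: [:: (0, 1)]; [:: (1, 4)]; [:: (2, 3)]];
             [:: [:: (0, 1)]; [:: (0, 2); (1, 4)]; [:: (2, 3)]];
             [:: [:: (0, 1)]; [:: (1, 4)]; [:: (2, 3); (0, 4)]];
             [:: [:: (0, 1)]; [:: (0, 2); (1, 4)]; [:: (2, 3); (0, 4)]];
             [:: [:: (0, 1)]; [:: (1, 2)]; [:: (2, 3); (0, 4)]];
             [:: [:: (0, 1)]; [:: (0, 2); (1, 3)]; [:: (2, 3); (0, 4)]];
             [:: [:: (0, 1)]; [:: (2, 3)]; [:: (2, 4); (0, 4)]];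
             [:: [:: (0, 1)]; [:: (2, 3); (0, 4)]; [:: (2, 4); (1, 3)]];
             [:: [:: (0, 1)]; [:: (2, 3); (0, 4)]; [:: (2, 4); (1, 4)]];
             [:: [:: (0, 1)  ; (2, 3)]; [:: (0, 3); (2, 4)]; [:: (4, 1); (2, 0)]]]
  | 6 => [:: [:: [:: (0, 1)]; [:: (0, 2)]];
             [:: [:: (0, 1)]; [:: (0, 2); (1, 3)]];
             [:: [:: (0, 1)]; [:: (2, 3)]];
             [:: [:: (0, 1)]; [:: (2, 3); (0, 4)]];
             [:: [:: (0, 1)]; [:: (2, 3); (0, 4); (1, 5)]];
             [:: [:: (0, 1)]; [:: (2, 3); (4, 5)]];
             [:: [:: (0, 1); (2, 3)]; [:: (4, 5); (0, 1)]];
             [:: [:: (0, 1); (2, 3)]; [:: (4, 5); (0, 2)]];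
             [:: [:: (0, 1); (2, 3)]; [:: (0, 4); (1, 2)]];
             [:: [:: (0, 1); (2, 3)]; [:: (0, 4); (2, 5); (1, 3)]];
             [:: [:: (0, 1); (2, 3)]; [:: (0, 4); (2, 5)]]]
  | 7 => [:: [:: [:: (0, 1)]];
             [:: [:: (0, 1); (2, 3)]];
             [:: [:: (0, 1); (2, 3); (4, 5)]]]
  | 8 => [:: [::]]
  | _ => [::]
  end.

(** * Pencils of forms in six variables *)

Section Pencils.

Variables (k : closedFieldType).
Local Notation W := 'rV[k]_6.
Local Notation M := 'M[k]_6.
Implicit Types (u v w x y : W) (A B F G : M) (S X Z E g : seq W) (U : {vspace M}).

Definition classified m (U : {vspace 'M[k]_m}) :=
  exists2 c, c \in codes m & has_code U c.

(** Modulo the ideal of e1 and e2 the form G is a sum of r = 0, 1 or 2 products. Shifting the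
    vectors of these products by e1 and e2 absorbs the parts of x and y along them; what is left of
    x and y is independent, proportional or zero. Six codes result. *)
Lemma pencil_decomposable U e1 e2 z G : \dim U = 2%N -> size z = 4%N ->
  (fullv <= <<e1 :: e2 :: z>>)%VS -> (U <= <<[:: wedge e1 e2; G]>>)%VS ->
  G \in ext2 (e1 :: e2 :: z) -> classified U.
Proof.
move=> dimU szz fullE UF /split2[c [x [y [B [xz yz Bz GE]]]]]; subst G.
have [r [z' [szz' zz' ler BE]]] := ext2_std Bz; subst B.
have {}fullE : (fullv <= <<e1 :: e2 :: z'>>)%VS.
  by apply: subv_trans fullE _; apply: (@span_catS _ _ [:: e1; e2]).
have {xz} := subvP zz' _ xz; have {yz zz' Bz} := subvP zz' _ yz.
move: szz' fullE ler UF; rewrite szz => {szz z}.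
case: z' => [|e3 [|e4 [|e5 [|e6 []]]]] // _ fullE.
case: r => [|[|[|]]] // _ UF yz xz.
- have [fxy | /dep2_unimodular[a [b [a' [d [w [E wxy xE yE]]]]]]] := boolP (free [:: x; y]).
    have [[|p [|q []]] // _ sZ] := steinitz2 fxy xz yz.
    exists [:: [:: (0, 1)]; [:: (0, 2); (1, 3)]]%N; first by [].
    apply: (has_codeE (g := [:: e1; e2; x; y; p; q]) (T2 := [:: [:: 1; 0]; [:: c; 1]]) _ UF) => //.
      by apply: subv_trans fullE _; apply: (@span_catS _ _ [:: e1; e2]).
    by lists by ring.
  have wz : w \in <<[:: e3; e4; e5; e6]>>%VS.
    apply: subvP wxy; apply/span_subvP=> v; rewrite !inE => /orP[]/eqP-> //.
  subst x y.
  have [w0 | w0] := eqVneq w 0.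
    case: (@few_generators _ _ [:: wedge e1 e2] U); rewrite ?dimU //.
    apply: subv_trans UF _; apply: (@span_lc _ _ [:: [:: 1]; [:: c]]).
    by rewrite w0; lists by ring.
  have [[|p [|q [|r []]]] // _ sZ] := steinitz1 w0 wz.
  exists [:: [:: (0, 1)]; [:: (0, 2)]]%N; first by [].
  apply: (has_code_lc (g := [:: a *: e1 + b *: e2; a' *: e1 + d *: e2; w; p; q; r])
     (T1 := [:: [:: d; - b]; [:: - a'; a]; [:: 0; 0; 1]; [:: 0; 0; 0; 1]; [:: 0; 0; 0; 0; 1]; [:: 0; 0; 0; 0; 0; 1]])
      (E := [:: e1; e2; w; p; q; r]) (T2 := [:: [:: 1; 0]; [:: c; 1]]) _ UF) => //.
  - by apply: subv_trans fullE _; apply: (@span_catS _ _ [:: e1; e2]).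
  - by lists by ring: E.
  by lists by ring: E.
- have [x3 [x0 [/span_consP[x4 [x' [x'z ->]]] xE]]] := span_consP xz; subst x.
  have [y3 [y0 [/span_consP[y4 [y' [y'z ->]]] yE]]] := span_consP yz; subst y.
  (* The product e3' e4' is e3 e4 plus the terms of e1 x + e2 y along e3 and e4, up to a multiple of
     e1 e2. *)
  pose e3' := e3 + x4 *: e1 + y4 *: e2; pose e4' := e4 - x3 *: e1 - y3 *: e2.
  have [fxy | /dep2_unimodular[a [b [a' [d [w [E wxy xE yE]]]]]]] := boolP (free [:: x'; y']).
    have [[] // _ sZ] := steinitz2 fxy x'z y'z.
    exists [:: [:: (0, 1)]; [:: (2, 3); (0, 4); (1, 5)]]%N; first by [].
    apply: (has_code_lc (g := [:: e1; e2; e3'; e4'; x'; y'])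
       (T1 := [:: [:: 1]; [:: 0; 1]; [:: -x4; -y4; 1]; [:: x3; y3; 0; 1]; [:: 0; 0; 0; 0; 1]; [:: 0; 0; 0; 0; 0; 1]])
      (E := [:: e1; e2; e3; e4; x'; y']) (T2 := [:: [:: 1; 0]; [:: c + x4 * y3 - x3 * y4; 1]]) _ UF) => //.
    + by apply: subv_trans fullE _; apply: (@span_catS _ _ [:: e1; e2; e3; e4]).
    + by lists by ring.
    by lists by ring.
  have wz : w \in <<[:: e5; e6]>>%VS.
    by apply: subvP wxy; apply/span_subvP=> v; rewrite !inE => /orP[]/eqP->.
  have [w0 | w0] := eqVneq w 0.
    exists [:: [:: (0, 1)]; [:: (2, 3)]]%N; first by [].
    apply: (has_code_lc (g := [:: e1; e2; e3'; e4'; e5; e6])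
       (T1 := [:: [:: 1]; [:: 0; 1]; [:: -x4; -y4; 1]; [:: x3; y3; 0; 1]; [:: 0; 0; 0; 0; 1]; [:: 0; 0; 0; 0; 0; 1]])
      (E := [:: e1; e2; e3; e4; e5; e6]) (T2 := [:: [:: 1; 0]; [:: c + x4 * y3 - x3 * y4; 1]]) _ UF) => //.
    + by lists by ring.
    by rewrite xE yE w0; lists by ring.
  have [[|p []] // _ sZ] := steinitz1 w0 wz.
  exists [:: [:: (0, 1)]; [:: (2, 3); (0, 4)]]%N; first by [].
  apply: (has_code_lc (g := [:: a *: e1 + b *: e2; a' *: e1 + d *: e2; e3'; e4'; w; p])
     (T1 := [:: [:: d; - b]; [:: - a'; a]; [:: - x4 * d + y4 * a'; x4 * b - y4 * a; 1];
       [:: x3 * d - y3 * a'; - x3 * b + y3 * a; 0; 1]; [:: 0; 0; 0; 0; 1]; [:: 0; 0; 0; 0; 0; 1]])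
      (E := [:: e1; e2; e3; e4; w; p]) (T2 := [:: [:: 1; 0]; [:: c + x4 * y3 - x3 * y4; 1]]) _ UF) => //.
  + by apply: subv_trans fullE _; apply: (@span_catS _ _ [:: e1; e2; e3; e4]).
  + by lists by ring: E.
  by rewrite xE yE; lists by ring: E.
have [[|x3 [|x4 [|x5 [|x6 []]]]] // _ xE] := spanP xz; subst x.
have [[|y3 [|y4 [|y5 [|y6 []]]]] // _ yE] := spanP yz; subst y.
exists [:: [:: (0, 1)]; [:: (2, 3); (4, 5)]]%N; first by [].
apply: (has_code_lc (g := [:: e1; e2; e3 + x4 *: e1 + y4 *: e2; e4 - x3 *: e1 - y3 *: e2;
          e5 + x6 *: e1 + y6 *: e2; e6 - x5 *: e1 - y5 *: e2])
       (T1 := [:: [:: 1]; [:: 0; 1]; [:: -x4; -y4; 1]; [:: x3; y3; 0; 1]; [:: -x6; -y6; 0; 0; 1]; [:: x5; y5; 0; 0; 0; 1]])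
      (T2 := [:: [:: 1; 0]; [:: c + x4 * y3 - x3 * y4 + x6 * y5 - x5 * y6; 1]]) fullE UF) => //.
- by lists by ring.
by lists by ring.
Qed.

End Pencils.

(** * Forms in four variables, and degenerate members of pencils *)

Section Four.

Variables (k : closedFieldType) (m : nat).
Local Notation W := 'rV[k]_m.
Local Notation M := 'M[k]_m.
Implicit Types (u v w x y : W) (A B F G : M) (S X Z E g : seq W) (U : {vspace M}).

Lemma quadratic_root (b c : k) : exists t, t ^+ 2 + b * t + c = 0.
Proof.
have [t tE] := @solve_monicpoly k 2 (fun i => if i == 0 then - c else - b) isT.
exists t; rewrite tE !big_ord_recl big_ord0 /= expr0 expr1; ring.
Qed.

Lemma ext2_4 e1 e2 e3 e4 A : A \in ext2 [:: e1; e2; e3; e4] ->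
  exists a12 a13 a14 a23 a24 a34, A = a12 *: wedge e1 e2 + a13 *: wedge e1 e3
    + a14 *: wedge e1 e4 + a23 *: wedge e2 e3 + a24 *: wedge e2 e4 + a34 *: wedge e3 e4.
Proof.
case/split2=> a12 [x [y [B [/spanP[[|x3 [|x4 []]] // _ ->] /spanP[[|y3 [|y4 []]] // _ ->]]]]].
move=> /ext2_pair[a34 ->] ->; exists a12, x3, x4, y3, y4, a34.
by rewrite /=; entrywise ring.
Qed.

(** The Plücker relation suffices for decomposability: the factors are written down by dividing by
    the first nonzero coefficient, and the relation supplies the coefficient opposite to it. *)
Lemma pfaffian0_decomposable (a12 a13 a14 a23 a24 a34 : k) e1 e2 e3 e4 :
    a12 * a34 - a13 * a24 + a14 * a23 = 0 ->
  exists u v, [/\ u \in <<[:: e1; e2; e3; e4]>>%VS, v \in <<[:: e1; e2; e3; e4]>>%VS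
    & a12 *: wedge e1 e2 + a13 *: wedge e1 e3
    + a14 *: wedge e1 e4 + a23 *: wedge e2 e3 + a24 *: wedge e2 e4 + a34 *: wedge e3 e4
     = wedge u v].
Proof.
move=> pf0.
suff [cu [cv E]] : exists cu cv : seq k, a12 *: wedge e1 e2 + a13 *: wedge e1 e3
    + a14 *: wedge e1 e4 + a23 *: wedge e2 e3 + a24 *: wedge e2 e4 + a34 *: wedge e3 e4
     = wedge (lc cu [:: e1; e2; e3; e4]) (lc cv [:: e1; e2; e3; e4]).
  by exists (lc cu [:: e1; e2; e3; e4]), (lc cv [:: e1; e2; e3; e4]); rewrite !lc_span.
have [a12_0 | a12_0] := eqVneq a12 0; last first.
  have -> : a34 = (a13 * a24 - a14 * a23) / a12.
    by apply: (mulfI a12_0); rewrite mulrCA mulfV // mulr1 -[RHS]addr0 -pf0; ring.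
  exists [:: 1; 0; - a23 / a12; - a24 / a12], [:: 0; a12; a13; a14].
  by rewrite /=; entrywise fld.
rewrite {}a12_0 in pf0 *.
have [a13_0 | a13_0] := eqVneq a13 0; last first.
  have -> : a24 = a14 * a23 / a13.
    by apply: (mulfI a13_0); rewrite mulrCA mulfV // mulr1 -[LHS]addr0 -pf0; ring.
  exists [:: a13; a23; 0; - a34], [:: 0; 0; 1; a14 / a13].
  by rewrite /=; entrywise fld.
rewrite {}a13_0 in pf0 *.
have [a14_0 | a14_0] := eqVneq a14 0; last first.
  have -> : a23 = 0.
    by apply: (mulfI a14_0); rewrite mulr0 -pf0; ring.
  exists [:: a14; a24; a34], [:: 0; 0; 0; 1].
  by rewrite /=; entrywise ring.
rewrite a14_0.
have [a23_0 | a23_0] := eqVneq a23 0; last first.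
  exists [:: 0; a23; 0; - a34], [:: 0; 0; 1; a24 / a23].
  by rewrite /=; entrywise fld.
exists [:: 0; a24; a34], [:: 0; 0; 0; 1].
by rewrite /= a23_0; entrywise ring.
Qed.

(** The Pfaffian of the member with parameter t is a monic quadratic polynomial in t. *)
Lemma pencil4_decomposable e1 e2 e3 e4 A : A \in ext2 [:: e1; e2; e3; e4] ->
  exists t u v, [/\ u \in <<[:: e1; e2; e3; e4]>>%VS, v \in <<[:: e1; e2; e3; e4]>>%VS
    & A + t *: (wedge e1 e2 + wedge e3 e4) = wedge u v].
Proof.
case/ext2_4=> a12 [a13 [a14 [a23 [a24 [a34 ->]]]]].
have [t tE] := quadratic_root (a12 + a34) (a12 * a34 - a13 * a24 + a14 * a23).
have pf0 : (a12 + t) * (a34 + t) - a13 * a24 + a14 * a23 = 0 by rewrite -tE; ring.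
have [u [v [uS vS uvE]]] := pfaffian0_decomposable e1 e2 e3 e4 pf0.
by exists t, u, v; split=> //; rewrite -uvE; entrywise ring.
Qed.

(** The symplectic group is transitive on nonzero vectors. *)
Lemma symplectic_transitive e1 e2 e3 e4 x : x \in <<[:: e1; e2; e3; e4]>>%VS -> x != 0 ->
  exists f2 f3 f4, (<<[:: e1; e2; e3; e4]>> <= <<[:: x; f2; f3; f4]>>)%VS /\
    wedge e1 e2 + wedge e3 e4 = wedge x f2 + wedge f3 f4.
Proof.
move=> /spanP[[|a [|b [|c [|d []]]]] // _ ->].
have [/sl2_complete[a' [d' E]] _ | ] := boolP ((a != 0) || (b != 0)).
  (* The wedge of a e1 + b e2 with [n] is e1 e2; shifting e3 and e4 by multiples of [n] compensates
     for the part c e3 + d e4 of x. *)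
  pose n := a' *: e1 + d' *: e2.
  exists n, (e3 + d *: n), (e4 - c *: n); split.
    apply: (@span_lc _ _ [:: [:: d'; - b; - d' * c; - d' * d]; [:: - a'; a; a' * c; a' * d]; [:: 0; - d; 1]; [:: 0; c; 0; 1]]).
    by lists by ring: E.
  by rewrite /=; entrywise ring: E.
rewrite negb_or !negbK => /andP[/eqP-> /eqP->].
have [/sl2_complete[a' [d' E]] _ | ] := boolP ((c != 0) || (d != 0)).
  exists (a' *: e3 + d' *: e4), e1, e2; split.
    apply: (@span_lc _ _ [:: [:: 0; 0; 1]; [:: 0; 0; 0; 1]; [:: d'; - d]; [:: - a'; c]]).
    by lists by ring: E.
  by rewrite /=; entrywise ring: E.
rewrite negb_or !negbK => /andP[/eqP-> /eqP->].
by rewrite /= !scale0r !addr0 eqxx.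
Qed.

(** A Darboux form that uses up a whole basis is nondegenerate: [v *m wedge x y] is a combination of
    x and y whose coefficients are, up to sign, the pairings of [v] with y and x, so freeness makes
    [v] orthogonal to every basis vector. *)
Lemma std_singular r S : size S = r.*2 -> size S = m -> (fullv <= <<S>>)%VS ->
  forall v : W, v *m std r S = 0 -> v = 0.
Proof.
move=> szS szm fullS v.
pose dot (x : W) := (v *m x^T) 0 0.
have dotP c (x y : W) : dot (c *: x + y) = c * dot x + dot y.
  by rewrite /dot linearP mulmxDr -scalemxAr !mxE.
have wE (x y : W) : v *m wedge x y = dot x *: y - dot y *: x.
  have -> : wedge x y = x^T *m y - y^T *m x.
    by apply/matrixP=> i j; rewrite !mxE !big_ord1 !mxE; ring.
  by rewrite mulmxBr !mulmxA [v *m x^T]mx11_scalar [v *m y^T]mx11_scalar !mul_scalar_mx.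
have freeS : free S.
  rewrite /free; have /eqP -> : \dim <<S>> == size S; last exact: eqxx.
  rewrite eqn_leq dim_span szm /=.
  by have := dimvS fullS; rewrite dimvf /dim /= mul1n.
move=> v0; suff dot0 x : x \in S -> dot x = 0.
  suff d0 x : dot x = 0.
    apply/rowP=> j; rewrite mxE; have := d0 (delta_mx 0 j).
    by rewrite /dot -[v]/(v) trmx_delta -colE mxE.
  have /spanP[cs _ ->] := subvP fullS x (memvf x).
  have {x} : {subset S <= S} by [].
  elim: {1 3}S cs => [|x T IHT] [|c cs] /= sT; try by rewrite /dot trmx0 mulmx0 mxE.
  rewrite dotP dot0 ?sT ?mem_head // IHT ?mulr0 ?addr0 // => y yT.
  by apply: sT; rewrite inE yT orbT.
move: v0; elim: r S szS freeS {szm fullS} => [|r IHr] [|y [|z S]] //= [szS].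
rewrite mulmxDr wE => freeS v0.
have sS (T : seq W) : {subset T <= S} -> v *m std r T \in <<S>>%VS.
  elim: r T {IHr szS v0} => [|r IHr] [|a [|b T]] //= sT; rewrite ?mulmx0 ?mem0v //.
  rewrite mulmxDr wE memvD ?IHr //.
    by rewrite memvB // memvZ // memv_span // sT // !inE eqxx ?orbT.
  by move=> c cT; rewrite sT // !inE cT !orbT.
move: freeS; rewrite free_cons span_cons free_cons => /and3P[ny nz fS].
have sSS := sS _ (fun x h => h).
have yz0 : dot y *: z - dot z *: y = - (v *m std r S) by apply/eqP; rewrite -addr_eq0 v0.
have dz : dot z = 0.
  apply: contraNeq ny => dz; have -> : y = (dot z)^-1 *: (dot y *: z + v *m std r S).
    by rewrite -[v *m _]opprK -yz0 opprB addrC subrK scalerA mulVf // scale1r.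
  apply: memvZ; apply: memv_add => //; apply: memvZ; exact: memv_line.
have dy : dot y = 0.
  apply: contraNeq nz => dy; have -> : z = (dot y)^-1 *: - (v *m std r S).
    by rewrite -yz0 dz scale0r subr0 scalerA mulVf // scale1r.
  by apply: memvZ; rewrite memvN.
rewrite !inE => /or3P[/eqP-> //|/eqP-> //|xS].
apply: (IHr S) => //.
by move: v0; rewrite dy dz !scale0r subr0 add0r.
Qed.

(** Minus an eigenvalue of G F^-1 serves as t. *)
Lemma singular_member F G : (forall v : W, v *m F = 0 -> v = 0) -> (0 < m)%N ->
  exists t, exists2 v : W, v != 0 & v *m (G + t *: F) = 0.
Proof.
move=> Freg m0; have uF : F \in unitmx.
  rewrite -row_free_unit -kermx_eq0; apply/eqP/row_matrixP=> i.
  by rewrite row0; apply: Freg; rewrite -row_mul mulmx_ker row0.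
have /closed_rootP[t rt] : size (char_poly (G *m invmx F)) != 1%N.
  by rewrite size_char_poly eqSS -lt0n.
move: rt; rewrite -eigenvalue_root_char => /eigenvalueP[v vE v0].
exists (- t), v => //; rewrite mulmxDr -scalemxAr scaleNr.
by rewrite -[G in v *m G](mulmxKV uF) mulmxA vE -scalemxAl subrr.
Qed.

End Four.

Lemma full_seq (k : fieldType) m :
  exists2 S : seq 'rV[k]_m, size S = m & (fullv <= <<S>>)%VS.
Proof.
exists (vbasis {:'rV[k]_m}); first by rewrite size_tuple dimvf /dim /= mul1n.
by rewrite (span_basis (vbasisP _)).
Qed.

Lemma member_extend (k : fieldType) m (U : {vspace 'M[k]_m}) F : F \in U -> F != 0 ->
  exists2 Z, (size Z).+1 = \dim U & U = <<F :: Z>>%VS.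
Proof.
rewrite -{1}(span_basis (vbasisP U)) => FU F0.
have [Z szZ] := steinitz1 F0 FU; rewrite (span_basis (vbasisP U)) size_tuple in szZ *.
by move=> UF; exists Z => //; apply: span_eqU.
Qed.

(** * Pencils in six variables without decomposable member *)

Section IndecomposablePencils.

Variables (k : closedFieldType).
Hypothesis char_neq2 : 2%N \notin [pchar k].
Local Notation W := 'rV[k]_6.
Local Notation M := 'M[k]_6.
Implicit Types (u v w x y : W) (A B F G : M) (S X Z E g : seq W) (U : {vspace M}).

(** Rank 2 means decomposable, so nonzero members have rank 4 or 6. If one of them is regular, the
    pencil has a nonzero degenerate member, whose rank must be 4. *)
Lemma rank4_member U : (forall A, A \in U -> A^T = - A) -> \dim U = 2%N ->
  indecomposable U ->
  exists e1 e2 e3 e4 e5 e6, [/\ (fullv <= <<[:: e1; e2; e3; e4; e5; e6]>>)%VS,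
    wedge e1 e2 + wedge e3 e4 \in U & wedge e1 e2 + wedge e3 e4 != 0].
Proof.
move=> altU dimU indecU; have [S0 szS0 fullS0] := full_seq k 6.
have stdU A : A \in U -> A != 0 -> exists r S, [/\ size S = 6, (fullv <= <<S>>)%VS,
    A = std r S & r = 2 \/ r = 3].
  move=> AU A0; have [r [S [szS sS ler AE]]] := ext2_std (alt_ext2 char_neq2 fullS0 (altU _ AU)).
  exists r, S; rewrite szS szS0; split=> //; first exact: subv_trans fullS0 sS.
  move: ler; rewrite szS0 (leq_double r 3).
  case: r AE => [|[|[|[|]]]] // AE _; try by [left | right].
    by rewrite AE eqxx in A0.
  case: S AE {szS sS} => [|x [|y S]] /= AE; try by rewrite AE eqxx in A0.
  by move: AU A0; rewrite AE addr0 => /indecU->; rewrite eqxx.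
suff [A [AU A0 [S [szS fullS AE]]]] : exists A, [/\ A \in U, A != 0
    & exists S, [/\ size S = 6, (fullv <= <<S>>)%VS & A = std 2 S]].
  case: S szS fullS AE => [|e1 [|e2 [|e3 [|e4 [|e5 [|e6 []]]]]]] //= _ fullS AE.
  rewrite addr0 in AE.
  by exists e1, e2, e3, e4, e5, e6; rewrite -AE.
have fB := basis_free (vbasisP U); have BU := @vbasis_mem _ _ _ U.
have : size (vbasis U) = 2%N by rewrite size_tuple.
case: {2 3}(tval (vbasis U)) (erefl (tval (vbasis U))) => [|A [|B []]] //= BE _.
rewrite BE in fB; have {BU} [AU BU] : A \in U /\ B \in U.
  by split; apply: BU; rewrite memtE BE !inE eqxx ?orbT.
have A0 : A != 0 by apply: contraTneq fB => ->; rewrite free_cons mem0v.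
have [r [S [szS fullS AE [rE|rE]]]] := stdU _ AU A0; rewrite rE in AE.
  by exists A; split=> //; exists S.
have regA : forall v : W, v *m A = 0 -> v = 0.
  by rewrite AE; apply: std_singular.
have [t [v v0 vE]] := singular_member B regA isT.
have C0 : B + t *: A != 0.
  apply: contraTneq fB => /eqP; rewrite addr_eq0 => /eqP->.
  rewrite /free neq_ltn ltnS (leq_trans (dimvS (_ : _ <= <<[:: A]>>)%VS)) ?dim_span //.
  apply: (@span_lc _ _ [:: [:: 1]; [:: - t]]).
  by rewrite /= scale1r addr0 scaleNr addr0.
have [r' [S' [szS' fullS' CE [r'E|r'E]]]] := stdU _ (memvD BU (memvZ t AU)) C0; rewrite r'E in CE.
  by exists (B + t *: A); rewrite memvD ?memvZ //; split=> //; exists S'.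
rewrite CE in vE; case/eqP: v0; exact: std_singular vE.
Qed.

(** Let L be the span of e1, ..., e4, on which the rank 4 member F lives, and G = c e5 e6 + e5 x +
    e6 y + B with x, y in L and B on L. The cases are: c nonzero; c = 0 with x, y proportional; c =
    0 with x, y independent. In the last one the coefficient [be] tells whether x and y are
    orthogonal for the symplectic form that F induces on L. *)
Lemma pencil_indecomposable U : (forall A, A \in U -> A^T = - A) -> \dim U = 2%N ->
  indecomposable U -> classified U.
Proof.
move=> altU dimU indecU.
have [e1 [e2 [e3 [e4 [e5 [e6 [fullE FU F0]]]]]]] := rank4_member altU dimU indecU.
have [Z] := member_extend FU F0; rewrite dimU; case: Z => [|G []] // _ UE.
have UF : (U <= <<[:: (wedge e1 e2 + wedge e3 e4)%R; G]>>)%VS by rewrite {1}UE.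
have : G \in U by rewrite UE memv_span // !inE eqxx orbT.
move/altU/(alt_ext2 char_neq2) => altG.
have {altG} : G \in ext2 [:: e5, e6 & [:: e1; e2; e3; e4]].
  apply: altG; apply: subv_trans fullE _.
  apply: (@span_lc _ _ [:: [:: 0; 0; 1]; [:: 0; 0; 0; 1]; [:: 0; 0; 0; 0; 1]; [:: 0; 0; 0; 0; 0; 1]; [:: 1]; [:: 0; 1]]).
  by lists by ring.
have contra p q H : (U <= <<[:: wedge p q; H]>>)%VS -> classified U.
  by move/(indecomposable_absurd indecU) => []; rewrite ?dimU.
have FL : wedge e1 e2 + wedge e3 e4 \in ext2 [:: e1; e2; e3; e4].
  by rewrite memvD // wedge_ext2 // memv_span // !inE eqxx ?orbT.
case/split2=> c [x [y [B [xL yL BL GE]]]]; subst G.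
have [c0 | c0] := eqVneq c 0; last first.
  (* For the [E5] and [E6] posed below, c e5 e6 + e5 x + e6 y is E5 E6 + c^-1 y x. Adding a multiple
     of F then makes the part on L decomposable. *)
  have ByL : B + c^-1 *: wedge y x \in ext2 [:: e1; e2; e3; e4].
    by rewrite memvD ?memvZ // wedge_ext2.
  have [t [u [v [uL vL uvE]]]] := pencil4_decomposable ByL.
  pose E5 := e5 - c^-1 *: y; pose E6 := c *: e6 + x.
  have {}fullE : (fullv <= <<[:: e1; e2; e3; e4; E5; E6]>>)%VS.
    have [[|x1 [|x2 [|x3 [|x4 []]]]] // _ xE] := spanP xL.
    have [[|y1 [|y2 [|y3 [|y4 []]]]] // _ yE] := spanP yL.
    apply: subv_trans fullE _.
    apply: (@span_lc _ _ [:: [:: 1]; [:: 0; 1]; [:: 0; 0; 1]; [:: 0; 0; 0; 1];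
       [:: y1 / c; y2 / c; y3 / c; y4 / c; 1]; [:: - x1 / c; - x2 / c; - x3 / c; - x4 / c; 0; c^-1]]).
    by rewrite /E5 /E6 xE yE; lists by fld.
  have {uvE} BE : B = wedge u v - t *: (wedge e1 e2 + wedge e3 e4) - c^-1 *: wedge y x.
    by rewrite -uvE; entrywise ring.
  move: (wedge e1 e2 + wedge e3 e4) FL UF {UE FU F0} BE => F FL UF BE.
  have {BE BL ByL} UF' : (U <= <<[:: F; (wedge E5 E6 + wedge u v - t *: F)%R]>>)%VS.
    apply: subv_trans UF _; apply: (@span_lc _ _ [:: [:: 1]; [:: 0; 1]]).
    by rewrite BE /E5 /E6; lists by fld.
  move: E5 E6 fullE UF' => E5 E6 fullE {}UF {x y xL yL}.
  have [uv0 | /wedge_free fuv] := eqVneq (wedge u v) 0.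
    apply: (contra E5 E6 F); apply: subv_trans UF _.
    apply: (@span_lc _ _ [:: [:: 0; 1]; [:: 1; - t]]).
    by rewrite uv0; lists by ring.
  have [[|p [|q []]] // _ sL] := steinitz2 fuv uL vL.
  have {}fullE : (fullv <= <<[:: u; v; p; q; E5; E6]>>)%VS.
    by apply: subv_trans fullE _; apply: (@span_Scat _ _ _ _ [:: E5; E6] sL).
  have /split2[c' [x [y [D [xL yL /ext2_pair[d ->] FE]]]]] := subvP (ext2S sL) _ FL.
  (* [d] = 0 means that F lies in the ideal generated by u and v. *)
  have [d0 | d0] := eqVneq d 0.
    have [fxy | /dep2_unimodular[a [b [a' [d' [w [E wxy xE yE]]]]]]] := boolP (free [:: x; y]).
      have [[] // _ sZ] := steinitz2 fxy xL yL.
      exists [:: [:: (0, 1); (2, 3)]; [:: (4, 5); (0, 2)]]%N; first by [].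
      apply: (has_code_lc (g := [:: u; x + c' *: v; v; y; E5; E6])
         (T1 := [:: [:: 1]; [:: 0; 0; 1]; [:: 0; 1; - c']; [:: 0; 0; 0; 1]; [:: 0; 0; 0; 0; 1]; [:: 0; 0; 0; 0; 0; 1]])
         (E := [:: u; v; x; y; E5; E6]) (T2 := [:: [:: 1]; [:: - t; 1]]) _ UF) => //.
      - apply: subv_trans fullE _; apply: (@span_catS _ _ [:: u; v]).
        exact: (@span_Scat _ _ _ _ [:: E5; E6] sZ).
      - by lists by ring.
      by rewrite FE d0; lists by ring.
    apply: (contra (a *: u + b *: v) (c' *: (a' *: u + d' *: v) + w) (wedge E5 E6 + wedge u v - t *: F)%R).
    apply: subv_trans UF _; apply: (@span_lc _ _ [:: [:: 1]; [:: 0; 1]]).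
    by rewrite FE d0 xE yE; lists by ring: E.
  have [[|x3 [|x4 []]] // _ xE] := spanP xL.
  have [[|y3 [|y4 []]] // _ yE] := spanP yL.
  pose P := p + (x4 / d) *: u + (y4 / d) *: v; pose Q := d *: q - x3 *: u - y3 *: v.
  have {}FE : F = (c' + (x4 * y3 - y4 * x3) / d) *: wedge u v + wedge P Q.
    by rewrite FE /P /Q xE yE /=; entrywise fld.
  have {}fullE : (fullv <= <<[:: u; v; P; Q; E5; E6]>>)%VS.
    apply: subv_trans fullE _.
    apply: (@span_lc _ _ [:: [:: 1]; [:: 0; 1]; [:: - x4 / d; - y4 / d; 1]; [:: x3 / d; y3 / d; 0; d^-1]; [:: 0; 0; 0; 0; 1]; [:: 0; 0; 0; 0; 0; 1]]).
    by lists by fld.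
  move: P Q (c' + _) FE fullE => P Q s FE fullE.
  have [s0 | s0] := eqVneq s 0.
    apply: (contra P Q (wedge E5 E6 + wedge u v - t *: F)%R); apply: subv_trans UF _.
    apply: (@span_lc _ _ [:: [:: 1]; [:: 0; 1]]).
    by rewrite FE s0; lists by ring.
  exists [:: [:: (0, 1); (2, 3)]; [:: (4, 5); (0, 1)]]%N; first by [].
  apply: (has_code_lc (g := [:: u; v; s^-1 *: P; Q; E5; E6])
     (T1 := [:: [:: 1]; [:: 0; 1]; [:: 0; 0; s]; [:: 0; 0; 0; 1]; [:: 0; 0; 0; 0; 1]; [:: 0; 0; 0; 0; 0; 1]])
     (T2 := [:: [:: s]; [:: - t * s; 1]]) fullE UF) => //.
    by lists by fld.
  by rewrite FE; lists by fld.
subst c.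
have [fxy | /dep2_unimodular[a [b [a' [d' [z [E zxy xE yE]]]]]]] := boolP (free [:: x; y]); last first.
  have zL : z \in <<[:: e1; e2; e3; e4]>>%VS.
    by apply: subvP zxy; apply/span_subvP=> w; rewrite !inE => /orP[]/eqP->.
  subst x y; have [z0 | z0] := eqVneq z 0.
    have [t [u [v [uL vL uvE]]]] := pencil4_decomposable BL.
    apply: (contra u v (wedge e1 e2 + wedge e3 e4)); apply: subv_trans UF _.
    apply: (@span_lc _ _ [:: [:: 0; 1]; [:: 1; - t]]).
    by rewrite -uvE z0; lists by ring.
  have [f2 [f3 [f4 [sL FE]]]] := symplectic_transitive zL z0.
  have {}fullE : (fullv <= <<[:: z; f2; f3; f4; e5; e6]>>)%VS.
    by apply: subv_trans fullE _; apply: (@span_Scat _ _ _ _ [:: e5; e6] sL).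
  have /ext2_4[b12 [b13 [b14 [b23 [b24 [b34 BE]]]]]] := subvP (ext2S sL) _ BL.
  (* Subtracting b34 F removes f3 f4 from G; what remains is z E5 + f2 (b23 f3 + b24 f4). *)
  pose E5 := (b12 - b34) *: f2 + b13 *: f3 + b14 *: f4 - (a *: e5 + b *: e6).
  have [/sl2_complete[c [d E']] | ] := boolP ((b23 != 0) || (b24 != 0)); last first.
    rewrite negb_or !negbK => /andP[/eqP b23_0 /eqP b24_0].
    apply: (contra z E5 (wedge e1 e2 + wedge e3 e4)); apply: subv_trans UF _.
    apply: (@span_lc _ _ [:: [:: 0; 1]; [:: 1; b34]]).
    by rewrite BE FE b23_0 b24_0; lists by ring.
  exists [:: [:: (0, 1); (2, 3)]; [:: (0, 4); (1, 2)]]%N; first by [].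
  apply: (has_code_lc (g := [:: z; f2; b23 *: f3 + b24 *: f4; c *: f3 + d *: f4; E5; a' *: e5 + d' *: e6])
     (T1 := [:: [:: 1]; [:: 0; 1]; [:: 0; 0; d; - b24]; [:: 0; 0; - c; b23];
           [:: 0; d' * (b12 - b34); d' * (b13 * d - b14 * c); d' * (b14 * b23 - b13 * b24); - d'; - b];
           [:: 0; - a' * (b12 - b34); - a' * (b13 * d - b14 * c); - a' * (b14 * b23 - b13 * b24); a'; a]])
     (T2 := [:: [:: 1]; [:: b34; 1]]) fullE UF) => //.
    by lists by ring: E E'.
  by rewrite BE FE; lists by ring: E'.
have x0 : x != 0 by apply: contraTneq fxy => ->; rewrite free_cons mem0v.
have [f2 [f3 [f4 [sL FE]]]] := symplectic_transitive xL x0.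
have {}fullE : (fullv <= <<[:: x; f2; f3; f4; e5; e6]>>)%VS.
  by apply: subv_trans fullE _; apply: (@span_Scat _ _ _ _ [:: e5; e6] sL).
rewrite {}FE in UF; have {yL BL} [yL BL] := (subvP sL _ yL, subvP (ext2S sL) _ BL).
have [[|al [|be [|ga [|de []]]]] // _ yE] := spanP yL.
have [be0 | be0] := eqVneq be 0; last first.
  (* When x and y are not orthogonal they form a hyperbolic pair for a multiple of F: be F = x y + P
     Q. *)
  pose P := be *: f3 - de *: x; pose Q := f4 + (ga / be) *: x.
  have sf : (<<[:: x; f2; f3; f4]>> <= <<[:: x; y; P; Q]>>)%VS.
    apply: (@span_lc _ _ [:: [:: 1]; [:: - al / be; be^-1; - ga / be / be; - de / be]; [:: de / be; 0; be^-1]; [:: - ga / be; 0; 0; 1]]).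
    by rewrite /P /Q yE; lists by fld.
  have {}fullE : (fullv <= <<[:: x; y; P; Q; e5; e6]>>)%VS.
    by apply: subv_trans fullE _; apply: (@span_Scat _ _ _ _ [:: e5; e6] sf).
  have FE : wedge x f2 + wedge f3 f4 = be^-1 *: (wedge x y + wedge P Q).
    by rewrite /P /Q yE; entrywise fld.
  move: P Q sf fullE FE => P Q sf fullE FE; rewrite {}FE in UF.
  have /split2[b [_ [_ [_ [/spanP[[|p1 [|p2 []]] // _ ->] /spanP[[|q1 [|q2 []]] // _ ->] /ext2_pair[d ->] BE]]]]] :=
    subvP (ext2S sf) _ BL.
  exists [:: [:: (0, 1); (2, 3)]; [:: (4, 5); (0, 2)]]%N; first by [].
  apply: (has_code_lc (g := [:: x; p1 *: P + p2 *: Q - e5 + (b - d) *: y; y; q1 *: P + q2 *: Q - e6; P; Q])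
     (T1 := [:: [:: 1]; [:: 0; 0; 1]; [:: 0; 0; 0; 0; 1]; [:: 0; 0; 0; 0; 0; 1];
           [:: 0; - 1; b - d; 0; p1; p2]; [:: 0; 0; 0; -1; q1; q2]])
     (T2 := [:: [:: 0; be^-1]; [:: 1; d]]) fullE UF) => //.
    by lists by ring.
  by rewrite BE; lists by ring.
have /sl2_complete[c [d E]] : (ga != 0) || (de != 0).
  apply: contraTT fxy; rewrite negb_or !negbK => /andP[/eqP ga0 /eqP de0].
  rewrite /free neq_ltn ltnS (leq_trans (dimvS (_ : _ <= <<[:: x]>>)%VS)) ?dim_span //.
  apply: (@span_lc _ _ [:: [:: 1]; [:: al]]).
  by rewrite yE be0 ga0 de0; lists by ring.
pose h3 := ga *: f3 + de *: f4; pose h4 := c *: f3 + d *: f4.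
have {}yE : y = al *: x + h3 by rewrite yE be0 /h3; entrywise ring.
have sf : (<<[:: x; f2; f3; f4]>> <= <<[:: x; h3; f2; h4]>>)%VS.
  apply: (@span_lc _ _ [:: [:: 1]; [:: 0; 0; 1]; [:: 0; d; 0; - de]; [:: 0; - c; 0; ga]]).
  by rewrite /h3 /h4; lists by ring: E.
have {}fullE : (fullv <= <<[:: x; h3; f2; h4; e5; e6]>>)%VS.
  by apply: subv_trans fullE _; apply: (@span_Scat _ _ _ _ [:: e5; e6] sf).
have FE : wedge f3 f4 = wedge h3 h4.
  by rewrite /h3 /h4; entrywise ring: E.
move: h3 h4 sf fullE FE yE => h3 h4 sf fullE FE yE; rewrite {}FE in UF.
have /split2[b [_ [_ [_ [/spanP[[|p1 [|p2 []]] // _ ->] /spanP[[|q1 [|q2 []]] // _ ->] /ext2_pair[s ->] BE]]]]] :=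
    subvP (ext2S sf) _ BL.
(* [E5] and [E6] are the cofactors of x and h3 in G; apart from x E5 + h3 E6 only s f2 h4
   remains. *)
pose E5 := p1 *: f2 + p2 *: h4 - e5 - al *: e6 + b *: h3; pose E6 := q1 *: f2 + q2 *: h4 - e6.
have {}fullE : (fullv <= <<[:: x; f2; h3; h4; E5; E6]>>)%VS.
  apply: subv_trans fullE _.
  apply: (@span_lc _ _ [:: [:: 1]; [:: 0; 0; 1]; [:: 0; 1]; [:: 0; 0; 0; 1];
         [:: 0; p1 - al * q1; b; p2 - al * q2; - 1; al]; [:: 0; q1; 0; q2; 0; - 1]]).
  by lists by ring.
have {BE yE} GE : 0 *: wedge e5 e6 + wedge e5 x + wedge e6 y + B =
    wedge x E5 + wedge h3 E6 + s *: wedge f2 h4.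
  by rewrite BE yE; entrywise ring.
rewrite {}GE in UF; have [s0 | s0] := eqVneq s 0.
  exists [:: [:: (0, 1); (2, 3)]; [:: (0, 4); (2, 5)]]%N; first by [].
  apply: (has_codeE (T2 := [:: [:: 1]; [:: 0; 1]]) fullE UF) => //.
  by rewrite s0; lists by ring.
exists [:: [:: (0, 1); (2, 3)]; [:: (0, 4); (2, 5); (1, 3)]]%N; first by [].
apply: (has_code_lc (g := [:: s^-1 *: x; s *: f2; h3; h4; s *: E5; E6])
   (T1 := [:: [:: s]; [:: 0; s^-1]; [:: 0; 0; 1]; [:: 0; 0; 0; 1]; [:: 0; 0; 0; 0; s^-1]; [:: 0; 0; 0; 0; 0; 1]])
   (T2 := [:: [:: 1]; [:: 0; 1]]) fullE UF) => //.
  by lists by fld.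
by lists by fld.
Qed.

End IndecomposablePencils.

Lemma span_sl2 (k : fieldType) m (a b c d : k) (x y : 'rV[k]_m) : a * d = 1 + b * c ->
  (<<[:: x; y]>> <= <<[:: (a *: x + b *: y)%R; (c *: x + d *: y)%R]>>)%VS.
Proof.
move=> E; apply: (@span_lc _ _ [:: [:: d; - b]; [:: - c; a]]).
by lists by ring: E.
Qed.

Section Free2.
Variables (k : fieldType) (V : vectType k).
Implicit Types x y z : V.

Lemma det0_dep (a b c d : k) x y : a * d - b * c = 0 ->
  ~~ free [:: a *: x + b *: y; c *: x + d *: y].
Proof.
move=> D0; rewrite /free neq_ltn ltnS.
have dim1 z : (<<[:: (a *: x + b *: y)%R; (c *: x + d *: y)%R]>> <= <<[:: z]>>)%VS ->
    (\dim <<[:: (a *: x + b *: y)%R; (c *: x + d *: y)%R]>> <= 1)%N.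
  by move=> sz; rewrite (leq_trans (dimvS sz)) ?dim_span.
have [a0 | a0] := eqVneq a 0; last first.
  rewrite (dim1 (a *: x + b *: y)) //; apply: (@span_lc _ _ [:: [:: 1]; [:: c / a]]).
  rewrite /= !addr0 scale1r scalerDr !scalerA divfK //.
  by rewrite (_ : c / a * b = d) // -[d](mulfK a0) mulrC (mulrC d) (subr0_eq D0); field.
have [b0 | b0] := eqVneq b 0; last first.
  rewrite (dim1 (a *: x + b *: y)) //; apply: (@span_lc _ _ [:: [:: 1]; [:: d / b]]).
  rewrite /= !addr0 scale1r scalerDr !scalerA divfK //.
  by rewrite (_ : d / b * a = c) // -[c](mulfK b0) mulrC (mulrC c) -(subr0_eq D0); field.
rewrite (dim1 (c *: x + d *: y)) //; apply: (@span_lc _ _ [:: [:: 0]; [:: 1]]).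
by rewrite /= a0 b0 !scale0r scale1r !addr0.
Qed.

Lemma dep_multiple x y : x != 0 -> ~~ free [:: x; y] -> exists a, y = a *: x.
Proof.
move=> x0 /dep2[z [_ [a xE] [b yE]]].
have a0 : a != 0 by apply: contraNneq x0 => a0; rewrite xE a0 scale0r.
by exists (b / a); rewrite xE yE scalerA divfK.
Qed.

End Free2.

(** * Nets of forms in five variables containing a decomposable one *)

Section DecomposableNets.

Variables (k : closedFieldType).
Local Notation W := 'rV[k]_5.
Local Notation M := 'M[k]_5.
Implicit Types (u v w x y z : W) (A B F G H : M) (S X Z E g : seq W).
Variable U : {vspace M}.
Hypothesis dimU : \dim U = 3%N.

Lemma two_generators A B : (U <= <<[:: A; B]>>)%VS -> classified U.
Proof. by move=> UF; case: (few_generators UF); rewrite dimU. Qed.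

(** With e1 e2 and e1 e3 present, the third form matters only through x modulo e3 and y. The five
    outcomes depend on whether x' and y' are independent, both zero or proportional, and then on [b]
    and [y3]. *)
Lemma net_rank1 e1 e2 e3 e4 e5 c x y :
    (fullv <= <<[:: e1; e2; e3; e4; e5]>>)%VS ->
    x \in <<[:: e3; e4; e5]>>%VS -> y \in <<[:: e3; e4; e5]>>%VS ->
    (U <= <<[:: wedge e1 e2; wedge e1 e3; (c *: wedge e1 e2 + wedge e1 x + wedge e2 y)%R]>>)%VS ->
  classified U.
Proof.
move=> fullE /span_consP[x3 [x' [xL ->]]] /span_consP[y3 [y' [yL ->]]] UF.
have [fxy | /dep2_unimodular[a [b [a' [d [z [E zxy xE yE]]]]]]] := boolP (free [:: x'; y']).
  have [[] // _ sZ] := steinitz2 fxy xL yL.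
  exists [:: [:: (0, 1)]; [:: (0, 2)]; [:: (0, 3); (1, 4)]]%N; first by [].
  apply: (has_code_lc (g := [:: e1; e2; e3; x'; y' + y3 *: e3])
    (E := [:: e1; e2; e3; x'; y'])
    (T1 := [:: [:: 1]; [:: 0; 1]; [:: 0; 0; 1]; [:: 0; 0; 0; 1]; [:: 0; 0; - y3; 0; 1]])
    (T2 := [:: [:: 1]; [:: 0; 1]; [:: c; x3; 1]]) _ UF) => //.
  - by apply: subv_trans fullE _; apply: (@span_catS _ _ [:: e1; e2; e3]).
  - by lists by ring.
  by lists by ring.
have zL : z \in <<[:: e4; e5]>>%VS.
  by apply: subvP zxy; apply/span_subvP=> w; rewrite !inE => /orP[]/eqP->.
subst x' y'; have [z0 | z0] := eqVneq z 0.
  have [y0 | y0] := eqVneq y3 0.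
    apply: (two_generators (A := wedge e1 e2) (B := wedge e1 e3)).
    apply: subv_trans UF _; apply: (@span_lc _ _ [:: [:: 1]; [:: 0; 1]; [:: c; x3]]).
    by rewrite z0 y0; lists by ring.
  exists [:: [:: (0, 1)]; [:: (0, 2)]; [:: (1, 2)]]%N; first by [].
  apply: (has_codeE (T2 := [:: [:: 1]; [:: 0; 1]; [:: c; x3; y3]]) fullE UF) => //.
  by rewrite z0; lists by ring.
have [[|p []] // _ sZ] := steinitz1 z0 zL.
have {}fullE : (fullv <= <<[:: e1; e2; e3; z; p]>>)%VS.
  by apply: subv_trans fullE _; apply: (@span_catS _ _ [:: e1; e2; e3]).
have [b0 | b0] := eqVneq b 0; last first.
  exists [:: [:: (0, 1)]; [:: (0, 2)]; [:: (1, 3)]]%N; first by [].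
  apply: (has_code_lc (g := [:: e1; e2 + (a / b) *: e1; e3; b *: z + y3 *: e3; p])
    (T1 := [:: [:: 1]; [:: - a / b; 1]; [:: 0; 0; 1]; [:: 0; 0; - y3 / b; b^-1]; [:: 0; 0; 0; 0; 1]])
    (T2 := [:: [:: 1]; [:: 0; 1]; [:: c; x3 - a / b * y3; 1]]) fullE UF) => //.
    by lists by fld.
  by lists by fld.
have a0 : a != 0.
  by apply: contra_eqN E => /eqP->; rewrite b0 !mul0r addr0 eq_sym oner_eq0.
have [y0 | y0] := eqVneq y3 0.
  exists [:: [:: (0, 1)]; [:: (0, 2)]; [:: (0, 3)]]%N; first by [].
  apply: (has_codeE (T2 := [:: [:: 1]; [:: 0; 1]; [:: c; x3; a]]) fullE UF) => //.
  by rewrite y0 b0; lists by ring.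
exists [:: [:: (0, 1)]; [:: (0, 2)]; [:: (0, 3); (1, 2)]]%N; first by [].
apply: (has_code_lc (g := [:: e1; e2; y3 *: e3; a *: z; p])
  (T1 := [:: [:: 1]; [:: 0; 1]; [:: 0; 0; y3^-1]; [:: 0; 0; 0; a^-1]; [:: 0; 0; 0; 0; 1]])
  (T2 := [:: [:: 1]; [:: 0; y3^-1]; [:: c; x3 / y3; 1]]) fullE UF) => //.
  by lists by fld.
by rewrite b0; lists by fld.
Qed.

(* L is the plane <<[:: e1; e2]>>: every form of the net lies in the ideal it generates. *)
Lemma net_L_dep e1 e2 Z c x y c' x' y' : size Z = 3%N ->
    (fullv <= <<e1 :: e2 :: Z>>)%VS ->
    x \in <<Z>>%VS -> y \in <<Z>>%VS -> x' \in <<Z>>%VS -> y' \in <<Z>>%VS ->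
    ~~ free [:: x; y] ->
    (U <= <<[:: wedge e1 e2; (c *: wedge e1 e2 + wedge e1 x + wedge e2 y)%R;
           (c' *: wedge e1 e2 + wedge e1 x' + wedge e2 y')%R]>>)%VS ->
  classified U.
Proof.
move=> szZ fullE xz yz x'z y'z /dep2_unimodular[a [b [a' [d [w [E wxy xE yE]]]]]] UF.
have {xz yz} wz : w \in <<Z>>%VS.
  by apply: subvP wxy; apply/span_subvP=> v; rewrite !inE => /orP[]/eqP->.
subst x y; have [w0 | w0] := eqVneq w 0.
  apply: (two_generators (A := wedge e1 e2) (B := c' *: wedge e1 e2 + wedge e1 x' + wedge e2 y')).
  apply: subv_trans UF _; apply: (@span_lc _ _ [:: [:: 1]; [:: c]; [:: 0; 1]]).
  by rewrite w0; lists by ring.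
have [[|p [|q []]]] := steinitz1 w0 wz; rewrite szZ // => _ sZ.
apply: (@net_rank1 (a *: e1 + b *: e2) (a' *: e1 + d *: e2) w p q c'
          (d *: x' - a' *: y') (a *: y' - b *: x')).
- apply: subv_trans fullE _; apply: (@subv_trans _ _ <<[:: e1; e2; w; p; q]>>%VS).
    exact: (@span_catS _ _ [:: e1; e2]).
  exact: (@span_Scat _ _ _ _ [:: w; p; q] (span_sl2 _ _ E)).
- by rewrite memvB // memvZ // (subvP sZ).
- by rewrite memvB // memvZ // (subvP sZ).
apply: subv_trans UF _; apply: (@span_lc _ _ [:: [:: 1]; [:: c; 1]; [:: 0; 0; 1]]).
by lists by ring: E.
Qed.

(** Subtracting m22 times the second form and moving the terms e1 e3 and e1 e4 into e5 leaves only
    m21 e2 e3. If m21 = 0, the net has a second form with factor e1 and [net_rank1] applies. *)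
Lemma net_L_split e1 e2 e3 e4 e5 x y : (fullv <= <<[:: e1; e2; e3; e4; e5]>>)%VS ->
    x \in <<[:: e3; e4]>>%VS -> y \in <<[:: e3; e4]>>%VS ->
    (U <= <<[:: wedge e1 e2; (wedge e1 e3 + wedge e2 e4)%R;
                (wedge e1 (e5 + x) + wedge e2 y)%R]>>)%VS ->
  classified U.
Proof.
move=> fullE /spanP[[|m11 [|m12 []]] // _ ->] /spanP[[|m21 [|m22 []]] // _ ->] UF.
pose w := e5 + (m11 - m22) *: e3 + m12 *: e4.
have {}fullE : (fullv <= <<[:: e1; e2; e3; e4; w]>>)%VS.
  apply: subv_trans fullE _.
  apply: (@span_lc _ _ [:: [:: 1]; [:: 0; 1]; [:: 0; 0; 1]; [:: 0; 0; 0; 1]; [:: 0; 0; m22 - m11; - m12; 1]]).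
  by rewrite /w; lists by ring.
have {}UF : (U <= <<[:: wedge e1 e2; (wedge e1 e3 + wedge e2 e4)%R; (wedge e1 w + m21 *: wedge e2 e3)%R]>>)%VS.
  apply: subv_trans UF _; apply: (@span_lc _ _ [:: [:: 1]; [:: 0; 1]; [:: 0; m22; 1]]).
  by rewrite /w; lists by ring.
move: w UF fullE => {}e5 UF fullE.
have [s0 | s0] := eqVneq m21 0.
  apply: (@net_rank1 e1 e2 e5 e3 e4 0 e3 e4); last first.
  - apply: subv_trans UF _; apply: (@span_lc _ _ [:: [:: 1]; [:: 0; 0; 1]; [:: 0; 1]]).
    by rewrite s0; lists by ring.
  - by rewrite memv_span // !inE eqxx !orbT.
  - by rewrite memv_span // !inE eqxx !orbT.
  apply: subv_trans fullE _.
  apply: (@span_lc _ _ [:: [:: 1]; [:: 0; 1]; [:: 0; 0; 0; 1]; [:: 0; 0; 0; 0; 1]; [:: 0; 0; 1]]).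
  by lists by ring.
exists [:: [:: (0, 1)]; [:: (0, 2); (1, 3)]; [:: (0, 3); (1, 4)]]%N; first by [].
apply: (has_code_lc (g := [:: e2; e1; e4; e3; m21^-1 *: e5])
  (T1 := [:: [:: 0; 1]; [:: 1]; [:: 0; 0; 0; 1]; [:: 0; 0; 1]; [:: 0; 0; 0; 0; m21]])
  (T2 := [:: [:: - 1]; [:: 0; 1]; [:: 0; 0; m21]]) fullE UF) => //.
  by lists by fld.
by lists by fld.
Qed.

(** Modulo e1 e2 this is a pencil of 2 by 3 matrices with rows x, y and x', y'. If x' and y' stay in
    the plane of x and y, an eigenvalue of their coordinate matrix gives a member of rank one;
    otherwise the coefficients (p3, q3) of z single out the vector l that multiplies z. *)
Lemma net_L e1 e2 e3 e4 e5 c x y c' x' y' :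
    (fullv <= <<[:: e1; e2; e3; e4; e5]>>)%VS ->
    x \in <<[:: e3; e4; e5]>>%VS -> y \in <<[:: e3; e4; e5]>>%VS ->
    x' \in <<[:: e3; e4; e5]>>%VS -> y' \in <<[:: e3; e4; e5]>>%VS ->
    (U <= <<[:: wedge e1 e2; (c *: wedge e1 e2 + wedge e1 x + wedge e2 y)%R;
           (c' *: wedge e1 e2 + wedge e1 x' + wedge e2 y')%R]>>)%VS ->
  classified U.
Proof.
move=> fullE xz yz x'z y'z UF.
have [fxy | nfxy] := boolP (free [:: x; y]); last first.
  by apply: (@net_L_dep e1 e2 [:: e3; e4; e5] c x y c' x' y').
have [[|z []] // _ sZ] := steinitz2 fxy xz yz.
have {}fullE : (fullv <= <<[:: e1; e2; x; y; z]>>)%VS.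
  by apply: subv_trans fullE _; apply: (@span_catS _ _ [:: e1; e2]).
have [x1 y1] : x \in <<[:: x; y; z]>>%VS /\ y \in <<[:: x; y; z]>>%VS.
  by rewrite !memv_span // !inE eqxx ?orbT.
have [[|p1 [|p2 [|p3 []]]] // _ x'E] := spanP (subvP sZ _ x'z).
have [[|q1 [|q2 [|q3 []]]] // _ y'E] := spanP (subvP sZ _ y'z).
have [/sl2_complete[a [d E]] | ] := boolP ((p3 != 0) || (q3 != 0)); last first.
  rewrite negb_or !negbK => /andP[/eqP p30 /eqP q30].
  have [t tE] := quadratic_root (- (p1 + q2)) (p1 * q2 - p2 * q1).
  apply: (@net_L_dep e1 e2 [:: x; y; z] (c' - t * c) ((p1 - t) *: x + p2 *: y)
    (q1 *: x + (q2 - t) *: y) c x y) => //.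
  - by rewrite memvD ?memvZ.
  - by rewrite memvD ?memvZ.
  - by apply: det0_dep; rewrite -tE; ring.
  apply: subv_trans UF _; apply: (@span_lc _ _ [:: [:: 1]; [:: 0; 0; 1]; [:: 0; 1; t]]).
  by rewrite x'E y'E p30 q30; lists by ring.
pose l := p3 *: e1 + q3 *: e2; pose n := a *: e1 + d *: e2.
(* The pair dual to the passage from e1, e2 to l, n: e1 x + e2 y = l X + n Y. *)
pose X := d *: x - a *: y; pose Y := p3 *: y - q3 *: x.
have sXY : (<<[:: x; y]>> <= <<[:: X; Y]>>)%VS.
  apply: (@span_lc _ _ [:: [:: p3; a]; [:: q3; d]]).
  by rewrite /X /Y; lists by ring: E.
have [xXY yXY] : x \in <<[:: X; Y]>>%VS /\ y \in <<[:: X; Y]>>%VS.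
  by rewrite !(subvP sXY) // memv_span // !inE eqxx ?orbT.
apply: (@net_L_split l n X Y z ((d * p1 - a * q1) *: x + (d * p2 - a * q2) *: y)
   ((p3 * q1 - q3 * p1) *: x + (p3 * q2 - q3 * p2) *: y)).
- apply: subv_trans fullE _; apply: (@subv_trans _ _ <<[:: l; n; x; y; z]>>%VS).
    exact: (@span_Scat _ _ _ _ [:: x; y; z] (span_sl2 _ _ E)).
  exact: (@span_catS _ _ [:: l; n] _ _ (@span_Scat _ _ _ _ [:: z] sXY)).
- by rewrite memvD ?memvZ.
- by rewrite memvD ?memvZ.
apply: subv_trans UF _; apply: (@span_lc _ _ [:: [:: 1]; [:: c; 1]; [:: c'; 0; 1]]).
by rewrite x'E y'E /l /n /X /Y; lists by ring: E.
Qed.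

End DecomposableNets.

Section DecomposableNets2.

Variables (k : closedFieldType).
Local Notation W := 'rV[k]_5.
Local Notation M := 'M[k]_5.
Implicit Types (u v w x y z : W) (A B F G H : M) (S X Z E g : seq W).
Variable U : {vspace M}.
Hypothesis dimU : \dim U = 3%N.

(* In the names below, [34] and [35] refer to the class of a form modulo the ideal generated
   by e1 and e2. *)
Lemma net_34 e1 e2 e3 e4 e5 c x y :
    (fullv <= <<[:: e1; e2; e3; e4; e5]>>)%VS ->
    x \in <<[:: e5; e3; e4]>>%VS -> y \in <<[:: e5; e3; e4]>>%VS ->
    (U <= <<[:: wedge e1 e2; (c *: wedge e1 e2 + wedge e1 x + wedge e2 y)%R; wedge e3 e4]>>)%VS ->
  classified U.
Proof.
move=> fullE /span_consP[x5 [x' [xL ->]]] /span_consP[y5 [y' [yL ->]]] UF.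
have [/sl2_complete[a [d E]] | ] := boolP ((x5 != 0) || (y5 != 0)).
  (* [n] is the vector that multiplies e5; up to a multiple of l n the second form becomes l w + n
     E5, with w on e3 and e4. *)
  pose n := x5 *: e1 + y5 *: e2; pose l := a *: e1 + d *: e2.
  pose w := x5 *: y' - y5 *: x'; pose E5 := e5 + d *: x' - a *: y'.
  have wL : w \in <<[:: e3; e4]>>%VS by rewrite memvB ?memvZ.
  have {}UF : (U <= <<[:: wedge l n; (wedge l w + wedge n E5)%R; wedge e3 e4]>>)%VS.
    apply: subv_trans UF _; apply: (@span_lc _ _ [:: [:: - 1]; [:: - c; 1]; [:: 0; 0; 1]]).
    by rewrite /n /l /w /E5; lists by ring: E.
  have {}fullE : (fullv <= <<[:: l; n; e3; e4; E5]>>)%VS.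
    have [[|x3 [|x4 []]] // _ xE] := spanP xL.
    have [[|y3 [|y4 []]] // _ yE] := spanP yL.
    apply: subv_trans fullE _.
    apply: (@span_lc _ _ [:: [:: - y5; d]; [:: x5; - a]; [:: 0; 0; 1]; [:: 0; 0; 0; 1];
      [:: 0; 0; a * y3 - d * x3; a * y4 - d * x4; 1]]).
    by rewrite /E5 /n /l xE yE; lists by ring: E.
  have [w0 | w0] := eqVneq w 0.
    exists [:: [:: (0, 1)]; [:: (1, 4)]; [:: (2, 3)]]%N; first by [].
    apply: (has_codeE (T2 := [:: [:: 1]; [:: 0; 1]; [:: 0; 0; 1]]) fullE UF) => //.
    by rewrite w0; lists by ring.
  have [[|p []] // _ sZ] := steinitz1 w0 wL.
  have /ext2_pair[s sE] : wedge e3 e4 \in ext2 [:: w; p].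
    by rewrite (subvP (ext2S sZ)) // wedge_ext2 // memv_span // !inE eqxx ?orbT.
  exists [:: [:: (0, 1)]; [:: (0, 2); (1, 4)]; [:: (2, 3)]]%N; first by [].
  apply: (has_codeE (g := [:: l; n; w; p; E5]) (T2 := [:: [:: 1]; [:: 0; 1]; [:: 0; 0; s]]) _ UF) => //.
    apply: subv_trans fullE _; apply: (@span_catS _ _ [:: l; n]).
    exact: (@span_Scat _ _ _ _ [:: E5] sZ).
  by rewrite sE; lists by ring.
rewrite negb_or !negbK => /andP[/eqP x50 /eqP y50].
have [fxy | /dep2_unimodular[a [b [a' [d [z [E zxy xE yE]]]]]]] := boolP (free [:: x'; y']).
  have [[] // _ sZ] := steinitz2 fxy xL yL.
  have /ext2_pair[s sE] : wedge e3 e4 \in ext2 [:: x'; y'].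
    by rewrite (subvP (ext2S sZ)) // wedge_ext2 // memv_span // !inE eqxx ?orbT.
  exists [:: [:: (0, 1)]; [:: (0, 2); (1, 3)]; [:: (2, 3)]]%N; first by [].
  apply: (has_codeE (g := [:: e1; e2; x'; y'; e5]) (T2 := [:: [:: 1]; [:: c; 1]; [:: 0; 0; s]]) _ UF) => //.
    apply: subv_trans fullE _; apply: (@span_catS _ _ [:: e1; e2]).
    exact: (@span_Scat _ _ _ _ [:: e5] sZ).
  by rewrite sE x50 y50; lists by ring.
have zL : z \in <<[:: e3; e4]>>%VS.
  by apply: subvP zxy; apply/span_subvP=> w; rewrite !inE => /orP[]/eqP->.
subst x' y'; have [z0 | z0] := eqVneq z 0.
  apply: (two_generators dimU (A := wedge e1 e2) (B := wedge e3 e4)).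
  apply: subv_trans UF _; apply: (@span_lc _ _ [:: [:: 1]; [:: c]; [:: 0; 1]]).
  by rewrite z0 x50 y50; lists by ring.
have [[|p []] // _ sZ] := steinitz1 z0 zL.
have /ext2_pair[s sE] : wedge e3 e4 \in ext2 [:: z; p].
  by rewrite (subvP (ext2S sZ)) // wedge_ext2 // memv_span // !inE eqxx ?orbT.
exists [:: [:: (0, 1)]; [:: (0, 2)]; [:: (1, 3)]]%N; first by [].
apply: (has_code_lc (g := [:: a *: e1 + b *: e2; z; a' *: e1 + d *: e2; p; e5])
  (E := [:: e1; e2; z; p; e5])
  (T1 := [:: [:: d; 0; - b]; [:: - a'; 0; a]; [:: 0; 1]; [:: 0; 0; 0; 1]; [:: 0; 0; 0; 0; 1]])
  (T2 := [:: [:: 0; 1]; [:: 1; c]; [:: 0; 0; s]]) _ UF) => //.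
- apply: subv_trans fullE _; apply: (@span_catS _ _ [:: e1; e2]).
  exact: (@span_Scat _ _ _ _ [:: e5] sZ).
- by lists by ring: E.
by rewrite sE x50 y50; lists by ring: E.
Qed.

(** If y5 is nonzero, the second form acquires the leading term E2 E5. If y5 = 0 but x5 is not, it
    cancels e1 e5 in the third form, which is the situation of [net_34]. If both vanish, the
    determinant of the coordinates of x and y on e3, e4 decides. *)
Lemma net_34_15 e1 e2 e3 e4 e5 c x y :
    (fullv <= <<[:: e1; e2; e3; e4; e5]>>)%VS ->
    x \in <<[:: e5; e3; e4]>>%VS -> y \in <<[:: e5; e3; e4]>>%VS ->
    (U <= <<[:: wedge e1 e2; (c *: wedge e1 e2 + wedge e1 x + wedge e2 y)%R;
                (wedge e3 e4 + wedge e1 e5)%R]>>)%VS ->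
  classified U.
Proof.
move=> fullE /spanP[[|x5 [|x3 [|x4 []]]] // _ ->] /spanP[[|y5 [|y3 [|y4 []]]] // _ ->] UF.
have [y50 | y50] := eqVneq y5 0; last first.
  pose E2 := e2 + (x5 / y5) *: e1; pose E5 := e5 + (y3 / y5) *: e3 + (y4 / y5) *: e4.
  pose E3 := e3 - (y4 / y5) *: e1; pose E4 := e4 + (y3 / y5) *: e1.
  pose X3 := (x3 - x5 * (y3 / y5)) / y5; pose X4 := (x4 - x5 * (y4 / y5)) / y5.
  have {}UF : (U <= <<[:: wedge e1 E2; (X3 *: wedge e1 E3 + X4 *: wedge e1 E4 + wedge E2 E5)%R;
       (wedge E3 E4 + wedge e1 E5)%R]>>)%VS.
    apply: subv_trans UF _; apply: (@span_lc _ _ [:: [:: 1]; [:: c; y5]; [:: 0; 0; 1]]).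
    by rewrite /E2 /E3 /E4 /E5 /X3 /X4; lists by fld.
  have {}fullE : (fullv <= <<[:: e1; E2; E3; E4; E5]>>)%VS.
    apply: subv_trans fullE _.
    apply: (@span_lc _ _ [:: [:: 1]; [:: - (x5 / y5); 1]; [:: y4 / y5; 0; 1]; [:: - (y3 / y5); 0; 0; 1];
      [:: 0; 0; - (y3 / y5); - (y4 / y5); 1]]).
    by rewrite /E2 /E3 /E4 /E5; lists by fld.
  move: E2 E3 E4 E5 X3 X4 UF fullE => {}e2 {}e3 {}e4 {}e5 X3 X4 UF fullE.
  have [/sl2_complete[a [d E]] | ] := boolP ((X3 != 0) || (X4 != 0)).
    exists [:: [:: (0, 1)]; [:: (0, 2); (1, 4)]; [:: (2, 3); (0, 4)]]%N; first by [].
    apply: (has_code_lc (g := [:: e1; e2; X3 *: e3 + X4 *: e4; a *: e3 + d *: e4; e5])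
      (T1 := [:: [:: 1]; [:: 0; 1]; [:: 0; 0; d; - X4]; [:: 0; 0; - a; X3]; [:: 0; 0; 0; 0; 1]])
      (T2 := [:: [:: 1]; [:: 0; 1]; [:: 0; 0; 1]]) fullE UF) => //.
      by lists by ring: E.
    by lists by ring: E.
  rewrite negb_or !negbK => /andP[/eqP X30 /eqP X40].
  exists [:: [:: (0, 1)]; [:: (1, 4)]; [:: (2, 3); (0, 4)]]%N; first by [].
  apply: (has_codeE (T2 := [:: [:: 1]; [:: 0; 1]; [:: 0; 0; 1]]) fullE UF) => //.
  by rewrite X30 X40; lists by ring.
have [x50 | x50] := eqVneq x5 0; last first.
  pose E3 := e3 - (x4 / x5) *: e1 - (y4 / x5) *: e2; pose E4 := e4 + (x3 / x5) *: e1 + (y3 / x5) *: e2.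
  apply: (@net_34 e1 e2 E3 E4 e5 0 (x5 *: e5 + x3 *: E3 + x4 *: E4) (y3 *: E3 + y4 *: E4)).
  - apply: subv_trans fullE _.
    apply: (@span_lc _ _ [:: [:: 1]; [:: 0; 1]; [:: x4 / x5; y4 / x5; 1]; [:: - (x3 / x5); - (y3 / x5); 0; 1];
        [:: 0; 0; 0; 0; 1]]).
    by rewrite /E3 /E4; lists by fld.
  - by rewrite !memvD // memvZ // memv_span // !inE eqxx ?orbT.
  - by rewrite !memvD // memvZ // memv_span // !inE eqxx ?orbT.
  apply: subv_trans UF _.
  apply: (@span_lc _ _ [:: [:: 1]; [:: c + (x3 * y4 - x4 * y3) / x5 *+ 2; 1];
     [:: (x3 * y4 - x4 * y3) / x5 / x5; x5^-1; 1]]).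
  by rewrite /E3 /E4 y50; lists by fld.
have [D0 | D0] := eqVneq (x3 * y4 - x4 * y3) 0; last first.
  exists [:: [:: (0, 1)]; [:: (0, 2); (1, 3)]; [:: (2, 3); (0, 4)]]%N; first by [].
  pose D := x3 * y4 - x4 * y3.
  apply: (has_code_lc (g := [:: e1; e2; x3 *: e3 + x4 *: e4; y3 *: e3 + y4 *: e4; D *: e5])
    (T1 := [:: [:: 1]; [:: 0; 1]; [:: 0; 0; y4 / D; - x4 / D]; [:: 0; 0; - y3 / D; x3 / D]; [:: 0; 0; 0; 0; D^-1]])
    (T2 := [:: [:: 1]; [:: c; 1]; [:: 0; 0; D^-1]]) fullE UF) => //.
    by rewrite /D; lists by fld.
  by rewrite /D x50 y50; lists by fld.
have /(det0_dep e3 e4)/dep2_unimodular[a [b [a' [d [z [E zxy xE yE]]]]]] := D0.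
have {xE yE} UF' : (U <= <<[:: wedge e1 e2; wedge (a *: e1 + b *: e2) z; (wedge e3 e4 + wedge e1 e5)%R]>>)%VS.
  apply: subv_trans UF _; apply: (@span_lc _ _ [:: [:: 1]; [:: c; 1]; [:: 0; 0; 1]]).
  have -> : wedge (a *: e1 + b *: e2) z = wedge e1 (x3 *: e3 + x4 *: e4) + wedge e2 (y3 *: e3 + y4 *: e4).
    by rewrite xE yE; entrywise ring.
  by rewrite x50 y50; lists by ring.
have /spanP[[|z3 [|z4 []]] // _ zE] : z \in <<[:: e3; e4]>>%VS.
  apply: subvP zxy; apply/span_subvP=> w; rewrite !inE => /orP[]/eqP->;
    by rewrite memvD // memvZ // memv_span // !inE eqxx ?orbT.
subst z; move: UF' {UF zxy} => UF.
have [/sl2_complete[a2 [d2 E2]] | ] := boolP ((z3 != 0) || (z4 != 0)); last first.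
  rewrite negb_or !negbK => /andP[/eqP z30 /eqP z40].
  apply: (two_generators dimU (A := wedge e1 e2) (B := wedge e3 e4 + wedge e1 e5)).
  apply: subv_trans UF _; apply: (@span_lc _ _ [:: [:: 1]; [:: 0]; [:: 0; 1]]).
  by rewrite z30 z40; lists by ring.
pose P := z3 *: e3 + z4 *: e4; pose Q := a2 *: e3 + d2 *: e4.
have {}fullE : (fullv <= <<[:: e1; e2; P; Q; e5]>>)%VS.
  apply: subv_trans fullE _; apply: (@span_catS _ _ [:: e1; e2]).
  exact: (@span_Scat _ _ _ _ [:: e5] (span_sl2 _ _ E2)).
have {}UF : (U <= <<[:: wedge e1 e2; wedge (a *: e1 + b *: e2) P; (wedge P Q + wedge e1 e5)%R]>>)%VS.
  apply: subv_trans UF _; apply: (@span_lc _ _ [:: [:: 1]; [:: 0; 1]; [:: 0; 0; 1]]).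
  by rewrite /P /Q; lists by ring: E2.
move: P Q UF fullE => {}e3 {}e4 UF fullE.
have [b0 | b0] := eqVneq b 0; last first.
  exists [:: [:: (0, 1)]; [:: (1, 2)]; [:: (2, 3); (0, 4)]]%N; first by [].
  apply: (has_code_lc (g := [:: e1; e2 + (a / b) *: e1; e3; e4; e5])
    (T1 := [:: [:: 1]; [:: - (a / b); 1]; [:: 0; 0; 1]; [:: 0; 0; 0; 1]; [:: 0; 0; 0; 0; 1]])
    (T2 := [:: [:: 1]; [:: 0; b]; [:: 0; 0; 1]]) fullE UF) => //.
    by lists by ring.
  by lists by fld.
exists [:: [:: (0, 1)]; [:: (0, 2)]; [:: (0, 3); (1, 4)]]%N; first by [].
apply: (has_code_lc (g := [:: e1; e3; e2; e5; e4])
  (T1 := [:: [:: 1]; [:: 0; 0; 1]; [:: 0; 1]; [:: 0; 0; 0; 0; 1]; [:: 0; 0; 0; 1]])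
  (T2 := [:: [:: 0; 1]; [:: a]; [:: 0; 0; 1]]) fullE UF) => //.
  by lists by ring.
by rewrite b0; lists by ring.
Qed.

(** Shifting e3 and e4 by e1 and e2 absorbs e1 x' + e2 y' except for its terms in e5, up to e1
    e2. *)
Lemma net_34_any e1 e2 e3 e4 e5 c x y c' x' y' :
    (fullv <= <<[:: e1; e2; e3; e4; e5]>>)%VS ->
    x \in <<[:: e5; e3; e4]>>%VS -> y \in <<[:: e5; e3; e4]>>%VS ->
    x' \in <<[:: e5; e3; e4]>>%VS -> y' \in <<[:: e5; e3; e4]>>%VS ->
    (U <= <<[:: wedge e1 e2; (c *: wedge e1 e2 + wedge e1 x + wedge e2 y)%R;
       (c' *: wedge e1 e2 + wedge e1 x' + wedge e2 y' + wedge e3 e4)%R]>>)%VS ->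
  classified U.
Proof.
move=> fullE /spanP[[|p5 [|p3 [|p4 []]]] // _ ->] /spanP[[|q5 [|q3 [|q4 []]]] // _ ->].
move=> /spanP[[|x5 [|x3 [|x4 []]]] // _ ->] /spanP[[|y5 [|y3 [|y4 []]]] // _ ->] UF.
pose E3 := e3 + x4 *: e1 + y4 *: e2; pose E4 := e4 - x3 *: e1 - y3 *: e2.
pose X := p5 *: e5 + p3 *: E3 + p4 *: E4; pose Y := q5 *: e5 + q3 *: E3 + q4 *: E4.
have {}fullE : (fullv <= <<[:: e1; e2; E3; E4; e5]>>)%VS.
  apply: subv_trans fullE _.
  apply: (@span_lc _ _ [:: [:: 1]; [:: 0; 1]; [:: - x4; - y4; 1]; [:: x3; y3; 0; 1]; [:: 0; 0; 0; 0; 1]]).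
  by rewrite /E3 /E4; lists by ring.
have {}UF : (U <= <<[:: wedge e1 e2; (wedge e1 X + wedge e2 Y)%R;
     (wedge E3 E4 + wedge (x5 *: e1 + y5 *: e2) e5)%R]>>)%VS.
  apply: subv_trans UF _; apply: (@span_lc _ _ [:: [:: 1];
      [:: c - p3 * y4 + p4 * y3 + q3 * x4 - q4 * x3; 1]; [:: c' + x4 * y3 - x3 * y4; 0; 1]]).
  by rewrite /X /Y /E3 /E4; lists by ring.
have XL : X \in <<[:: e5; E3; E4]>>%VS by rewrite !memvD // memvZ // memv_span // !inE eqxx ?orbT.
have YL : Y \in <<[:: e5; E3; E4]>>%VS by rewrite !memvD // memvZ // memv_span // !inE eqxx ?orbT.
move: E3 E4 X Y fullE UF XL YL => {}e3 {}e4 X Y fullE UF XL YL.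
have [/sl2_complete[a [d E]] | ] := boolP ((x5 != 0) || (y5 != 0)).
  apply: (@net_34_15 (x5 *: e1 + y5 *: e2) (a *: e1 + d *: e2) e3 e4 e5 0 (d *: X - a *: Y) (x5 *: Y - y5 *: X)).
  - apply: subv_trans fullE _.
    exact: (@span_Scat _ _ _ _ [:: e3; e4; e5] (span_sl2 _ _ E)).
  - by rewrite memvB ?memvZ.
  - by rewrite memvB ?memvZ.
  apply: subv_trans UF _; apply: (@span_lc _ _ [:: [:: 1]; [:: 0; 1]; [:: 0; 0; 1]]).
  by lists by ring: E.
rewrite negb_or !negbK => /andP[/eqP x50 /eqP y50].
apply: (@net_34 e1 e2 e3 e4 e5 0 X Y) => //.
apply: subv_trans UF _; apply: (@span_lc _ _ [:: [:: 1]; [:: 0; 1]; [:: 0; 0; 1]]).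
by rewrite x50 y50; lists by ring.
Qed.

End DecomposableNets2.

Section DecomposableNets3.

Variables (k : closedFieldType).
Hypothesis char_neq2 : 2%N \notin [pchar k].
Local Notation W := 'rV[k]_5.
Local Notation M := 'M[k]_5.
Implicit Types (u v w x y z : W) (A B F G H : M) (S X Z E g : seq W).
Variable U : {vspace M}.
Hypothesis dimU : \dim U = 3%N.

Lemma net_34_35_bd e1 e2 e3 e4 e5 x y :
    (fullv <= <<[:: e1; e2; e3; e4; e5]>>)%VS ->
    x \in <<[:: e1; e2]>>%VS -> y \in <<[:: e1; e2]>>%VS ->
    (U <= <<[:: wedge e1 e2; (wedge e3 e4 + wedge x e5)%R; (wedge e3 e5 + wedge y e5)%R]>>)%VS ->
  classified U.
Proof.
move=> fullE xL yL UF.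
have [fxy | /dep2_unimodular[a [b [a' [d [z [E zxy xE yE]]]]]]] := boolP (free [:: x; y]).
  have [[] // _ sZ] := steinitz2 fxy xL yL.
  have /ext2_pair[s sE] : wedge e1 e2 \in ext2 [:: x; y].
    by rewrite (subvP (ext2S sZ)) // wedge_ext2 // memv_span // !inE eqxx ?orbT.
  exists [:: [:: (0, 1)]; [:: (2, 3); (0, 4)]; [:: (2, 4); (1, 4)]]%N; first by [].
  apply: (has_codeE (g := [:: x; y; e3; e4; e5]) (T2 := [:: [:: s]; [:: 0; 1]; [:: 0; 0; 1]]) _ UF) => //.
    apply: subv_trans fullE _.
    exact: (@span_Scat _ _ _ _ [:: e3; e4; e5] sZ).
  by rewrite sE; lists by ring.
have zL : z \in <<[:: e1; e2]>>%VS.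
  by apply: subvP zxy; apply/span_subvP=> w; rewrite !inE => /orP[]/eqP->.
subst x y; have [z0 | z0] := eqVneq z 0.
  exists [:: [:: (0, 1)]; [:: (1, 4)]; [:: (2, 3)]]%N; first by [].
  apply: (has_code_lc (g := [:: e4; e3; e1; e2; e5])
    (T1 := [:: [:: 0; 0; 1]; [:: 0; 0; 0; 1]; [:: 0; 1]; [:: 1]; [:: 0; 0; 0; 0; 1]])
    (T2 := [:: [:: 0; 0; 1]; [:: - 1]; [:: 0; 1]]) fullE UF) => //.
    by lists by ring.
  by rewrite z0; lists by ring.
have [[|p []] // _ sZ] := steinitz1 z0 zL.
have /ext2_pair[s sE] : wedge e1 e2 \in ext2 [:: z; p].
  by rewrite (subvP (ext2S sZ)) // wedge_ext2 // memv_span // !inE eqxx ?orbT.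
have {}fullE : (fullv <= <<[:: z; p; e3; e4; e5]>>)%VS.
  apply: subv_trans fullE _.
  exact: (@span_Scat _ _ _ _ [:: e3; e4; e5] sZ).
rewrite {}sE in UF; have [b0 | b0] := eqVneq b 0; last first.
  exists [:: [:: (0, 1)]; [:: (2, 3)]; [:: (2, 4); (0, 4)]]%N; first by [].
  apply: (has_code_lc (g := [:: b *: z; p; e3; e4 - (a / b) *: e5; e5])
    (T1 := [:: [:: b^-1]; [:: 0; 1]; [:: 0; 0; 1]; [:: 0; 0; 0; 1; a / b]; [:: 0; 0; 0; 0; 1]])
    (T2 := [:: [:: s / b]; [:: 0; 1; a / b]; [:: 0; 0; 1]]) fullE UF) => //.
    by lists by fld.
  by lists by fld.
have a0 : a != 0.
  by apply: contra_eqN E => /eqP->; rewrite b0 !mul0r addr0 eq_sym oner_eq0.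
exists [:: [:: (0, 1)]; [:: (0, 2); (1, 4)]; [:: (2, 3)]]%N; first by [].
apply: (has_code_lc (g := [:: e5; e3; - a *: z; p; e4])
  (T1 := [:: [:: 0; 0; - a^-1]; [:: 0; 0; 0; 1]; [:: 0; 1]; [:: 0; 0; 0; 0; 1]; [:: 1]])
  (T2 := [:: [:: 0; 0; - (s / a)]; [:: 0; 1]; [:: - 1]]) fullE UF) => //.
  by lists by fld.
by rewrite b0; lists by fld.
Qed.

(** Replacing e3 by e3 + y gives the shape of [net_34_35_bd] with e4 and e5 exchanged. *)
Lemma net_34_35_cd e1 e2 e3 e4 e5 x y :
    (fullv <= <<[:: e1; e2; e3; e4; e5]>>)%VS ->
    x \in <<[:: e1; e2]>>%VS -> y \in <<[:: e1; e2]>>%VS ->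
    (U <= <<[:: wedge e1 e2; wedge e3 e4; (wedge e3 e5 + wedge x e4 + wedge y e5)%R]>>)%VS ->
  classified U.
Proof.
move=> fullE xL yL UF; have [[|y1 [|y2 []]] // _ yE] := spanP yL.
apply: (@net_34_35_bd e1 e2 (e3 + y) e5 e4 x (- y)).
- apply: subv_trans fullE _.
  apply: (@span_lc _ _ [:: [:: 1]; [:: 0; 1]; [:: - y1; - y2; 1]; [:: 0; 0; 0; 0; 1]; [:: 0; 0; 0; 1]]).
  by rewrite yE; lists by ring.
- by [].
- by rewrite memvN.
apply: subv_trans UF _; apply: (@span_lc _ _ [:: [:: 1]; [:: 0; 0; 1]; [:: 0; 1]]).
by lists by ring.
Qed.

(** Replacing e3 by e3 + t y and e4 by e4 + t e5 preserves the shape while t times the third form is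
    added to the second. The new x is quadratic in t; where it vanishes, [net_34_35_cd] applies. *)
Lemma net_shear e1 e2 e3 e4 e5 x y z t :
    (fullv <= <<[:: e1; e2; e3; e4; e5]>>)%VS -> y \in <<[:: e1; e2]>>%VS ->
    (U <= <<[:: wedge e1 e2; (wedge e3 e4 + wedge x e5)%R;
        (wedge e3 e5 + wedge y e4 + wedge z e5)%R]>>)%VS ->
  exists f3 f4,
   (fullv <= <<[:: e1; e2; f3; f4; e5]>>)%VS /\
    (U <= <<[:: wedge e1 e2; (wedge f3 f4 + wedge (x + t *: z - t ^+ 2 *: y) e5)%R;
        (wedge f3 e5 + wedge y f4 + wedge (z - (t *+ 2) *: y) e5)%R]>>)%VS.
Proof.
move=> fullE /spanP[[|y1 [|y2 []]] // _ yE] UF.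
exists (e3 + t *: y), (e4 + t *: e5); split.
  apply: subv_trans fullE _.
  apply: (@span_lc _ _ [:: [:: 1]; [:: 0; 1]; [:: - (t * y1); - (t * y2); 1]; [:: 0; 0; 0; 1; - t]; [:: 0; 0; 0; 0; 1]]).
  by rewrite yE; lists by ring.
apply: subv_trans UF _; apply: (@span_lc _ _ [:: [:: 1]; [:: 0; 1; - t]; [:: 0; 0; 1]]).
by lists by ring.
Qed.

(** Unless y = 0 or x + t z - t^2 y = 0 for some t, a single class remains. If z is a multiple d y,
    the shear by d / 2 removes z. If y and z are independent, a shear makes x a multiple of y, and a
    square root t splits the net. *)
Lemma net_34_35 e1 e2 e3 e4 e5 x y z :
    (fullv <= <<[:: e1; e2; e3; e4; e5]>>)%VS ->
    x \in <<[:: e1; e2]>>%VS -> y \in <<[:: e1; e2]>>%VS -> z \in <<[:: e1; e2]>>%VS ->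
    (U <= <<[:: wedge e1 e2; (wedge e3 e4 + wedge x e5)%R;
        (wedge e3 e5 + wedge y e4 + wedge z e5)%R]>>)%VS ->
  classified U.
Proof.
move=> fullE xL yL zL UF; have [y0 | y0] := eqVneq y 0.
  apply: (@net_34_35_bd e1 e2 e3 e4 e5 x z) => //; apply: subv_trans UF _.
  apply: (@span_lc _ _ [:: [:: 1]; [:: 0; 1]; [:: 0; 0; 1]]).
  by rewrite y0; lists by ring.
have beta0 t : x + t *: z - t ^+ 2 *: y = 0 -> classified U.
  move=> t0; have [f3 [f4 [fullF]]] := net_shear t fullE yL UF; rewrite t0 => UF'.
  apply: (net_34_35_cd fullF yL (y := z - (t *+ 2) *: y)); first by rewrite memvB // memvZ.
  apply: subv_trans UF' _; apply: (@span_lc _ _ [:: [:: 1]; [:: 0; 1]; [:: 0; 0; 1]]).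
  by lists by ring.
have [fyz | nfyz] := boolP (free [:: y; z]); last first.
  have [d zE] := dep_multiple y0 nfyz.
  have [fyx | nfyx] := boolP (free [:: y; x]); last first.
    have [c xE] := dep_multiple y0 nfyx.
    have [t tE] := quadratic_root (- d) (- c).
    apply: (beta0 t); rewrite xE zE scalerA -scalerDl -scalerBl.
    by rewrite (_ : _ - _ = 0) ?scale0r // -[RHS]oppr0 -tE; ring.
  have [f3 [f4 [{}fullE {}UF]]] := net_shear (d / 2%:R) fullE yL UF.
  pose x' := x + ((d / 2%:R) * d - (d / 2%:R) ^+ 2) *: y.
  have x'L : x' \in <<[:: e1; e2]>>%VS by rewrite memvD // memvZ.
  have fyx' : free [:: y; x'].
    apply: contraT => /(dep_multiple y0)[c x'E].
    have D0 : 1 * 0 - 0 * (c - ((d / 2%:R) * d - (d / 2%:R) ^+ 2)) = 0 by ring.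
    move: (det0_dep y x D0); rewrite scale1r !scale0r !addr0.
    by rewrite scalerBl -x'E /x' addrK fyx.
  have [[] // _ sZ] := steinitz2 fyx' yL x'L.
  have /ext2_pair[s sE] : wedge e1 e2 \in ext2 [:: y; x'].
    by rewrite (subvP (ext2S sZ)) // wedge_ext2 // memv_span // !inE eqxx ?orbT.
  exists [:: [:: (0, 1)]; [:: (2, 3); (0, 4)]; [:: (2, 4); (1, 3)]]%N; first by [].
  apply: (has_code_lc (g := [:: x'; y; f3; f4; e5]) (E := [:: y; x'; f3; f4; e5])
     (T1 := [:: [:: 0; 1]; [:: 1]; [:: 0; 0; 1]; [:: 0; 0; 0; 1]; [:: 0; 0; 0; 0; 1]])
     (T2 := [:: [:: - s]; [:: 0; 1]; [:: 0; 0; 1]]) _ UF) => //.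
  - apply: subv_trans fullE _.
    exact: (@span_Scat _ _ _ _ [:: f3; f4; e5] sZ).
  - by lists by ring.
  by rewrite sE /x' zE; lists by fld.
have [[] // _ sZ] := steinitz2 fyz yL zL.
have [[|a [|b []]] // _ xE] := spanP (subvP sZ _ xL).
have [f3 [f4 [{}fullE {}UF]]] := net_shear (- b) fullE yL UF.
have [c0 | c0] := eqVneq (a - b ^+ 2) 0.
  apply: (beta0 (- b)); rewrite xE /=.
  have -> : a = b ^+ 2 by apply/eqP; rewrite -subr_eq0 c0.
  by entrywise ring.
have /ext2_pair[s sE] : wedge e1 e2 \in ext2 [:: y; z].
  by rewrite (subvP (ext2S sZ)) // wedge_ext2 // memv_span // !inE eqxx ?orbT.
have {beta0} [t tE] := quadratic_root 0 (a - b ^+ 2).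
have t0 : t != 0.
  by apply: contraNneq c0 => t0; rewrite -tE t0; apply/eqP; ring.
pose z' := z + (b *+ 2) *: y.
have {}fullE : (fullv <= <<[:: y; z'; f3; f4; e5]>>)%VS.
  apply: subv_trans fullE _; apply: (@subv_trans _ _ <<[:: y; z; f3; f4; e5]>>%VS).
    exact: (@span_Scat _ _ _ _ [:: f3; f4; e5] sZ).
  apply: (@span_lc _ _ [:: [:: 1]; [:: - (b *+ 2); 1]; [:: 0; 0; 1]; [:: 0; 0; 0; 1]; [:: 0; 0; 0; 0; 1]]).
  by rewrite /z'; lists by ring.
have {}UF : (U <= <<[:: (s *: wedge y z')%R; (wedge f3 f4 - t ^+ 2 *: wedge y e5)%R;
        (wedge f3 e5 + wedge y f4 + wedge z' e5)%R]>>)%VS.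
  apply: subv_trans UF _; apply: (@span_lc _ _ [:: [:: 1]; [:: 0; 1]; [:: 0; 0; 1]]).
  have -> : t ^+ 2 = b ^+ 2 - a by apply/eqP; rewrite -subr_eq0 -tE; apply/eqP; ring.
  by rewrite sE xE /z'; lists by ring.
exists [:: [:: (0, 1)]; [:: (2, 3); (0, 4)]; [:: (2, 4); (1, 3)]]%N; first by [].
(* With P and Q the last two generators, P + t Q and P - t Q are the forms 23 + 04 and 24 + 13 of
   this basis. *)
apply: (has_code_lc (g := [:: t *: y - 2%:R^-1 *: z'; - (t *: y + 2%:R^-1 *: z'); f3 + 2%:R^-1 *: z'; f4 + t *: e5; f4 - t *: e5])
   (T1 := [:: [:: (t *+ 2)^-1; - (t *+ 2)^-1]; [:: - 1; - 1]; [:: 2%:R^-1; 2%:R^-1; 1];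
      [:: 0; 0; 0; 2%:R^-1; 2%:R^-1]; [:: 0; 0; 0; (t *+ 2)^-1; - (t *+ 2)^-1]])
   (T2 := [:: [:: - (s / t)]; [:: 0; 2%:R^-1; 2%:R^-1]; [:: 0; (t *+ 2)^-1; - (t *+ 2)^-1]]) fullE UF) => //.
  by lists by fld.
by lists by fld.
Qed.

(** Shifts of e3, e4, e5 by e1 and e2 leave, besides e1 e2, only terms along e5 in the second
    generator and along e4, e5 in the third. *)
Lemma net_34_35_any e1 e2 e3 e4 e5 c x y c' x' y' :
    (fullv <= <<[:: e1; e2; e3; e4; e5]>>)%VS ->
    x \in <<[:: e3; e4; e5]>>%VS -> y \in <<[:: e3; e4; e5]>>%VS ->
    x' \in <<[:: e3; e4; e5]>>%VS -> y' \in <<[:: e3; e4; e5]>>%VS ->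
    (U <= <<[:: wedge e1 e2; (c *: wedge e1 e2 + wedge e1 x + wedge e2 y + wedge e3 e4)%R;
       (c' *: wedge e1 e2 + wedge e1 x' + wedge e2 y' + wedge e3 e5)%R]>>)%VS ->
  classified U.
Proof.
move=> fullE /spanP[[|p3 [|p4 [|p5 []]]] // _ ->] /spanP[[|q3 [|q4 [|q5 []]]] // _ ->].
move=> /spanP[[|x3 [|x4 [|x5 []]]] // _ ->] /spanP[[|y3 [|y4 [|y5 []]]] // _ ->] UF.
pose E3 := e3 + p4 *: e1 + q4 *: e2.
pose E4 := e4 - p3 *: e1 - q3 *: e2; pose E5 := e5 - x3 *: e1 - y3 *: e2.
apply: (@net_34_35 e1 e2 E3 E4 E5 (p5 *: e1 + q5 *: e2) (x4 *: e1 + y4 *: e2)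
   ((x5 - p4) *: e1 + (y5 - q4) *: e2)).
- apply: subv_trans fullE _.
  apply: (@span_lc _ _ [:: [:: 1]; [:: 0; 1]; [:: - p4; - q4; 1]; [:: p3; q3; 0; 1]; [:: x3; y3; 0; 0; 1]]).
  by rewrite /E3 /E4 /E5; lists by ring.
- by rewrite memvD // memvZ // memv_span // !inE eqxx ?orbT.
- by rewrite memvD // memvZ // memv_span // !inE eqxx ?orbT.
- by rewrite memvD // memvZ // memv_span // !inE eqxx ?orbT.
apply: subv_trans UF _.
apply: (@span_lc _ _ [:: [:: 1]; [:: c + p4 * q3 - p3 * q4 + p5 * y3 - q5 * x3; 1];
   [:: c' + x4 * q3 - y4 * p3 + x5 * y3 - y5 * x3; 0; 1]]).
by rewrite /E3 /E4 /E5; lists by ring.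
Qed.

(** In three variables every form is decomposable and two forms have a common factor. The
    alternatives are the dimensions 0, 1, 2 of the span of A and B, where dimension 1 is split
    according to whether B is nonzero. *)
Lemma ext2_3_pair e3 e4 e5 A B : A \in ext2 [:: e3; e4; e5] -> B \in ext2 [:: e3; e4; e5] ->
  exists f3 f4 f5, (<<[:: e3; e4; e5]>> <= <<[:: f3; f4; f5]>>)%VS /\
    [\/ A = 0 /\ B = 0, exists s, A = s *: wedge f3 f4 /\ B = wedge f3 f4, A = wedge f3 f4 /\ B = 0
      | A = wedge f3 f4 /\ exists s, B = s *: wedge f3 f4 + wedge f3 f5].
Proof.
move=> AE BE; have [r [S [/= szS sS ler ArE]]] := ext2_std AE.
case: S szS sS ArE => [|s1 [|s2 [|s3 []]]] // _ sS; case: r ler => [|[|[|]]] //= _ ->.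
  have [r [S' [/= szS' sS' ler BrE]]] := ext2_std BE.
  case: S' szS' sS' BrE => [|f3 [|f4 [|f5 []]]] // _ sS'; case: r ler => [|[|[|]]] //= _ ->.
    by exists f3, f4, f5; split=> //; constructor 1.
  exists f3, f4, f5; split=> //; constructor 2; exists 0; rewrite scale0r addr0.
  by [].
have sS' : (<<[:: e3; e4; e5]>> <= <<[:: s3; s1; s2]>>)%VS.
  apply: subv_trans sS _.
  apply: (@span_lc _ _ [:: [:: 0; 1]; [:: 0; 0; 1]; [:: 1]]).
  by lists by ring.
have /ext2_consP[w [_ [wL /ext2_pair[s ->] ->]]] := subvP (ext2S sS') _ BE.
case/spanP: wL => -[|w1 [|w2 []]] // _ ->.
have [/sl2_complete[a [d E]] | ] := boolP ((w1 != 0) || (w2 != 0)).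
  exists (w1 *: s1 + w2 *: s2), (a *: s1 + d *: s2), (- s3); split.
    apply: subv_trans sS _.
    apply: (@span_lc _ _ [:: [:: d; - w2]; [:: - a; w1]; [:: 0; 0; - 1]]).
    by lists by ring: E.
  constructor 4; split; last exists s; rewrite /=; by entrywise ring: E.
rewrite negb_or !negbK => /andP[/eqP-> /eqP->].
have [-> | s0] := eqVneq s 0.
  exists s1, s2, s3; split=> //; constructor 3.
  by split; rewrite /= ?addr0 //; entrywise ring.
exists s1, (s *: s2), s3; split.
  apply: subv_trans sS _; apply: (@span_lc _ _ [:: [:: 1]; [:: 0; s^-1]; [:: 0; 0; 1]]).
  by lists by fld.
by constructor 2; exists s^-1; split; rewrite /=; entrywise fld.
Qed.

(** Modulo the ideal of u and v the net maps to the forms in three variables. An image of dimension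
    0, 1 or 2 is handled by [net_L], [net_34_any] or [net_34_35_any]. *)
Lemma net_decomposable u v : (forall A, A \in U -> A^T = - A) ->
  wedge u v \in U -> wedge u v != 0 -> classified U.
Proof.
move=> altU uvU uv0; have fuv := wedge_free uv0.
have [S szS fullS] := full_seq k 5.
have [] := steinitz2 fuv (subvP fullS u (memvf u)) (subvP fullS v (memvf v)).
rewrite szS => -[|e3 [|e4 [|e5 []]]] // _ /(subv_trans fullS) fullE.
have [Z] := member_extend uvU uv0; rewrite dimU; case: Z => [|G [|H []]] // _ UE.
have GE : G \in ext2 [:: u; v; e3; e4; e5].
  by apply: alt_ext2 => //; apply: altU; rewrite UE memv_span // !inE eqxx ?orbT.
have HE : H \in ext2 [:: u; v; e3; e4; e5].
  by apply: alt_ext2 => //; apply: altU; rewrite UE memv_span // !inE eqxx ?orbT.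
have {UE} UF : (U <= <<[:: wedge u v; G; H]>>)%VS by rewrite {1}UE.
case/split2: GE => c [x [y [A [xL yL AE GE]]]].
case/split2: HE => c' [x' [y' [B [x'L y'L BE HE]]]]; subst G H.
have [f3 [f4 [f5 [sf AB]]]] := ext2_3_pair AE BE.
have {}fullE : (fullv <= <<[:: u; v; f3; f4; f5]>>)%VS.
  by apply: subv_trans fullE _; apply: (@span_catS _ _ [:: u; v]).
have {xL yL x'L y'L} [xL yL x'L y'L] := And4 (subvP sf _ xL) (subvP sf _ yL) (subvP sf _ x'L) (subvP sf _ y'L).
have sp : (<<[:: f3; f4; f5]>> <= <<[:: f5; f3; f4]>>)%VS.
  apply: (@span_lc _ _ [:: [:: 0; 1]; [:: 0; 0; 1]; [:: 1]]).
  by lists by ring.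
case: AB => [[A0 B0] | [s [AE' BE']] | [AE' BE'] | [AE' [s BE']]].
- apply: (net_L dimU (c := c) (c' := c') fullE xL yL x'L y'L); apply: subv_trans UF _.
  apply: (@span_lc _ _ [:: [:: 1]; [:: 0; 1]; [:: 0; 0; 1]]).
  by rewrite A0 B0; lists by ring.
- apply: (@net_34_any _ _ dimU u v f3 f4 f5 (c - s * c') (x - s *: x') (y - s *: y') c' x' y');
    rewrite ?(subvP sp) ?memvB ?memvZ //.
  apply: subv_trans UF _; apply: (@span_lc _ _ [:: [:: 1]; [:: 0; 1; s]; [:: 0; 0; 1]]).
  by rewrite AE' BE'; lists by ring.
- apply: (@net_34_any _ _ dimU u v f3 f4 f5 c' x' y' c x y); rewrite ?(subvP sp) //.
  apply: subv_trans UF _; apply: (@span_lc _ _ [:: [:: 1]; [:: 0; 0; 1]; [:: 0; 1]]).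
  by rewrite AE' BE'; lists by ring.
apply: (@net_34_35_any u v f3 f4 f5 c x y (c' - s * c) (x' - s *: x) (y' - s *: y));
  rewrite ?memvB ?memvZ //.
apply: subv_trans UF _; apply: (@span_lc _ _ [:: [:: 1]; [:: 0; 1]; [:: 0; s; 1]]).
by rewrite AE' BE'; lists by ring.
Qed.

End DecomposableNets3.

(** * Nets of forms in five variables without decomposable member *)

Section IndecomposableNets.

Variables (k : closedFieldType).
Hypothesis char_neq2 : 2%N \notin [pchar k].
Local Notation W := 'rV[k]_5.
Local Notation M := 'M[k]_5.
Implicit Types (p q a b c u v w x y z : W) (A B F G H : M) (S X Z E g : seq W).
Variable U : {vspace M}.
Hypothesis dimU : \dim U = 3%N.
Hypothesis indecU : indecomposable U.

Lemma absurd3 x y A B : (U <= <<[:: wedge x y; A; B]>>)%VS -> classified U.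
Proof. by move/(indecomposable_absurd indecU) => []; rewrite ?dimU. Qed.

(* The first two forms are the normal form of an indecomposable pencil in five variables. *)
Lemma net_ca p q a b c u v (s : k) :
    (fullv <= <<[:: p; q; a; b; c]>>)%VS ->
    u \in <<[:: a; b; c]>>%VS -> v \in <<[:: a; b; c]>>%VS ->
    (U <= <<[:: (wedge q a + wedge p b)%R; (wedge q b + wedge p c)%R;
      (s *: wedge p q + wedge p u + wedge q v + wedge c a)%R]>>)%VS -> classified U.
Proof.
move=> fullE /spanP[[|u1 [|u2 [|u3 []]]] // _ ->] /spanP[[|v1 [|v2 [|v3 []]]] // _ ->] UF.
(* These shifts fix the first two forms; combined with multiples of those forms they absorb u and v
   up to p q. *)
pose A' := a + (v2 - u3) *: p - v3 *: q; pose B' := b + (v1 - u2) *: p + (v2 - u3) *: q.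
pose C' := c + u1 *: p + (v1 - u2) *: q.
pose r := s + u1 * v3 + (v2 - u3) * (v1 - u2).
have {}fullE : (fullv <= <<[:: p; q; A'; B'; C']>>)%VS.
  apply: subv_trans fullE _.
  apply: (@span_lc _ _ [:: [:: 1]; [:: 0; 1]; [:: u3 - v2; v3; 1]; [:: u2 - v1; u3 - v2; 0; 1];
      [:: - u1; u2 - v1; 0; 0; 1]]).
  by rewrite /A' /B' /C'; lists by ring.
have {}UF : (U <= <<[:: (wedge q A' + wedge p B')%R; (wedge q B' + wedge p C')%R;
      (r *: wedge p q + wedge C' A')%R]>>)%VS.
  apply: subv_trans UF _.
  apply: (@span_lc _ _ [:: [:: 1]; [:: 0; 1]; [:: u2; v2; 1]]).
  by rewrite /A' /B' /C' /r; lists by ring.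
move: A' B' C' r UF fullE => {}a {}b {}c r UF fullE.
have [r0 | r0] := eqVneq r 0.
  apply: (absurd3 (x := c) (y := a) (A := wedge q a + wedge p b) (B := wedge q b + wedge p c)).
  apply: subv_trans UF _; apply: (@span_lc _ _ [:: [:: 0; 1]; [:: 0; 0; 1]; [:: 1]]).
  by rewrite r0; lists by ring.
exists [:: [:: (0, 1); (2, 3)]; [:: (0, 3); (2, 4)]; [:: (4, 1); (2, 0)]]%N; first by [].
apply: (has_code_lc (g := [:: q; r^-1 ^+ 2 *: a; r^-1 *: p; r^-1 *: b; c])
   (T1 := [:: [:: 0; 0; r]; [:: 1]; [:: 0; r ^+ 2]; [:: 0; 0; 0; r]; [:: 0; 0; 0; 0; 1]])
   (T2 := [:: [:: r ^+ 2]; [:: 0; r]; [:: 0; 0; r ^+ 2]]) fullE UF) => //.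
  by lists by fld.
by lists by fld.
Qed.

(** Halving u2 - v1 distributes it evenly over the shifts of a and b. If the surviving coefficient
    v3 is 0, a square root of -r yields a decomposable member; otherwise the code is that of
    [net_ca]. *)
Lemma net_ab p q a b c u v (s : k) :
    (fullv <= <<[:: p; q; a; b; c]>>)%VS ->
    u \in <<[:: a; b; c]>>%VS -> v \in <<[:: a; b; c]>>%VS ->
    (U <= <<[:: (wedge q a + wedge p b)%R; (wedge q b + wedge p c)%R;
      (s *: wedge p q + wedge p u + wedge q v + wedge a b)%R]>>)%VS -> classified U.
Proof.
move=> fullE /spanP[[|u1 [|u2 [|u3 []]]] // _ ->] /spanP[[|v1 [|v2 [|v3 []]]] // _ ->] UF.
pose h := (u2 - v1) / 2%:R.
pose A' := a + h *: p + (v2 - u3) *: q; pose B' := b - u1 *: p + h *: q.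
pose C' := c - u1 *: q.
pose r := s - h ^+ 2 - (v2 - u3) * u1.
have {}fullE : (fullv <= <<[:: p; q; A'; B'; C']>>)%VS.
  apply: subv_trans fullE _.
  apply: (@span_lc _ _ [:: [:: 1]; [:: 0; 1]; [:: - h; u3 - v2; 1]; [:: u1; - h; 0; 1];
      [:: 0; u1; 0; 0; 1]]).
  by rewrite /A' /B' /C'; lists by ring.
have {}UF : (U <= <<[:: (wedge q A' + wedge p B')%R; (wedge q B' + wedge p C')%R;
      (r *: wedge p q + v3 *: wedge q C' + wedge A' B')%R]>>)%VS.
  apply: subv_trans UF _.
  apply: (@span_lc _ _ [:: [:: 1]; [:: 0; 1]; [:: u2 - h; u3; 1]]).
  by rewrite /A' /B' /C' /r /h; lists by fld.
move: A' B' C' r UF fullE => {}a {}b {}c r UF fullE.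
have [v30 | v30] := eqVneq v3 0.
  have [x xE] := quadratic_root 0 r.
  apply: (absurd3 (x := a + x *: p) (y := b - x *: q) (A := wedge q a + wedge p b) (B := wedge q b + wedge p c)).
  apply: subv_trans UF _; apply: (@span_lc _ _ [:: [:: 0; 1]; [:: 0; 0; 1]; [:: 1; - x]]).
  have -> : r = - x ^+ 2 by apply/eqP; rewrite -subr_eq0 -xE; apply/eqP; ring.
  by rewrite v30; lists by ring.
pose C' := c - (r / v3) *: p.
exists [:: [:: (0, 1); (2, 3)]; [:: (0, 3); (2, 4)]; [:: (4, 1); (2, 0)]]%N; first by [].
apply: (has_code_lc (g := [:: - v3^-1 *: b; - p; q; - v3^-1 *: a; - v3^-1 *: C'])
   (T1 := [:: [:: 0; - 1]; [:: 0; 0; 1]; [:: 0; 0; 0; - v3]; [:: - v3]; [:: 0; - (r / v3); 0; 0; - v3]])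
   (T2 := [:: [:: - v3]; [:: 0; 0; - v3]; [:: 0; - v3 ^+ 2]]) fullE UF) => //.
  by rewrite /C'; lists by fld.
by rewrite /C'; lists by fld.
Qed.

(** A net in the ideal of p and q has a decomposable member: its factor is q if u1 = 0, and
    otherwise p + t q for a root t of a cubic. *)
Lemma net_0 p q a b c u v (s : k) :
    (fullv <= <<[:: p; q; a; b; c]>>)%VS ->
    u \in <<[:: a; b; c]>>%VS -> v \in <<[:: a; b; c]>>%VS ->
    (U <= <<[:: (wedge q a + wedge p b)%R; (wedge q b + wedge p c)%R;
      (s *: wedge p q + wedge p u + wedge q v)%R]>>)%VS -> classified U.
Proof.
move=> fullE /spanP[[|u1 [|u2 [|u3 []]]] // _ ->] /spanP[[|v1 [|v2 [|v3 []]]] // _ ->] UF.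
have [u10 | u10] := eqVneq u1 0.
  apply: (absurd3 (x := q) (y := (v1 - u2) *: a + (v2 - u3) *: b + v3 *: c - s *: p)
      (A := wedge q a + wedge p b) (B := wedge q b + wedge p c)).
  apply: subv_trans UF _; apply: (@span_lc _ _ [:: [:: 0; 1]; [:: 0; 0; 1]; [:: 1; u2; u3]]).
  by rewrite u10; lists by ring.
have [t tE] := @solve_monicpoly k 3
  (fun i => nth 0 [:: v3 / u1; (v2 - u3) / u1; (v1 - u2) / u1] i) isT.
have {tE} v3E : v3 = t * (t ^+ 2 * u1 - t * (v1 - u2) - (v2 - u3)).
  have -> : t * (t ^+ 2 * u1 - t * (v1 - u2) - (v2 - u3)) = t ^+ 3 * u1 - t ^+ 2 * (v1 - u2) - t * (v2 - u3).
    by ring.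
  by rewrite tE !big_ord_recl big_ord0 /=; fld.
pose x := t * u1 - (v1 - u2); pose y := t ^+ 2 * u1 - t * (v1 - u2) - (v2 - u3).
apply: (absurd3 (x := p + t *: q) (y := x *: b + y *: c + u1 *: a + s *: q)
      (A := wedge q a + wedge p b) (B := wedge q b + wedge p c)).
apply: subv_trans UF _; apply: (@span_lc _ _ [:: [:: 0; 1]; [:: 0; 0; 1]; [:: 1; u2 - x; u3 - y]]).
by rewrite /x /y v3E; lists by ring.
Qed.

(** The pencil of the first two forms is stable under SL_2, acting on p, q and, as on a symmetric
    square, on a, b, c. The unipotent element with t = - s3 / (2 s2) removes a b. *)
Lemma net_ca_ab p q a b c u v (s s2 s3 : k) :
    (fullv <= <<[:: p; q; a; b; c]>>)%VS ->
    u \in <<[:: a; b; c]>>%VS -> v \in <<[:: a; b; c]>>%VS ->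
    (U <= <<[:: (wedge q a + wedge p b)%R; (wedge q b + wedge p c)%R;
      (s *: wedge p q + wedge p u + wedge q v + s2 *: wedge c a + s3 *: wedge a b)%R]>>)%VS ->
  classified U.
Proof.
move=> fullE uL vL UF; have [s20 | s20] := eqVneq s2 0.
  have [s30 | s30] := eqVneq s3 0.
    apply: (net_0 (s := s) fullE uL vL); apply: subv_trans UF _.
    apply: (@span_lc _ _ [:: [:: 1]; [:: 0; 1]; [:: 0; 0; 1]]).
    by rewrite s20 s30; lists by ring.
  apply: (net_ab (s := s / s3) (u := s3^-1 *: u) (v := s3^-1 *: v) fullE); rewrite ?memvZ //.
  apply: subv_trans UF _.
  apply: (@span_lc _ _ [:: [:: 1]; [:: 0; 1]; [:: 0; 0; s3]]).
  by rewrite s20; lists by fld.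
pose t := - s3 / s2 / 2%:R.
have sL : (<<[:: a; b; c]>> <= <<[:: a; (b + t *: a)%R; (c + (t *+ 2) *: b + t ^+ 2 *: a)%R]>>)%VS.
  apply: (@span_lc _ _ [:: [:: 1]; [:: - t; 1]; [:: t ^+ 2; - (t *+ 2); 1]]).
  by lists by ring.
apply: (@net_ca p (q - t *: p) a (b + t *: a) (c + (t *+ 2) *: b + t ^+ 2 *: a)
   (s2^-1 *: (u + t *: v)) (s2^-1 *: v) (s / s2)).
- apply: subv_trans fullE _; apply: subv_trans (@span_catS _ _ [:: p; q] _ _ sL) _.
  apply: (@span_lc _ _ [:: [:: 1]; [:: t; 1]; [:: 0; 0; 1]; [:: 0; 0; 0; 1]; [:: 0; 0; 0; 0; 1]]).
  by lists by ring.
- by apply: (subvP sL); rewrite memvZ // memvD // memvZ.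
- by apply: (subvP sL); rewrite memvZ.
apply: subv_trans UF _.
apply: (@span_lc _ _ [:: [:: 1]; [:: - t; 1]; [:: 0; 0; s2]]).
by rewrite /t; lists by fld.
Qed.

(** Under this SL_2 the part on a, b, c behaves like a binary quadratic form: a root t of s3 t^2 - 2
    s2 t + s1 removes b c. If s3 = 0, exchanging p with q and a with c does. *)
Lemma net_sigma p q a b c u v (s : k) A :
    (fullv <= <<[:: p; q; a; b; c]>>)%VS ->
    u \in <<[:: a; b; c]>>%VS -> v \in <<[:: a; b; c]>>%VS -> A \in ext2 [:: a; b; c] ->
    (U <= <<[:: (wedge q a + wedge p b)%R; (wedge q b + wedge p c)%R;
      (s *: wedge p q + wedge p u + wedge q v + A)%R]>>)%VS -> classified U.
Proof.
move=> fullE uL vL /ext2_consP[_ [_ [/spanP[[|s3 [|s2 []]] // _ ->] /ext2_pair[s1 ->] ->]]] UF.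
have [s30 | s30] := eqVneq s3 0.
  have sL : (<<[:: a; b; c]>> <= <<[:: c; b; a]>>)%VS.
    by apply: (@span_lc _ _ [:: [:: 0; 0; 1]; [:: 0; 1]; [:: 1]]); lists by ring.
  apply: (@net_ca_ab q p c b a v u (- s) s2 (- s1)); rewrite ?(subvP sL) //.
    apply: subv_trans fullE _.
    apply: (@span_lc _ _ [:: [:: 0; 1]; [:: 1]; [:: 0; 0; 0; 0; 1]; [:: 0; 0; 0; 1]; [:: 0; 0; 1]]).
    by lists by ring.
  apply: subv_trans UF _.
  apply: (@span_lc _ _ [:: [:: 0; 1]; [:: 1]; [:: 0; 0; 1]]).
  by rewrite s30; lists by ring.
have [t tE] := quadratic_root (- (s2 / s3) *+ 2) (s1 / s3).
have s1E : s1 = t * (s2 *+ 2) - t ^+ 2 * s3.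
  by apply: (divIf s30); apply/eqP; rewrite -subr_eq0 -tE; apply/eqP; fld.
have sL : (<<[:: a; b; c]>> <= <<[:: (a + (t *+ 2) *: b + t ^+ 2 *: c)%R; (b + t *: c)%R; c]>>)%VS.
  apply: (@span_lc _ _ [:: [:: 1; - (t *+ 2); t ^+ 2]; [:: 0; 1; - t]; [:: 0; 0; 1]]).
  by lists by ring.
apply: (@net_ca_ab (p - t *: q) q (a + (t *+ 2) *: b + t ^+ 2 *: c) (b + t *: c) c
   u (v + t *: u) s (- s2 + t * s3) s3).
- apply: subv_trans fullE _; apply: subv_trans (@span_catS _ _ [:: p; q] _ _ sL) _.
  apply: (@span_lc _ _ [:: [:: 1; t]; [:: 0; 1]; [:: 0; 0; 1]; [:: 0; 0; 0; 1]; [:: 0; 0; 0; 0; 1]]).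
  by lists by ring.
- exact: (subvP sL).
- by apply: (subvP sL); rewrite memvD // memvZ.
apply: subv_trans UF _.
apply: (@span_lc _ _ [:: [:: 1; - t]; [:: 0; 1]; [:: 0; 0; 1]]).
by rewrite s1E; lists by ring.
Qed.

(** A nonzero member has rank 4, say F = e1 e2 + e3 e4. A second one is e5 l + B with B on e1, ...,
    e4; if l were 0, these two would span a pencil in four variables, which has a decomposable
    member. So l can start a Darboux basis for F. *)
Lemma net_indecomposable : (forall A, A \in U -> A^T = - A) -> classified U.
Proof.
move=> altU; have [S szS fullS] := full_seq k 5.
have U0 : U != 0%VS by rewrite -dimv_eq0 dimU.
have FU := memv_pick U; have F0 : vpick U != 0 by rewrite vpick0.
have [Z] := member_extend FU F0; rewrite dimU; case: Z => [|G [|H []]] // _ UE.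
have GU : G \in U by rewrite UE memv_span // !inE eqxx ?orbT.
have HU : H \in U by rewrite UE memv_span // !inE eqxx ?orbT.
have {UE} UF : (U <= <<[:: vpick U; G; H]>>)%VS by rewrite {1}UE.
have [r [S' [szS' sS ler FE]]] := ext2_std (alt_ext2 char_neq2 fullS (altU _ FU)).
move: szS' sS FE FU F0 UF; rewrite szS in ler *; move: (vpick U) => F.
case: S' => [|e1 [|e2 [|e3 [|e4 [|e5 []]]]]] // _ /(subv_trans fullS) fullE.
case: r ler => [|[|[|]]] //= _ ->; first by rewrite eqxx.
  by rewrite addr0 => /indecU->; rewrite eqxx.
rewrite addr0 => FU F0 UF {szS fullS S F}.
have /ext2_consP[l [B [lL BL GE]]] : G \in ext2 (e5 :: [:: e1; e2; e3; e4]).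
  apply: alt_ext2; rewrite ?altU //; apply: subv_trans fullE _.
  apply: (@span_lc _ _ [:: [:: 0; 1]; [:: 0; 0; 1]; [:: 0; 0; 0; 1]; [:: 0; 0; 0; 0; 1]; [:: 1]]).
  by lists by ring.
subst G; have [l0 | l0] := eqVneq l 0.
  have [t [u [v [_ _ uvE]]]] := pencil4_decomposable BL.
  apply: (absurd3 (x := u) (y := v) (A := wedge e1 e2 + wedge e3 e4) (B := H)).
  apply: subv_trans UF _; apply: (@span_lc _ _ [:: [:: 0; 1]; [:: 1; - t]; [:: 0; 0; 1]]).
  by rewrite l0 -uvE; lists by ring.
have [f2 [f3 [f4 [sL FE]]]] := symplectic_transitive lL l0.
have {}fullE : (fullv <= <<[:: l; f2; f3; f4; e5]>>)%VS.
  by apply: subv_trans fullE _; apply: (@span_Scat _ _ _ _ [:: e5] sL).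
have /ext2_4[b12 [b13 [b14 [b23 [b24 [b34 BE]]]]]] := subvP (ext2S sL) _ BL.
pose c := (b12 - b34) *: f2 + b13 *: f3 + b14 *: f4 - e5.
rewrite {}FE in FU F0 UF; subst B.
have [/sl2_complete[a1 [d1 E]] | ] := boolP ((b23 != 0) || (b24 != 0)); last first.
  rewrite negb_or !negbK => /andP[/eqP b23_0 /eqP b24_0].
  apply: (absurd3 (x := l) (y := c) (A := wedge l f2 + wedge f3 f4) (B := H)).
  apply: subv_trans UF _; apply: (@span_lc _ _ [:: [:: 0; 1]; [:: 1; b34]; [:: 0; 0; 1]]).
  by rewrite b23_0 b24_0; lists by ring.
(* The signs give F = q a + l f2 and, for the second member G, G - b34 F = q f2 + l c. *)
pose q := - (b23 *: f3 + b24 *: f4); pose a := - (a1 *: f3 + d1 *: f4).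
have {}fullE : (fullv <= <<[:: l; q; a; f2; c]>>)%VS.
  apply: subv_trans fullE _.
  apply: (@span_lc _ _ [:: [:: 1]; [:: 0; 0; 0; 1]; [:: 0; - d1; b24]; [:: 0; a1; - b23];
     [:: 0; - (b13 * d1 - b14 * a1); - (b14 * b23 - b13 * b24); b12 - b34; - 1]]).
  by rewrite /q /a /c; lists by ring: E.
have /split2[s [u [v [A [uL vL AL HE]]]]] : H \in ext2 [:: l, q & [:: a; f2; c]].
  by apply: alt_ext2; rewrite ?altU.
apply: (@net_sigma l q a f2 c u v s A) => //.
apply: subv_trans UF _; rewrite -HE.
apply: (@span_lc _ _ [:: [:: 1]; [:: b34; 1]; [:: 0; 0; 1]]).
by rewrite /q /a /c; lists by ring: E.
Qed.

End IndecomposableNets.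

(** * Spaces of forms in four variables *)

Section DimensionFour.

Variables (k : closedFieldType).
Hypothesis char_neq2 : 2%N \notin [pchar k].
Local Notation W := 'rV[k]_4.
Local Notation M := 'M[k]_4.
Implicit Types (p q u v w x y z : W) (A B F G H : M) (S X Z E g : seq W).
Variable U : {vspace M}.
Hypothesis dimU : \dim U = 4%N.

Lemma three_generators A B G : (U <= <<[:: A; B; G]>>)%VS -> classified U.
Proof. by move=> UF; case: (few_generators UF); rewrite dimU. Qed.

(** These are pencils of 2 by 2 matrices: if the first matrix is invertible, an eigenvalue of the
    second relative to it gives a singular combination. *)
Lemma rank1_member e1 e2 e3 e4 x y x' y' :
    x \in <<[:: e3; e4]>>%VS -> y \in <<[:: e3; e4]>>%VS ->
    x' \in <<[:: e3; e4]>>%VS -> y' \in <<[:: e3; e4]>>%VS ->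
  exists a b c d z x1 y1, [/\ a * d = 1 + b * c, z \in <<[:: e3; e4]>>%VS,
    x1 \in <<[:: e3; e4]>>%VS, y1 \in <<[:: e3; e4]>>%VS
    & (<<[:: (wedge e1 x + wedge e2 y)%R; (wedge e1 x' + wedge e2 y')%R]>> <=
       <<[:: wedge (a *: e1 + b *: e2) z; (wedge e1 x1 + wedge e2 y1)%R]>>)%VS].
Proof.
have sub_pair u v : u \in <<[:: e3; e4]>>%VS -> v \in <<[:: e3; e4]>>%VS ->
    (<<[:: u; v]>> <= <<[:: e3; e4]>>)%VS.
  by move=> uL vL; apply/span_subvP=> w; rewrite !inE => /orP[]/eqP->.
move=> xL yL x'L y'L.
have [fxy | /dep2_unimodular[a [b [c [d [z [E zxy -> ->]]]]]]] := boolP (free [:: x; y]); last first.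
  exists a, b, c, d, z, x', y'; split=> //; first exact: subvP (sub_pair x y xL yL) _ zxy.
  apply: (@span_lc _ _ [:: [:: 1]; [:: 0; 1]]).
  by lists by ring.
have [[] // _ sZ] := steinitz2 fxy xL yL.
have [[|p1 [|p2 []]] // _ x'E] := spanP (subvP sZ _ x'L).
have [[|q1 [|q2 []]] // _ y'E] := spanP (subvP sZ _ y'L).
have [t tE] := quadratic_root (- (p1 + q2)) (p1 * q2 - p2 * q1).
have D0 : (p1 - t) * (q2 - t) - p2 * q1 = 0 by rewrite -tE; ring.
have /dep2_unimodular[a [b [c [d [z [E zxy XE YE]]]]]] := det0_dep x y D0.
exists a, b, c, d, z, x, y; split=> //.
  apply: subvP (sub_pair _ _ _ _) _ zxy; by rewrite memvD // memvZ.
apply: (@span_lc _ _ [:: [:: 0; 1]; [:: 1; t]]).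
have -> : wedge (a *: e1 + b *: e2) z = wedge e1 ((p1 - t) *: x + p2 *: y) + wedge e2 (q1 *: x + (q2 - t) *: y).
  by rewrite XE YE; entrywise ring.
by rewrite x'E y'E; lists by ring.
Qed.

(* Brings the pencil spanned by the two last forms to the shape e1 e3, e1 x + e2 y. *)
Lemma rank1_basis e1 e2 e3 e4 x y x' y' (F0 : seq M) :
    (fullv <= <<[:: e1; e2; e3; e4]>>)%VS -> size F0 = 1%N ->
    x \in <<[:: e3; e4]>>%VS -> y \in <<[:: e3; e4]>>%VS ->
    x' \in <<[:: e3; e4]>>%VS -> y' \in <<[:: e3; e4]>>%VS ->
    (U <= <<wedge e1 e2 :: F0 ++ [:: (wedge e1 x + wedge e2 y)%R; (wedge e1 x' + wedge e2 y')%R]>>)%VS ->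
  classified U \/ exists f1 f2 f3 f4 s h13 h14 h23 h24,
   [/\ (fullv <= <<[:: f1; f2; f3; f4]>>)%VS, (<<[:: e1; e2]>> <= <<[:: f1; f2]>>)%VS,
     (<<[:: e3; e4]>> <= <<[:: f3; f4]>>)%VS, wedge e3 e4 = s *: wedge f3 f4
   & (U <= <<wedge f1 f2 :: F0 ++ [:: wedge f1 f3;
        (h13 *: wedge f1 f3 + h14 *: wedge f1 f4 + h23 *: wedge f2 f3 + h24 *: wedge f2 f4)%R]>>)%VS].
Proof.
move=> fullE szF0 xL yL x'L y'L UF.
have [a [b [c [d [z [x1 [y1 [E zL x1L y1L sF]]]]]]]] := rank1_member e1 e2 xL yL x'L y'L.
have [z0 | z0] := eqVneq z 0.
  left; case: F0 szF0 UF => [|A []] // _ UF.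
  apply: (@three_generators (wedge e1 e2) A (wedge e1 x1 + wedge e2 y1)).
  apply: subv_trans UF _; apply: subv_trans (@span_catS _ _ [:: wedge e1 e2; A] _ _ sF) _.
  apply: (@span_lc _ _ [:: [:: 1]; [:: 0; 1]; [:: 0]; [:: 0; 0; 1]]).
  by rewrite z0; lists by ring.
have [[|p []] // _ sZ] := steinitz1 z0 zL.
have /ext2_pair[s sE] : wedge e3 e4 \in ext2 [:: z; p].
  by rewrite (subvP (ext2S sZ)) // wedge_ext2 // memv_span // !inE eqxx ?orbT.
have [[|x3 [|x4 []]] // _ xE] := spanP (subvP sZ _ x1L).
have [[|y3 [|y4 []]] // _ yE] := spanP (subvP sZ _ y1L).
right; exists (a *: e1 + b *: e2), (c *: e1 + d *: e2), z, p, s.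
exists (d * x3 - c * y3), (d * x4 - c * y4), (a * y3 - b * x3), (a * y4 - b * x4).
split=> //; try exact: span_sl2.
  apply: subv_trans fullE _; apply: subv_trans (@span_catS _ _ [:: e1; e2] _ _ sZ) _.
  exact: (@span_Scat _ _ _ _ [:: z; p] (span_sl2 _ _ E)).
case: F0 szF0 UF => [|A []] // _ UF; apply: subv_trans UF _.
apply: subv_trans (@span_catS _ _ [:: wedge e1 e2; A] _ _ sF) _.
apply: (@span_lc _ _ [:: [:: 1]; [:: 0; 1]; [:: 0; 0; 1]; [:: 0; 0; 0; 1]]).
by rewrite xE yE; lists by ring: E.
Qed.

(** Once the third form is f1 f3, a nonzero h24 makes the fourth a product up to multiples of f1 f3;
    otherwise the vanishing of h14 and h23 decides. *)
Lemma quad_34 e1 e2 e3 e4 x y x' y' :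
    (fullv <= <<[:: e1; e2; e3; e4]>>)%VS ->
    x \in <<[:: e3; e4]>>%VS -> y \in <<[:: e3; e4]>>%VS ->
    x' \in <<[:: e3; e4]>>%VS -> y' \in <<[:: e3; e4]>>%VS ->
    (U <= <<[:: wedge e1 e2; wedge e3 e4; (wedge e1 x + wedge e2 y)%R; (wedge e1 x' + wedge e2 y')%R]>>)%VS ->
  classified U.
Proof.
move=> fullE xL yL x'L y'L UF.
have [|[f1 [f2 [f3 [f4 [s [h13 [h14 [h23 [h24 [fullF _ _ sE]]]]]]]]]]] :=
   @rank1_basis _ _ _ _ _ _ _ _ [:: wedge e3 e4] fullE (erefl _) xL yL x'L y'L UF; first by [].
rewrite {}sE => {}UF.
have [h240 | h240] := eqVneq h24 0; last first.
  exists [:: [:: (0, 1)]; [:: (0, 2)]; [:: (1, 3)]; [:: (2, 3)]]%N; first by [].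
  apply: (has_code_lc (g := [:: f1; f2 + (h14 / h24) *: f1; f3; f4 + (h23 / h24) *: f3])
     (T1 := [:: [:: 1]; [:: - (h14 / h24); 1]; [:: 0; 0; 1]; [:: 0; 0; - (h23 / h24); 1]])
     (T2 := [:: [:: 1]; [:: 0; 0; 0; s]; [:: 0; 1]; [:: 0; h13 - h14 * h23 / h24; h24]]) fullF UF) => //.
    by lists by ring.
  by lists by fld.
have [h140 | h140] := eqVneq h14 0.
  exists [:: [:: (0, 1)]; [:: (0, 2)]; [:: (0, 3)]; [:: (1, 2)]]%N; first by [].
  apply: (has_code_lc (g := [:: f3; f1; f2; f4])
     (T1 := [:: [:: 0; 1]; [:: 0; 0; 1]; [:: 1]; [:: 0; 0; 0; 1]])
     (T2 := [:: [:: 0; 0; 0; 1]; [:: 0; 0; s]; [:: - 1]; [:: - h13; - h23]]) fullF UF) => //.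
    by lists by ring.
  by rewrite h240 h140; lists by ring.
have [h230 | h230] := eqVneq h23 0.
  exists [:: [:: (0, 1)]; [:: (0, 2)]; [:: (0, 3)]; [:: (1, 2)]]%N; first by [].
  apply: (has_code_lc (g := [:: f1; f3; f4; f2])
     (T1 := [:: [:: 1]; [:: 0; 0; 0; 1]; [:: 0; 1]; [:: 0; 0; 1]])
     (T2 := [:: [:: 0; 0; 1]; [:: 0; 0; 0; s]; [:: 1]; [:: h13; h14]]) fullF UF) => //.
    by lists by ring.
  by rewrite h240 h230; lists by ring.
exists [:: [:: (0, 1)]; [:: (0, 2)]; [:: (0, 3); (1, 2)]; [:: (1, 3)]]%N; first by [].
apply: (has_code_lc (g := [:: f1; f3; - (h23 / h14) *: f2; f4])
   (T1 := [:: [:: 1]; [:: 0; 0; - (h14 / h23)]; [:: 0; 1]; [:: 0; 0; 0; 1]])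
   (T2 := [:: [:: 0; - (h14 / h23)]; [:: 0; 0; 0; s]; [:: 1]; [:: h13; 0; h14]]) fullF UF) => //.
  by lists by fld.
by rewrite h240; lists by fld.
Qed.

Lemma quad_13_24 f1 f2 f3 f4 h14 h23 h24 k14 k23 k24 : h24 != 0 ->
    (fullv <= <<[:: f1; f2; f3; f4]>>)%VS ->
    (U <= <<[:: wedge f1 f2; wedge f1 f3;
        (h14 *: wedge f1 f4 + h23 *: wedge f2 f3 + h24 *: wedge f2 f4)%R;
        (k14 *: wedge f1 f4 + k23 *: wedge f2 f3 + k24 *: wedge f2 f4)%R]>>)%VS ->
  classified U.
Proof.
move=> h240 fullF UF.
pose f2' := f2 + (h14 / h24) *: f1; pose f4' := f4 + (h23 / h24) *: f3.
pose l14 := k14 - k24 * h14 / h24; pose l23 := k23 - k24 * h23 / h24.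
have {}fullF : (fullv <= <<[:: f1; f2'; f3; f4']>>)%VS.
  apply: subv_trans fullF _.
  apply: (@span_lc _ _ [:: [:: 1]; [:: - (h14 / h24); 1]; [:: 0; 0; 1]; [:: 0; 0; - (h23 / h24); 1]]).
  by lists by ring.
have {}UF : (U <= <<[:: wedge f1 f2'; wedge f1 f3; wedge f2' f4'; (l14 *: wedge f1 f4' + l23 *: wedge f2' f3)%R]>>)%VS.
  apply: subv_trans UF _.
  apply: (@span_lc _ _ [:: [:: 1]; [:: 0; 1]; [:: 0; - (h14 * h23 / h24); h24];
      [:: 0; - (l14 * (h23 / h24) + l23 * (h14 / h24) + k24 * h14 * h23 / h24 / h24); k24; 1]]).
  by rewrite /l14 /l23 /f2' /f4'; lists by fld.
move: f2' f4' l14 l23 UF fullF => {}f2 {}f4 l14 l23 UF fullF.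
have [l140 | l140] := eqVneq l14 0.
  exists [:: [:: (0, 1)]; [:: (0, 2)]; [:: (0, 3)]; [:: (1, 2)]]%N; first by [].
  apply: (has_code_lc (g := [:: f2; f1; f3; f4])
     (T1 := [:: [:: 0; 1]; [:: 1]; [:: 0; 0; 1]; [:: 0; 0; 0; 1]])
     (T2 := [:: [:: - 1]; [:: 0; 0; 0; 1]; [:: 0; 0; 1]; [:: 0; l23]]) fullF UF) => //.
    by lists by ring.
  by rewrite l140; lists by ring.
have [l230 | l230] := eqVneq l23 0.
  exists [:: [:: (0, 1)]; [:: (0, 2)]; [:: (0, 3)]; [:: (1, 2)]]%N; first by [].
  apply: (has_code_lc (g := [:: f1; f2; f4; f3])
     (T1 := [:: [:: 1]; [:: 0; 1]; [:: 0; 0; 0; 1]; [:: 0; 0; 1]])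
     (T2 := [:: [:: 1]; [:: 0; 0; 1]; [:: 0; 0; 0; 1]; [:: 0; l14]]) fullF UF) => //.
    by lists by ring.
  by rewrite l230; lists by ring.
exists [:: [:: (0, 1)]; [:: (0, 2)]; [:: (0, 3); (1, 2)]; [:: (1, 3)]]%N; first by [].
apply: (has_code_lc (g := [:: f1; f2; (l23 / l14) *: f3; f4])
   (T1 := [:: [:: 1]; [:: 0; 1]; [:: 0; 0; l14 / l23]; [:: 0; 0; 0; 1]])
   (T2 := [:: [:: 1]; [:: 0; l14 / l23]; [:: 0; 0; 0; 1]; [:: 0; 0; l14]]) fullF UF) => //.
  by lists by fld.
by lists by fld.
Qed.

Lemma quad_L e1 e2 e3 e4 x y x' y' x2 y2 :
    (fullv <= <<[:: e1; e2; e3; e4]>>)%VS ->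
    x \in <<[:: e3; e4]>>%VS -> y \in <<[:: e3; e4]>>%VS ->
    x' \in <<[:: e3; e4]>>%VS -> y' \in <<[:: e3; e4]>>%VS ->
    x2 \in <<[:: e3; e4]>>%VS -> y2 \in <<[:: e3; e4]>>%VS ->
    (U <= <<[:: wedge e1 e2; (wedge e1 x2 + wedge e2 y2)%R;
             (wedge e1 x + wedge e2 y)%R; (wedge e1 x' + wedge e2 y')%R]>>)%VS ->
  classified U.
Proof.
move=> fullE xL yL x'L y'L x2L y2L UF.
have [|[f1 [f2 [f3 [f4 [_ [h13 [h14 [h23 [h24 [fullF s12 s34 _]]]]]]]]]]] :=
   @rank1_basis _ _ _ _ _ _ _ _ [:: wedge e1 x2 + wedge e2 y2] fullE (erefl _) xL yL x'L y'L UF; first by [].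
have [e1L e2L] : e1 \in <<[:: f1; f2]>>%VS /\ e2 \in <<[:: f1; f2]>>%VS.
  by split; apply: (subvP s12); rewrite memv_span // !inE eqxx ?orbT.
have [[|a [|b []]] // _ e1E] := spanP e1L.
have [[|c [|d []]] // _ e2E] := spanP e2L.
have [[|x3 [|x4 []]] // _ x2E] := spanP (subvP s34 _ x2L).
have [[|y3 [|y4 []]] // _ y2E] := spanP (subvP s34 _ y2L).
move=> {}UF; pose k14 := a * x4 + c * y4; pose k23 := b * x3 + d * y3; pose k24 := b * x4 + d * y4.
have {}UF : (U <= <<[:: wedge f1 f2; wedge f1 f3;
        (h14 *: wedge f1 f4 + h23 *: wedge f2 f3 + h24 *: wedge f2 f4)%R;
        (k14 *: wedge f1 f4 + k23 *: wedge f2 f3 + k24 *: wedge f2 f4)%R]>>)%VS.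
  apply: subv_trans UF _.
  apply: (@span_lc _ _ [:: [:: 1]; [:: 0; a * x3 + c * y3; 0; 1]; [:: 0; 1]; [:: 0; h13; 1]]).
  by rewrite /k14 /k23 /k24 e1E e2E x2E y2E; lists by ring.
have [h240 | h240] := eqVneq h24 0; last exact: quad_13_24 h240 fullF UF.
have [k240 | k240] := eqVneq k24 0; last first.
  apply: (@quad_13_24 f1 f2 f3 f4 k14 k23 k24 h14 h23 h24) => //.
  apply: subv_trans UF _.
  apply: (@span_lc _ _ [:: [:: 1]; [:: 0; 1]; [:: 0; 0; 0; 1]; [:: 0; 0; 1]]).
  by lists by ring.
exists [:: [:: (0, 1)]; [:: (0, 2)]; [:: (0, 3)]; [:: (1, 2)]]%N; first by [].
apply: (has_codeE (T2 := [:: [:: 1]; [:: 0; 1]; [:: 0; 0; h14; h23]; [:: 0; 0; k14; k23]]) fullF UF) => //.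
by rewrite h240 k240; lists by ring.
Qed.

(** The form with s nonzero is completed to s E3 E4 up to e1 e2, and then clears e3 e4 from the
    other two. *)
Lemma quad_s e1 e2 e3 e4 c x y c' x' y' s' c2 x2 y2 s2 (s : k) : s != 0 ->
    (fullv <= <<[:: e1; e2; e3; e4]>>)%VS ->
    x \in <<[:: e3; e4]>>%VS -> y \in <<[:: e3; e4]>>%VS ->
    x' \in <<[:: e3; e4]>>%VS -> y' \in <<[:: e3; e4]>>%VS ->
    x2 \in <<[:: e3; e4]>>%VS -> y2 \in <<[:: e3; e4]>>%VS ->
    (U <= <<[:: wedge e1 e2; (c *: wedge e1 e2 + wedge e1 x + wedge e2 y + s *: wedge e3 e4)%R;
             (c' *: wedge e1 e2 + wedge e1 x' + wedge e2 y' + s' *: wedge e3 e4)%R;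
             (c2 *: wedge e1 e2 + wedge e1 x2 + wedge e2 y2 + s2 *: wedge e3 e4)%R]>>)%VS ->
  classified U.
Proof.
move=> s0 fullE.
move=> /spanP[[|x3 [|x4 []]] // _ ->] /spanP[[|y3 [|y4 []]] // _ ->].
move=> /spanP[[|x3' [|x4' []]] // _ ->] /spanP[[|y3' [|y4' []]] // _ ->].
move=> /spanP[[|p3 [|p4 []]] // _ ->] /spanP[[|q3 [|q4 []]] // _ ->] UF.
pose E3 := e3 + (x4 / s) *: e1 + (y4 / s) *: e2; pose E4 := e4 - (x3 / s) *: e1 - (y3 / s) *: e2.
have EL a b : a *: E3 + b *: E4 \in <<[:: E3; E4]>>%VS.
  by rewrite memvD // memvZ // memv_span // !inE eqxx ?orbT.
pose r' := s' / s; pose r2 := s2 / s.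
pose A3 := x3' - r' * x3; pose A4 := x4' - r' * x4; pose B3 := y3' - r' * y3; pose B4 := y4' - r' * y4.
pose C3 := p3 - r2 * x3; pose C4 := p4 - r2 * x4; pose D3 := q3 - r2 * y3; pose D4 := q4 - r2 * y4.
apply: (@quad_34 e1 e2 E3 E4 (A3 *: E3 + A4 *: E4) (B3 *: E3 + B4 *: E4)
   (C3 *: E3 + C4 *: E4) (D3 *: E3 + D4 *: E4)) => //.
  apply: subv_trans fullE _.
  apply: (@span_lc _ _ [:: [:: 1]; [:: 0; 1]; [:: - (x4 / s); - (y4 / s); 1]; [:: x3 / s; y3 / s; 0; 1]]).
  by rewrite /E3 /E4; lists by ring.
pose m0 := (x4 * y3 - x3 * y4) / s.
apply: subv_trans UF _.
apply: (@span_lc _ _ [:: [:: 1]; [:: c + m0; s];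
    [:: c' + r' * m0 - A3 * (y4 / s) + A4 * (y3 / s) + B3 * (x4 / s) - B4 * (x3 / s); s'; 1];
    [:: c2 + r2 * m0 - C3 * (y4 / s) + C4 * (y3 / s) + D3 * (x4 / s) - D4 * (x3 / s); s2; 0; 1]]).
by rewrite /E3 /E4 /m0 /A3 /A4 /B3 /B4 /C3 /C4 /D3 /D4 /r' /r2; lists by fld.
Qed.

(** The member given by [pencil4_decomposable] is nonzero, since otherwise three forms would span
    [U]. *)
Lemma decomposable4 : (forall A, A \in U -> A^T = - A) ->
  exists u v, wedge u v \in U /\ wedge u v != 0.
Proof.
move=> altU; have [S szS fullS] := full_seq k 4.
have U0 : U != 0%VS by rewrite -dimv_eq0 dimU.
have FU := memv_pick U; have F0 : vpick U != 0 by rewrite vpick0.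
have [Z] := member_extend FU F0; rewrite dimU; case: Z => [|G [|H [|K []]]] // _ UE.
have GU : G \in U by rewrite UE memv_span // !inE eqxx ?orbT.
have [r [S' [szS' sS ler FE]]] := ext2_std (alt_ext2 char_neq2 fullS (altU _ FU)).
move: szS' sS FE FU F0 UE; rewrite szS in ler *; move: (vpick U) => F.
case: S' => [|e1 [|e2 [|e3 [|e4 []]]]] // _ /(subv_trans fullS) fullE.
case: r ler => [|[|[|]]] //= _ ->; first by rewrite eqxx.
  by rewrite addr0 => FU F0 _; exists e1, e2.
rewrite addr0 => FU F0 UE.
have [t [u [v [_ _ uvE]]]] := pencil4_decomposable (alt_ext2 char_neq2 fullE (altU _ GU)).
exists u, v; rewrite -uvE memvD ?memvZ //; split=> //.
apply/eqP=> G0; apply: (@few_generators _ _ [:: wedge e1 e2 + wedge e3 e4; H; K] U); last by rewrite dimU.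
rewrite {1}UE; apply: (@span_lc _ _ [:: [:: 1]; [:: - t]; [:: 0; 1]; [:: 0; 0; 1]]).
have -> : G = - t *: (wedge e1 e2 + wedge e3 e4) by apply/eqP; rewrite scaleNr -addr_eq0 G0.
by lists by ring.
Qed.

(** Once u v is split off, either some generator involves e3 e4 or the whole space lies in the ideal
    of u and v. *)
Lemma quad_classified : (forall A, A \in U -> A^T = - A) -> classified U.
Proof.
move=> altU; have [u [v [uvU uv0]]] := decomposable4 altU.
have fuv := wedge_free uv0; have [S szS fullS] := full_seq k 4.
have [] := steinitz2 fuv (subvP fullS u (memvf u)) (subvP fullS v (memvf v)).
rewrite szS => -[|e3 [|e4 []]] // _ /(subv_trans fullS) fullE.
have [Z] := member_extend uvU uv0; rewrite dimU; case: Z => [|G [|H [|K []]]] // _ UE.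
have mem A : A \in [:: G; H; K] -> exists c x y s, [/\ x \in <<[:: e3; e4]>>%VS,
    y \in <<[:: e3; e4]>>%VS & A = c *: wedge u v + wedge u x + wedge v y + s *: wedge e3 e4].
  move=> AU; have /split2[c [x [y [B [xL yL /ext2_pair[s ->] ->]]]]] : A \in ext2 [:: u; v; e3; e4].
    by apply: alt_ext2; rewrite // altU // UE memv_span // inE AU orbT.
  by exists c, x, y, s.
have [|c1 [x1 [y1 [s1 [x1L y1L GE]]]]] := mem G; first by rewrite !inE eqxx.
have [|c2 [x2 [y2 [s2 [x2L y2L HE]]]]] := mem H; first by rewrite !inE eqxx orbT.
have [|c3 [x3 [y3 [s3 [x3L y3L KE]]]]] := mem K; first by rewrite !inE eqxx !orbT.
have UF : (U <= <<[:: wedge u v; G; H; K]>>)%VS by rewrite {1}UE.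
rewrite {}GE {}HE {}KE in UF.
have [s10 | s10] := eqVneq s1 0; last exact: quad_s s10 fullE x1L y1L x2L y2L x3L y3L UF.
have [s20 | s20] := eqVneq s2 0; last first.
  apply: (quad_s s20 fullE x2L y2L x1L y1L x3L y3L (c := c2) (c' := c1) (s' := s1) (c2 := c3) (s2 := s3)).
  apply: subv_trans UF _.
  by apply: (@span_lc _ _ [:: [:: 1]; [:: 0; 0; 1]; [:: 0; 1]; [:: 0; 0; 0; 1]]); lists by ring.
have [s30 | s30] := eqVneq s3 0; last first.
  apply: (quad_s s30 fullE x3L y3L x1L y1L x2L y2L (c := c3) (c' := c1) (s' := s1) (c2 := c2) (s2 := s2)).
  apply: subv_trans UF _.
  by apply: (@span_lc _ _ [:: [:: 1]; [:: 0; 0; 1]; [:: 0; 0; 0; 1]; [:: 0; 1]]); lists by ring.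
apply: (quad_L fullE x1L y1L x2L y2L x3L y3L); apply: subv_trans UF _.
apply: (@span_lc _ _ [:: [:: 1]; [:: c1; 0; 1]; [:: c2; 0; 0; 1]; [:: c3; 1]]).
by rewrite s10 s20 s30; lists by ring.
Qed.

End DimensionFour.

(** * The case distinction on the number m of variables *)

Lemma dim_ext2 (k : fieldType) m (S : seq 'rV[k]_m) : (\dim (ext2 S) <= 'C(size S, 2))%N.
Proof.
elim: S => [|x S IHS] /=; first by rewrite dimv0.
rewrite binS bin1 addnC (leq_trans (dimv_add_leqif _ _)) // leq_add //.
by rewrite (leq_trans (dim_span _)) ?size_map.
Qed.

Lemma alternating_classified (k : closedFieldType) m (U : {vspace 'M[k]_m}) :
  2%N \notin [pchar k] -> (forall A, A \in U -> A^T = - A) -> (m + \dim U = 8)%N ->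
  classified U.
Proof.
move=> char_neq2 altU dimU.
have decomposable_or_not : indecomposable U \/ exists u v, wedge u v \in U /\ wedge u v != 0.
  have [[u [v uvU]] | no] := classic (exists u v, wedge u v \in U /\ wedge u v != 0).
    by right; exists u, v.
  left=> u v uvU; apply/eqP; apply: contraT => uv0; case: no.
  by exists u, v.
have [S szS fullS] := full_seq k m.
have leU : (\dim U <= 'C(m, 2))%N.
  have <- : 'C(size S, 2) = 'C(m, 2) by rewrite szS.
  apply: leq_trans (dim_ext2 S); apply: dimvS.
  by apply/subvP=> A /altU; apply: alt_ext2.
have lem : (m <= 8)%N by rewrite -dimU leq_addr.
move: altU decomposable_or_not leU dimU.
case: m U {S szS fullS} lem => [|[|[|[|[|[|[|[|[|//]]]]]]]]] U _ altU dec leU;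
  rewrite ?addSn add0n => -[dimU].
- by rewrite dimU in leU.
- by rewrite dimU in leU.
- by rewrite dimU in leU.
- by rewrite dimU in leU.
- exact: quad_classified.
- case: dec => [indecU | [u [v [uvU uv0]]]]; first exact: net_indecomposable.
  exact: net_decomposable uvU uv0.
- case: dec => [indecU | [u [v [uvU uv0]]]]; first exact: pencil_indecomposable.
  have [S szS fullS] := full_seq k 6.
  have [Z] := steinitz2 (wedge_free uv0) (subvP fullS u (memvf u)) (subvP fullS v (memvf v)).
  rewrite szS => -[szZ] /(subv_trans fullS) fullZ.
  have [[|G []] + UE] := member_extend uvU uv0; rewrite dimU // => _.
  apply: (pencil_decomposable dimU szZ fullZ (G := G)); first by rewrite {1}UE.
  by apply: alt_ext2; rewrite // altU // UE memv_span // !inE eqxx orbT.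
- have FU := memv_pick U; have F0 : vpick U != 0 by rewrite vpick0 -dimv_eq0 dimU.
  have [[|G Z] + UE] := member_extend FU F0; rewrite dimU // => _.
  have [S szS fullS] := full_seq k 7.
  have [r [S' [szS' sS ler FE]]] := ext2_std (alt_ext2 char_neq2 fullS (altU _ FU)).
  have UF : (U <= <<[:: std r S']>>)%VS by rewrite {1}UE FE.
  move: szS' sS UF F0; rewrite FE {UE}; rewrite szS in ler *.
  case: S' {FE} => [|e1 [|e2 [|e3 [|e4 [|e5 [|e6 [|e7 []]]]]]]] // _ /(subv_trans fullS) fullE.
  case: r ler => [|[|[|[|]]]] //= _ UF; first by rewrite eqxx.
  + exists [:: [:: (0, 1)]]%N; first by [].
    by apply: (has_codeE (T2 := [:: [:: 1]]) fullE UF) => //; lists by ring.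
  + exists [:: [:: (0, 1); (2, 3)]]%N; first by [].
    by apply: (has_codeE (T2 := [:: [:: 1]]) fullE UF) => //; lists by ring.
  exists [:: [:: (0, 1); (2, 3); (4, 5)]]%N; first by [].
  by apply: (has_codeE (T2 := [:: [:: 1]]) fullE UF) => //; lists by ring.
have [S szS fullS] := full_seq k 8.
exists [::]; first by [].
apply: (has_codeE (g := S) (F := [::]) (T2 := [::])) => //.
by rewrite span_nil subv0 -dimv_eq0 dimU.
Qed.

(** * Ranks over the integers *)

(* The concrete [eqn] and [intZmod.addz], rather than the generic operations, keep
   [vm_compute] fast. *)
Definition sparse := seq (nat * nat * nat * int).

Definition same_key (x y : nat * nat * nat) :=
  let: (x1, x2, x3) := x in let: (y1, y2, y3) := y in
  [&& eqn x1 y1, eqn x2 y2 & eqn x3 y3].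

Definition before (x y : nat * nat * nat) :=
  let: (x1, x2, x3) := x in let: (y1, y2, y3) := y in
  (x1 < y1)%N || eqn x1 y1 && ((x2 < y2)%N || eqn x2 y2 && (x3 < y3)%N).

(** A sparse vector is read through [coef], which adds up entries with equal keys; the order kept by
    [insert] only serves to keep the rows short. *)
Definition coef x (R : sparse) : int :=
  foldr (fun e z => if same_key e.1 x then intZmod.addz e.2 z else z) (Posz 0) R.

Definition nonzero (z : int) := if z is Posz 0 then false else true.

Fixpoint insert x z (R : sparse) : sparse :=
  match R with
  | [::] => [:: (x, z)]
  | (y, t) :: R' =>
    if same_key y x then
      let u := intZmod.addz t z in if nonzero u then (x, u) :: R' else R'
    else if before x y then (x, z) :: R else (y, t) :: insert x z R'
  end.

Definition insert_all (T R : sparse) : sparse :=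
  foldr (fun e T' => if nonzero e.2 then insert e.1 e.2 T' else T') T R.

Definition scale_row z (R : sparse) : sparse := [seq (e.1, intRing.mulz z e.2) | e <- R].

(** Fraction-free elimination: [R] is multiplied by the pivot before a multiple of [P] is
    subtracted. This loses nothing over a field where the pivot is invertible. *)
Definition eliminate x p (P R : sparse) : sparse :=
  let a := coef x R in
  if nonzero a then insert_all (scale_row p R) (scale_row (intZmod.oppz a) P) else R.

(* The only pivots that occur; they are invertible outside characteristics 2 and 3. *)
Definition unit6 (z : int) := match absz z with 1 | 2 | 3 | 4 | 6 => true | _ => false end.

(** A value [Some r] is a certificate: a pivot outside [unit6], an index out of range or exhausted
    fuel gives [None]. Each step uses up one row, so the number of rows is enough fuel. *)
Fixpoint rank_rows n (fuel : nat) (Rs : seq sparse) : option nat :=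
  match fuel, Rs with
  | _, [::] => Some 0
  | fuel'.+1, [::] :: Rs' => rank_rows n fuel' Rs'
  | fuel'.+1, ((((i, s, t) as x), _) :: _) as P :: Rs' =>
    let p := coef x P in
    if [&& unit6 p, (i < n)%N, (s < n)%N & (t < n)%N]
    then omap succn (rank_rows n fuel' [seq eliminate x p P R | R <- Rs'])
    else None
  | _, _ => None
  end.

(** The image of the elementary matrix at (a, b) under the linear system of the invariant; the key
    (i, s, t) is the entry (s, t) of its i-th equation, and [Negz 0] is -1. *)
Definition derivation_row (al ga : int) (c : seq (seq (nat * nat))) (a b : nat) : sparse :=
  insert_all [::] (
    flatten [seq [:: ((a, p.1, p.2), al); ((a, p.2, p.1), intZmod.oppz al)] | p <- nth [::] c b] ++
    flatten [seq flatten [seq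
       [:: ((i, b, p.2), if eqn p.1 a then Negz 0 else Posz 0);
           ((i, b, p.1), if eqn p.2 a then Posz 1 else Posz 0);
           ((i, p.1, b), if eqn p.2 a then intZmod.oppz ga else Posz 0);
           ((i, p.2, b), if eqn p.1 a then ga else Posz 0)] | p <- nth [::] c i] | i <- iota 0 (size c)]).

Definition derivation_rank (al ga : int) c :=
  let n := size c in
  rank_rows n (n * n) (flatten [seq [seq derivation_row al ga c a b | b <- iota 0 n] | a <- iota 0 n]).

(** The m closed generators come first, with the empty form; the indices in a code of [codes m]
    refer to them. *)
Definition table : seq (seq (seq (nat * nat))) :=
  flatten [seq [seq nseq m [::] ++ c | c <- codes m] | m <- [:: 8; 7; 6; 5; 4]%N].

Definition derivation_ranks c :=
  [:: derivation_rank (Posz 1) (Posz 1) c; derivation_rank (Posz 0) (Posz 1) c;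
      derivation_rank (Posz 0) (Negz 0) c].

Lemma same_keyE x y : same_key x y = (x == y).
Proof. by case: x y => [[x1 x2] x3] [[y1 y2] y3]; rewrite -!pair_eqE /= andbA. Qed.

Lemma nonzeroE z : nonzero z = (z != 0).
Proof. by case: z => [[]|]. Qed.

Lemma coef_cons y e R : coef y (e :: R) = (if e.1 == y then e.2 else 0) + coef y R.
Proof. by rewrite /= same_keyE; case: eqP; rewrite ?add0r. Qed.

Lemma coef_insert y x z R : coef y (insert x z R) = (if x == y then z else 0) + coef y R.
Proof.
elim: R => [|[x' t] R IHR]; first by rewrite /insert coef_cons.
rewrite /insert -/insert same_keyE; have [-> | nex] := eqVneq x' x.
  rewrite nonzeroE; case: eqP => [u0 | _]; rewrite !coef_cons /=; case: eqP => // _.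
  - by rewrite addrA [z + t]addrC (u0 : t + z = 0) add0r.
  - by rewrite !add0r.
  - by rewrite addrA [z + t]addrC.
  by rewrite !add0r.
case: ifP => _; first by rewrite coef_cons.
by rewrite !coef_cons IHR addrCA.
Qed.

Lemma coef_insert_all y T R : coef y (insert_all T R) = coef y R + coef y T.
Proof.
elim: R => [|e R IHR]; first by rewrite add0r.
rewrite coef_cons -addrA -IHR /= nonzeroE; case: eqP => [-> | _].
  by case: ifP; rewrite add0r.
by rewrite coef_insert.
Qed.

Lemma coef_scale y z R : coef y (scale_row z R) = z * coef y R.
Proof.
elim: R => [|e R IHR]; first by rewrite mulr0.
rewrite -[scale_row z _]/((e.1, z * e.2) :: scale_row z R) !coef_cons IHR mulrDr /=.
case: ifP => // _.
by rewrite mulr0.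
Qed.

Lemma coef_eliminate x p P R : exists u v : int,
  [/\ forall y, coef y (eliminate x p P R) = u * coef y R - v * coef y P,
     u = p \/ u = 1 & p = coef x P -> u * coef x R - v * coef x P = 0].
Proof.
rewrite /eliminate nonzeroE; case: eqP => [a0 | _].
  by exists 1, 0; split=> [z||]; rewrite ?a0 ?mul1r ?mul0r ?subr0 //; right.
exists p, (coef x R); split=> [z||->]; last by rewrite mulrC subrr.
  by rewrite coef_insert_all !coef_scale mulNr addrC.
by left.
Qed.

(** * The invariant over a field of characteristic other than 2 and 3 *)

Section Rank.

Variables (k : fieldType) (n : nat).
Hypotheses (char_neq2 : 2%N \notin [pchar k]) (char_neq3 : 3%N \notin [pchar k]).
Local Notation V := {ffun 'I_n * 'I_n * 'I_n -> k^o}.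

Definition row_vec (R : sparse) : V :=
  [ffun x => (coef (val x.1.1, val x.1.2, val x.2) R)%:~R].

Lemma unit6_neq0 z : unit6 z -> z%:~R != 0 :> k.
Proof.
have n2 : 2%:R != 0 :> k by exact: two_neq0.
have n3 : 3%:R != 0 :> k by move: char_neq3; rewrite !inE.
have n1 : 1%:R != 0 :> k by rewrite oner_eq0.
suff nat6 m : match m with 1 | 2 | 3 | 4 | 6 => true | _ => false end -> m%:R != 0 :> k.
  case: z => m; first exact: nat6.
  by move=> u6; rewrite NegzE rmorphN oppr_eq0; apply: (nat6 m.+1 u6).
case: m => [|[|[|[|[|[|[|m]]]]]]] // _.
  by rewrite -[4%N]/(2 * 2)%N natrM mulf_neq0.
by rewrite -[6%N]/(2 * 3)%N natrM mulf_neq0.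
Qed.

Lemma dim_span_cons (v : V) (S : seq V) : v \notin <<S>>%VS ->
  \dim <<v :: S>> = (\dim <<S>>).+1.
Proof.
move=> vS; have v0 : v != 0 by apply: contraNneq vS => ->; rewrite mem0v.
rewrite span_cons dimv_disjoint_sum ?dim_vline ?v0 //.
apply/eqP; rewrite -subv0; apply/subvP=> w; rewrite memv_cap => /andP[/vlineP[a ->] aS].
have [-> | a0] := eqVneq a 0; first by rewrite scale0r mem0v.
by case/negP: vS; rewrite -[v](scalerK a0) memvZ.
Qed.

(** The pivot row is nonzero at the pivot position, where all eliminated rows vanish, so it lies
    outside their span. The total span is unchanged, since each row was multiplied by 1 or by an
    invertible pivot. *)
Lemma rank_rowsP fuel Rs r :
  rank_rows n fuel Rs = Some r -> \dim <<map row_vec Rs>> = r.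
Proof.
elim: fuel Rs r => [|fuel IH] [|P Rs] r //=; try by case=> <-; rewrite span_nil dimv0.
case: P => [|[[[i s] t] z] P] //=.
  move/IH <-; rewrite span_cons; have -> : row_vec [::] = 0 by apply/ffunP=> x; rewrite !ffunE.
  by rewrite (_ : <[0]> = 0)%VS ?add0v //; apply/eqP; rewrite -dimv_eq0 dim_vline eqxx.
set Q := (_, z) :: P; set x := (i, s, t); set p := coef x Q.
rewrite -[if same_key x x then _ else _]/p.
case: ifP => // /and4P[p6 lti lts ltt].
case Er: (rank_rows _ _ _) => [r'|] //= [<-]; rewrite -(IH _ _ Er).
have p0 := unit6_neq0 p6.
pose y : 'I_n * 'I_n * 'I_n := (Ordinal lti, Ordinal lts, Ordinal ltt).

rewrite -map_comp; set S := map (row_vec \o _) Rs.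
have fE c (v w : V) : (c *: v + w) y = c * v y + w y by rewrite !ffunE.
have Ry R : row_vec (eliminate x p Q R) y = 0.
  have [u [v [E _ /(_ erefl) E0]]] := coef_eliminate x p Q R.
  by rewrite ffunE -[X in coef X _]/x E E0.
have Sy w : w \in <<S>>%VS -> w y = 0.
  case/spanP=> cs _ ->; rewrite /S; elim: (Rs) cs => [|R Rs' IHR] [|c cs] /=; try by rewrite ffunE.
  by rewrite fE IHR addr0 (Ry R : _ = 0) mulr0.
have QS : row_vec Q \notin <<S>>%VS.
  by apply: contraNN p0 => /Sy; rewrite ffunE => ->.
rewrite -(dim_span_cons QS); congr (\dim _).
have elimE R : exists u v : k, [/\ u != 0
    & row_vec (eliminate x p Q R) = u *: row_vec R - v *: row_vec Q].
  have [u [v [E up _]]] := coef_eliminate x p Q R.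
  exists u%:~R, v%:~R; split; first by case: up => ->; rewrite ?oner_eq0.
  by apply/ffunP=> w; rewrite !ffunE E rmorphB !rmorphM.
apply/eqP; rewrite eqEsubv; apply/andP; split; apply/span_subvP=> w;
  rewrite inE => /predU1P[-> | /mapP[R RRs ->]]; try by rewrite memv_span // mem_head.
  have [u [v [u0 E]]] := elimE R.
  have -> : row_vec R = u^-1 *: (row_vec (eliminate x p Q R) + v *: row_vec Q).
    by rewrite E subrK scalerK.
  rewrite memvZ // memvD // ?memvZ // memv_span // ?mem_head //.
  by rewrite inE (map_f (fun R => row_vec (eliminate x p Q R)) RRs) orbT.
have [u [v [u0 /= ->]]] := elimE R; rewrite memvB // memvZ // memv_span // ?mem_head //.
by rewrite inE map_f ?orbT.
Qed.

Definition code_int (c : seq (seq (nat * nat))) i s t : int :=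
  \sum_(p <- nth [::] c i)
    (((p.1 == s) && (p.2 == t))%:R - ((p.1 == t) && (p.2 == s))%:R).

Lemma coef_cat y R T : coef y (R ++ T) = coef y R + coef y T.
Proof.
elim: R => [|e R IHR]; first by rewrite add0r.
by rewrite cat_cons !coef_cons IHR addrA.
Qed.

Lemma coef_flatten (I : Type) y (F : I -> sparse) (r : seq I) :
  coef y (flatten [seq F x | x <- r]) = \sum_(x <- r) coef y (F x).
Proof.
elim: r => [|x r IHr]; first by rewrite big_nil.
by rewrite big_cons /= coef_cat IHr.
Qed.

Lemma coef_derivation_row al ga c a b i s t : (i < size c)%N ->
  coef (i, s, t) (derivation_row al ga c a b) =
    al * ((a == i)%:R * code_int c b s t) - (b == s)%:R * code_int c i a t
    - ga * ((b == t)%:R * code_int c i s a).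
Proof.
move=> lti; rewrite /derivation_row coef_insert_all addr0 coef_cat !coef_flatten.
rewrite -addrA; congr (_ + _).
  rewrite /code_int !mulr_sumr; apply: eq_bigr => p _.
  rewrite !coef_cons !xpair_eqE /= addr0 -[intZmod.oppz al]/(- al) -!eqnE.
  by case: (eqn a i); case: (eqn p.1 s); case: (eqn p.2 s);
    case: (eqn p.1 t); case: (eqn p.2 t) => /=; ring.
rewrite (bigD1_seq i) ?iota_uniq ?mem_iota //= [X in _ + X]big1 ?addr0; last first.
  move=> j neji; rewrite coef_flatten big1 // => p _.
  by rewrite !coef_cons !xpair_eqE (negPf neji) /= !addr0.
rewrite coef_flatten /code_int !mulr_sumr -!sumrN -big_split; apply: eq_bigr => p _.
rewrite !coef_cons !xpair_eqE eqxx /= addr0 -[intZmod.oppz ga]/(- ga) -!eqnE.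
by case: (eqn b s); case: (eqn b t); case: (eqn p.1 a); case: (eqn p.2 a);
  case: (eqn p.1 s); case: (eqn p.2 s); case: (eqn p.1 t); case: (eqn p.2 t) => /=; ring.
Qed.

Definition code_mx c i : 'M[k]_n := \matrix_(s, t) (code_int c i s t)%:~R.

Definition derivation_map (al ga : int) c (X : 'M[k]_n) : V :=
  [ffun x => (al%:~R *: (\sum_j X x.1.1 j *: code_mx c j) - X^T *m code_mx c x.1.1
              - ga%:~R *: (code_mx c x.1.1 *m X)) x.1.2 x.2].

Fact derivation_map_linear al ga c : linear (derivation_map al ga c).
Proof.
move=> z X Y; apply/ffunP=> x; rewrite !ffunE /=.
have -> : \sum_j (z *: X + Y) x.1.1 j *: code_mx c j =
    z *: (\sum_j X x.1.1 j *: code_mx c j) + \sum_j Y x.1.1 j *: code_mx c j.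
  rewrite scaler_sumr -big_split; apply: eq_bigr => j _.
  by rewrite !mxE scalerDl scalerA.
rewrite [(_ + _)^T]linearP /= mulmxDl mulmxDr -scalemxAl -scalemxAr.
by rewrite !mxE -[z *: _]/(z * _); ring.
Qed.
HB.instance Definition _ al ga c :=
  GRing.isLinear.Build k 'M[k]_n V *:%R (derivation_map al ga c)
    (derivation_map_linear al ga c).

Lemma derivation_map_delta al ga c (a b : 'I_n) : size c = n ->
  derivation_map al ga c (delta_mx a b) = row_vec (derivation_row al ga c a b).
Proof.
move=> szc; apply/ffunP=> -[[i s] t]; rewrite !ffunE /= coef_derivation_row ?szc ?ltn_ord //.
have -> : \sum_j (delta_mx a b : 'M[k]_n) i j *: code_mx c j = (i == a)%:R *: code_mx c b.
  rewrite (bigD1 b) //= big1 ?addr0 => [|j neb]; first by rewrite mxE eqxx andbT.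
  by rewrite mxE (negPf neb) andbF scale0r.
rewrite !mxE !rmorphB !rmorphM /=.
have iE (x y : 'I_n) : (val x == val y)%:R%:~R = (y == x)%:R :> k by rewrite eq_sym rmorph_nat.
rewrite !iE; congr (_ - _ - _ * _).
  rewrite (bigD1 a) //= big1 ?addr0 => [|u neu].
    by rewrite !mxE eqxx /= eq_sym.
  by rewrite !mxE (negPf neu) mul0r.
rewrite (bigD1 a) //= big1 ?addr0 => [|u neu].
  by rewrite !mxE eqxx /= mulrC.
by rewrite !mxE (negPf neu) mulr0.
Qed.

Definition derivations al ga c : {vspace 'M[k]_n} :=
  lker (linfun (derivation_map al ga c)).

(** Rank plus nullity: the rows are the images of the elementary matrices and hence span the
    image. *)
Lemma dim_derivations al ga c r : size c = n ->
  derivation_rank al ga c = Some r -> (\dim (derivations al ga c) + r = n * n)%N.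
Proof.
move=> szc; rewrite /derivation_rank szc => /rank_rowsP <-.
have := limg_ker_dim (linfun (derivation_map al ga c)) fullv.
have -> : \dim {:'M[k]_n} = (n * n)%N by rewrite dimvf.
rewrite capfv => <-; congr (_ + \dim _)%N.
apply/eqP; rewrite eqEsubv; apply/andP; split.
  apply/span_subvP=> _ /mapP[R /flatten_mapP[a +] + ->].
  rewrite mem_iota => /andP[_ lta] /mapP[b]; rewrite mem_iota => /andP[_ ltb] ->.
  rewrite -(derivation_map_delta al ga (Ordinal lta) (Ordinal ltb) szc).
  by apply/memv_imgP; exists (delta_mx (Ordinal lta) (Ordinal ltb)); rewrite ?memvf ?lfunE.
apply/subvP=> _ /memv_imgP[X _ ->]; rewrite lfunE /= [X]matrix_sum_delta linear_sum.
apply: memv_suml => a _; rewrite linear_sum; apply: memv_suml => b _; rewrite linearZ memvZ //=.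
rewrite derivation_map_delta // memv_span // map_f //.
apply/flatten_mapP; exists (val a); first by rewrite mem_iota /=.
by apply/mapP; exists (val b); rewrite // mem_iota /=.
Qed.

(** Both sides are d of the i-th new generator in the old coordinates, obtained by linearity on the
    left and by substitution into the form of [c'] on the right. *)
Definition congruent c c' := exists2 P : 'M[k]_n, P \in unitmx
  & forall i : 'I_n, \sum_j P i j *: code_mx c j = P^T *m code_mx c' i *m P.

Lemma sum_mulmx_scale (A B : 'M[k]_n) (C : 'I_n -> 'M[k]_n) l :
  \sum_j (A *m B) l j *: C j = \sum_u A l u *: (\sum_j B u j *: C j).
Proof.
under [RHS]eq_bigr => u _ do rewrite scaler_sumr.
rewrite exchange_big; apply: eq_bigr => j _; rewrite mxE scaler_suml.
by apply: eq_bigr => u _; rewrite scalerA.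
Qed.

(** Conjugation by P, X |-> P^-1 X P, sends the solutions for [c'] injectively to solutions for
    [c]. *)
Lemma derivations_congruent al ga c c' : congruent c c' ->
  (\dim (derivations al ga c') <= \dim (derivations al ga c))%N.
Proof.
case=> P uP PE; pose h (X : 'M[k]_n) := invmx P *m X *m P.
have h_lin : linear h.
  by move=> a X Y; rewrite /h mulmxDr mulmxDl -scalemxAr -scalemxAl.
pose hL : {linear 'M[k]_n -> 'M[k]_n} := HB.pack h (GRing.isLinear.Build k _ _ _ h h_lin).
have h_inj : lker (linfun hL) = 0%VS.
  apply/eqP; rewrite -subv0; apply/subvP=> X; rewrite memv_ker lfunE /= memv0 => /eqP h0.
  rewrite -[X]mulmx1 -(mulmxV uP) -[X]mul1mx -(mulmxV uP) !mulmxA.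
  by rewrite -[P *m invmx P *m X *m P]mulmxA -[_ *m (X *m P)]mulmxA [invmx P *m _]mulmxA -/(h X) [h X]h0 mulmx0 mul0mx.
rewrite -(limg_dim_eq (f := linfun hL)) ?h_inj ?capv0 //.
apply: dimvS; apply/subvP=> _ /memv_imgP[X XD ->]; rewrite lfunE /=.
move: XD; rewrite /derivations !memv_ker !lfunE /= => /eqP XD; apply/eqP.
have XE i : al%:~R *: (\sum_j X i j *: code_mx c' j) =
    X^T *m code_mx c' i + ga%:~R *: (code_mx c' i *m X).
  apply/matrixP=> s t; have := congr1 (fun f : V => f (i, s, t)) XD.
  rewrite !ffunE /= => /eqP; rewrite !mxE -addrA -opprD subr_eq0 => /eqP.
  by [].
pose defect (u : 'I_n) : 'M[k]_n := al%:~R *: (\sum_j h X u j *: code_mx c j)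
    - (h X)^T *m code_mx c u - ga%:~R *: (code_mx c u *m h X).
suff defect0 i : defect i = 0.
  by apply/ffunP=> x; rewrite !ffunE -[LHS]/(defect x.1.1 x.1.2 x.2) defect0 mxE.
have PhX : P *m h X = X *m P by rewrite /h !mulmxA mulmxV // mul1mx.
have dE u : defect u = al%:~R *: (\sum_j h X u j *: code_mx c j)
    - (h X)^T *m code_mx c u - ga%:~R *: (code_mx c u *m h X) by [].
(* The equations for [c] are first verified in the combinations given by the rows of P;
   invertibility of P then yields each of them. *)
have sumPd l : \sum_i P l i *: defect i = 0.
  have -> : \sum_i P l i *: defect i = al%:~R *: (\sum_i P l i *: (\sum_j h X i j *: code_mx c j))
      - (h X)^T *m (\sum_i P l i *: code_mx c i) - ga%:~R *: ((\sum_i P l i *: code_mx c i) *m h X).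
    rewrite mulmx_sumr mulmx_suml !scaler_sumr -!sumrB; apply: eq_bigr => v _.
    rewrite dE !scalerBr; congr (_ - _ - _).
    - by rewrite !scalerA mulrC.
    - by rewrite scalemxAr.
    by rewrite -scalemxAl !scalerA mulrC.
  rewrite -sum_mulmx_scale PhX sum_mulmx_scale PE.
  have -> : \sum_u X l u *: (\sum_j P u j *: code_mx c j) =
      P^T *m (\sum_j X l j *: code_mx c' j) *m P.
    rewrite mulmx_sumr mulmx_suml; apply: eq_bigr => u _.
    by rewrite PE -scalemxAr -scalemxAl.
  rewrite scalemxAl scalemxAr XE -!mulmxA PhX !mulmxA -trmx_mul PhX trmx_mul.
  rewrite mulmxDr mulmxDl -scalemxAr -scalemxAl !mulmxA.
  by rewrite [X in X - _ - _]addrC addrK subrr.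
have {sumPd} := sumPd; move: (defect) => f sumPd.
have -> : f i = \sum_j (1%:M : 'M[k]_n) i j *: f j.
  rewrite (bigD1 i) //= big1 ?addr0 => [|j nej]; first by rewrite mxE eqxx scale1r.
  by rewrite mxE eq_sym (negPf nej) scale0r.
rewrite -(mulVmx uP) sum_mulmx_scale big1 // => u _.
by rewrite sumPd scaler0.
Qed.

End Rank.

(** * Quadratic elements of the exterior algebra as matrices *)

Lemma basis_size (k : fieldType) (V : vectType k) (U : {vspace V}) (e : seq V) :
  basis_of U e -> size e = \dim U.
Proof. by case/andP=> /eqP <- /eqnP <-. Qed.

Section CodeForm.

Variables (k : fieldType) (V : vectType k).
Local Notation n := (\dim {:V}).
Local Notation inc := (ext_inc V).
Implicit Types (e : seq V) (f : seq (nat * nat)) (Y Z : 'M[k]_n).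

Definition code_form e f : exterior V := \sum_(p <- f) inc e`_p.1 * inc e`_p.2.

Definition vrow (x : V) : 'rV[k]_n := \row_i coord (vbasis {:V}) i x.

Fact vrow_linear : linear vrow.
Proof. by move=> a x y; apply/rowP=> i; rewrite !mxE linearP. Qed.
HB.instance Definition _ := GRing.isLinear.Build k V 'rV[k]_n *:%R vrow vrow_linear.

Lemma vrow_sum x : x = \sum_i vrow x 0 i *: vcoord i.
Proof. by rewrite {1}[x]vcoord_decomp; apply: eq_bigr => i _; rewrite mxE. Qed.

Lemma vrow_vcoord i : vrow (vcoord i) = delta_mx 0 i.
Proof.
apply/rowP=> j; rewrite !mxE eqxx /= coord_free ?(basis_free (vbasisP _)) //.
by rewrite eq_sym.
Qed.

(** The coefficient matrix of a quadratic element is determined only up to symmetric matrices, which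
    is why matrices are antisymmetrized below. *)
Definition quad_form Y : exterior V :=
  \sum_i \sum_j Y i j *: (inc (vcoord i) * inc (vcoord j)).

Fact quad_form_linear : linear quad_form.
Proof.
move=> a Y Z; rewrite /quad_form scaler_sumr -big_split; apply: eq_bigr => i _ /=.
rewrite scaler_sumr -big_split; apply: eq_bigr => j _ /=.
by rewrite !mxE scalerDl scalerA.
Qed.
HB.instance Definition _ :=
  GRing.isLinear.Build k 'M[k]_n (exterior V) *:%R quad_form quad_form_linear.

Lemma quad_form_mul x y : quad_form ((vrow x)^T *m vrow y) = inc x * inc y.
Proof.
rewrite {2}[x]vrow_sum {2}[y]vrow_sum !linear_sum mulr_suml; apply: eq_bigr => i _.
rewrite mulr_sumr; apply: eq_bigr => j _.
by rewrite !linearZ /= -scalerAl -scalerAr scalerA !mxE big_ord1 !mxE.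
Qed.

(** For s < t the coefficient at the basis element of {s, t} is Y s t - Y t s, as no other pair of
    indices contributes. *)
Lemma quad_form_eq0 Y : quad_form Y = 0 -> Y = Y^T.
Proof.
move=> Y0; have lt_eq (s t : 'I_n) : (s < t)%N -> Y s t = Y t s.
  move=> st; have ne : s != t by rewrite -(inj_eq val_inj) ltn_eqF.
  have val_mul i j : (inc (vcoord i) * inc (vcoord j)) [set s; t] =
      if [set i] :|: [set j] == [set s; t] then (ext_sign [set i] [set j] : k) else 0 :> k.
    rewrite !ext_inc_vcoord [_ * _]ext_mul_elt !ffunE eq_sym.
    by case: eqP => _; [exact: mulr1 | exact: mulr0].
  have evalZ a (u : exterior V) : (a *: u) [set s; t] = a * (u [set s; t] : k) by rewrite !ffunE.
  have E0 : \sum_i \sum_j ((Y i j *: (inc (vcoord i) * inc (vcoord j))) [set s; t] : k) = 0.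
    transitivity ((quad_form Y) [set s; t] : k); last by rewrite Y0 ffunE.
    by rewrite sum_ffunE; apply: eq_bigr => i _; rewrite sum_ffunE.
  have val0 i j : (i == s) && (j == t) = false -> (i == t) && (j == s) = false ->
      (Y i j *: (inc (vcoord i) * inc (vcoord j))) [set s; t] = 0 :> k.
    move=> n1 n2; rewrite evalZ val_mul; case: eqP => [E | _]; last by rewrite mulr0.
    have iS : i \in [set s; t] by rewrite -E !inE eqxx.
    have jS : j \in [set s; t] by rewrite -E !inE eqxx orbT.
    have sS : s \in [set i] :|: [set j] by rewrite E !inE eqxx.
    have tS : t \in [set i] :|: [set j] by rewrite E !inE eqxx orbT.
    move: iS jS sS tS n1 n2; rewrite !inE.
    case/orP=> /eqP->; case/orP=> /eqP->; rewrite ?eqxx ?orbb //=.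
      by rewrite eq_sym (negPf ne).
    by rewrite (negPf ne).
  have sum_s : \sum_j (Y s j *: (inc (vcoord s) * inc (vcoord j))) [set s; t] = Y s t :> k.
    rewrite (bigD1 t) //= big1 ?addr0 => [|j nej]; last first.
      by apply: val0; rewrite ?eqxx ?(negPf nej) // (negPf ne).
    rewrite evalZ val_mul eqxx /ext_sign disjoints1 !inE ne !big_set1.
    by rewrite ltnNge ltnW // expr0 mulr1.
  have sum_t : \sum_j (Y t j *: (inc (vcoord t) * inc (vcoord j))) [set s; t] = - Y t s :> k.
    rewrite (bigD1 s) //= big1 ?addr0 => [|j nej]; last first.
      by apply: val0; rewrite ?eqxx ?(negPf nej) // eq_sym (negPf ne).
    rewrite evalZ val_mul setUC eqxx /ext_sign disjoints1 !inE eq_sym ne !big_set1.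
    by rewrite st expr1 mulrN1.
  have nts : t != s by rewrite eq_sym.
  move: E0; rewrite (bigD1 s) //= [X in _ + X](bigD1 t) //= [X in _ + (_ + X)]big1 => [|i /andP[nes net]].
    by rewrite addr0 sum_s sum_t => /eqP; rewrite subr_eq0 => /eqP.
  apply: big1 => j _.
  by apply: val0; rewrite ?(negPf nes) ?(negPf net).
apply/matrixP=> s t; rewrite mxE.
case: (ltngtP s t) => [/lt_eq // | /lt_eq // | /val_inj->]; by [].
Qed.

Definition basis_mx e : 'M[k]_n := \matrix_(i < n) vrow e`_i.

Lemma basis_mx_unit e : basis_of fullv e -> basis_mx e \in unitmx.
Proof.
move=> be; have sze := basis_size be.
pose te := Tuple (introT eqP sze); have bte : basis_of fullv te by [].
pose S : 'M[k]_n := \matrix_(t, i) coord te i (vcoord t).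
suff /mulmx1_unit[] : S *m basis_mx e = 1%:M by [].
apply/row_matrixP=> t; rewrite row_mul row1 -vrow_vcoord.
rewrite [in RHS](coord_basis bte (memvf (vcoord t))) linear_sum mulmx_sum_row.
by apply: eq_bigr => i _; rewrite linearZ /= !mxE rowK.
Qed.

Lemma vrow_nth e p : size e = n ->
  vrow e`_p = (\row_(s < n) (p == s)%:R) *m basis_mx e.
Proof.
move=> sze; rewrite mulmx_sum_row.
have [ltp | lep] := ltnP p n; last first.
  rewrite nth_default ?sze // linear0 big1 // => s _.
  by rewrite mxE gtn_eqF ?scale0r // (leq_trans (ltn_ord s)).
rewrite (bigD1 (Ordinal ltp)) //= big1 ?addr0 => [|s nes].
  by rewrite mxE eqxx scale1r rowK.
by rewrite mxE eq_sym -[p]/(val (Ordinal ltp)) (inj_eq val_inj) (negPf nes) scale0r.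
Qed.

Definition form_mx e f : 'M[k]_n := \sum_(p <- f) (vrow e`_p.1)^T *m vrow e`_p.2.

Lemma quad_form_code e f : quad_form (form_mx e f) = code_form e f.
Proof. rewrite linear_sum; apply: eq_bigr => p _; exact: quad_form_mul. Qed.

Lemma form_mx_alt e c i : size e = n ->
  form_mx e (nth [::] c i) - (form_mx e (nth [::] c i))^T =
  (basis_mx e)^T *m code_mx k n c i *m basis_mx e.
Proof.
move=> sze; rewrite /form_mx; set f := nth _ c i.
have -> : code_mx k n c i = \sum_(p <- f)
   ((\row_(s < n) (p.1 == s)%:R)^T *m (\row_(s < n) (p.2 == s)%:R)
    - (\row_(s < n) (p.2 == s)%:R)^T *m (\row_(s < n) (p.1 == s)%:R)).
  apply/matrixP=> s t; rewrite summxE !mxE /code_int rmorph_sum; apply: eq_bigr => p _.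
  by rewrite !mxE !big_ord1 !mxE rmorphB !rmorph_nat -!natrM !mulnb ![(_ == val s) && _]andbC.
rewrite mulmx_sumr mulmx_suml linear_sum -sumrB; apply: eq_bigr => p _.
by rewrite /= trmx_mul trmxK !vrow_nth // mulmxBr mulmxBl !trmx_mul !mulmxA.
Qed.

End CodeForm.

(** * Minimal algebras realizing a code *)

Section Realizations.

Variable k : fieldType.
Implicit Types L M : minimal_algebra k.

(** Beyond the ends of both lists the defaults 0 and [[::]] make both sides 0. *)
Definition realizes L c := exists2 e : seq (gens L), basis_of fullv e
  & forall i, diff L (ext_inc _ e`_i) = code_form e (nth [::] c i).

(** P is the transition matrix of the two bases. The two coefficient matrices of d of a new
    generator differ by a symmetric matrix, so their antisymmetrizations agree, and the invertible
    matrix R cancels. *)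
Lemma realizes_congruent L c c' : realizes L c -> realizes L c' ->
  congruent k (\dim {:gens L}) c c'.
Proof.
move=> [e be eE] [e' be' e'E].
have sze : size e = \dim {:gens L} by exact: basis_size be.
have sze' : size e' = \dim {:gens L} by exact: basis_size be'.
have uR := basis_mx_unit be; have uR' := basis_mx_unit be'.
set R := basis_mx e in uR *; set R' := basis_mx e' in uR' *.
exists (R' *m invmx R) => [|i]; first by rewrite unitmx_mul uR' unitmx_inv.
set P := R' *m invmx R; have PR : P *m R = R' by rewrite mulmxKV.
have e'P : e'`_i = \sum_j P i j *: e`_j.
  have vrow_inj (x y : gens L) : vrow x = vrow y -> x = y.
    by move=> xy; rewrite [x]vrow_sum [y]vrow_sum xy.
  apply: vrow_inj; rewrite linear_sum.
  have -> : vrow e'`_i = row i R' by rewrite rowK.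
  rewrite -PR row_mul mulmx_sum_row; apply: eq_bigr => j _.
  by rewrite linearZ /= rowK !mxE.
have qs : quad_form (\sum_j P i j *: form_mx e (nth [::] c j)) = diff L (ext_inc _ e'`_i).
  rewrite [LHS]linear_sum e'P !linear_sum; apply: eq_bigr => j _.
  by rewrite !linearZ /= eE -quad_form_code.
have form0 : quad_form (form_mx e' (nth [::] c' i) - \sum_j P i j *: form_mx e (nth [::] c j)) = 0.
  by rewrite [LHS]linearB /= qs quad_form_code e'E subrr.
have alt := quad_form_eq0 form0.
set F' := form_mx e' _ in alt *; set F := \sum_j _ in alt *.
have FF : F' - F'^T = F - F^T.
  by rewrite -[F'](subrK F) {1}alt linearB /=; apply/matrixP=> s t; rewrite !mxE; ring.
have FE : F - F^T = R^T *m (\sum_j P i j *: code_mx k _ c j) *m R.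
  rewrite /F [_^T]linear_sum -sumrB mulmx_sumr mulmx_suml; apply: eq_bigr => j _.
  by rewrite linearZ /= -scalerBr form_mx_alt // -scalemxAr -scalemxAl.
move: FF; rewrite FE form_mx_alt // -/R' -PR trmx_mul => FF.
have uRT : R^T \in unitmx by rewrite unitmx_tr.
apply: (can_inj (mulmxK uR)); apply: (can_inj (mulKmx uRT)).
by rewrite !mulmxA in FF *.
Qed.

End Realizations.

(** Applied to the kernel of the difference of two linear maps, this reduces an identity between
    them to products of generators. *)
Lemma exterior_ind (k : fieldType) (V : vectType k) (U : {vspace exterior V}) :
    (forall s : seq V, \prod_(x <- s) ext_inc V x \in U) -> forall u, u \in U.
Proof.
move=> prodU u; rewrite [u]ext_decomp; apply: memv_suml => S _; apply: memvZ.
by rewrite ext_eltE -(big_map (@vcoord k V) xpredT (ext_inc V)).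
Qed.

Lemma ext_inc_pow (k : fieldType) (V : vectType k) (x : V) : ext_inc V x \in ext_pow {:V} 1.
Proof. by rewrite /ext_pow expv1 memv_img ?memvf. Qed.

Lemma prod_inc_pow (k : fieldType) (V : vectType k) (s : seq V) :
  \prod_(x <- s) ext_inc V x \in ext_pow {:V} (size s).
Proof.
elim: s => [|x s IHs]; first by rewrite big_nil /ext_pow expv0 memv_line.
rewrite big_cons /ext_pow expvSl memv_mul ?memv_img ?memvf //.
Qed.

(** * Isomorphic algebras and common codes *)

Section Isomorphisms.

Variable k : fieldType.
Implicit Types L M : minimal_algebra k.

Lemma diff_inc_mul L x s : let u := \prod_(y <- s) ext_inc (gens L) y in
  diff L (ext_inc _ x * u) = diff L (ext_inc _ x) * u - ext_inc _ x * diff L u.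
Proof.
by rewrite /= (diff_leibniz (ext_inc_pow x) (prod_inc_pow s)) expr1 mulN1r mulNr.
Qed.

Lemma diff1 L : diff L 1 = 0.
Proof.
have one0 : (1 : exterior (gens L)) \in ext_pow {:gens L} 0 by rewrite /ext_pow expv0 memv_line.
have := diff_leibniz one0 one0; rewrite expr0 !mulr1 !mul1r => /eqP.
by rewrite -subr_eq0 opprD addrA subrr sub0r oppr_eq0 => /eqP.
Qed.

Lemma ext_map_code_form (V V' : vectType k) (f : 'Hom(V, V')) e c :
  ext_map f (code_form e c) = code_form (map f e) c.
Proof.
rewrite rmorph_sum; apply: eq_bigr => p _; rewrite rmorphM /= !ext_map_inc.
have nthf i : f e`_i = (map f e)`_i.
  have [lti | lei] := ltnP i (size e); first by rewrite (nth_map 0).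
  by rewrite !nth_default ?size_map ?linear0.
by rewrite !nthf.
Qed.

Lemma realizes_iso L M c : isomorphic L M -> realizes L c -> realizes M c.
Proof.
case=> f bij_f fd [e be eE]; exists (map f e).
  have <- : (f @: fullv)%VS = fullv.
    apply/eqP; rewrite eqEsubv subvf; apply/subvP=> y _; have [g fK gK] := bij_f.
    by rewrite -[y]gK memv_img ?memvf.
  apply: limg_basis_of be; have /lker0P/eqP-> := bij_inj bij_f.
  by rewrite capv0.
move=> i; have <- : f e`_i = (map f e)`_i.
  have [lti | lei] := ltnP i (size e); first by rewrite (nth_map 0).
  by rewrite !nth_default ?size_map ?linear0.
by rewrite -ext_map_inc -fd eE ext_map_code_form.
Qed.

(** The map matching the two bases commutes with d on generators, where both sides are the same code
    form, and on products by the Leibniz rule and induction on their length. *)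
Lemma iso_realizes L M c : realizes L c -> realizes M c ->
  \dim {:gens L} = \dim {:gens M} -> isomorphic L M.
Proof.
move=> [e be eE] [e' be' e'E] dimE.
have sze : size e' = size e by rewrite (basis_size be) (basis_size be').
have [f /(_ (basis_free be) sze) fe] := linear_of_free e e'.
have [g /(_ (basis_free be') (esym sze)) ge] := linear_of_free e' e.
have fnth i : f e`_i = e'`_i.
  rewrite -fe; have [lti | lei] := ltnP i (size e); first by rewrite (nth_map 0).
  by rewrite !nth_default ?size_map ?linear0.
have gnth i : g e'`_i = e`_i.
  rewrite -ge; have [lti | lei] := ltnP i (size e'); first by rewrite (nth_map 0).
  by rewrite !nth_default ?size_map ?linear0.
have bE x : x = \sum_i coord (in_tuple e) i x *: e`_i.
  by rewrite {1}[x](coord_basis (X := in_tuple e) be (memvf x)).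
have bE' x : x = \sum_i coord (in_tuple e') i x *: e'`_i.
  by rewrite {1}[x](coord_basis (X := in_tuple e') be' (memvf x)).
exists (linfun f).
  exists (linfun g) => x; rewrite !lfunE /=.
    rewrite [x]bE !linear_sum; apply: eq_bigr => i _.
    by rewrite !linearZ /= fnth gnth.
  rewrite [x]bE' !linear_sum; apply: eq_bigr => i _.
  by rewrite !linearZ /= gnth fnth.
pose F : 'Hom(exterior (gens L), exterior (gens M)) := linfun (ext_map (linfun f)).
have FE u : F u = ext_map (linfun f) u by rewrite lfunE.
have gen x : ext_map (linfun f) (diff L (ext_inc _ x)) = diff M (ext_inc _ (f x)).
  rewrite [x]bE !linear_sum; apply: eq_bigr => i _.
  rewrite !linearZ /= eE ext_map_code_form fnth e'E; congr (_ *: code_form _ _).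
  by rewrite -fe; apply: eq_map => y; rewrite lfunE.
move=> u; apply/eqP; rewrite -subr_eq0 -!FE -!comp_lfunE -opp_lfunE -add_lfunE -memv_ker.
apply: exterior_ind u => s; rewrite memv_ker add_lfunE opp_lfunE !comp_lfunE !FE subr_eq0.
elim: s => [|x s /eqP IHs]; first by rewrite big_nil diff1 linear0 rmorph1 diff1.
rewrite big_cons diff_inc_mul linearB !rmorphM /= gen IHs.
have fprod t : ext_map (linfun f) (\prod_(y <- t) ext_inc _ y) = \prod_(y <- map f t) ext_inc _ y.
  by rewrite rmorph_prod big_map; apply: eq_bigr => y _; rewrite /= ext_map_inc [linfun f _]lfunE.
by rewrite fprod ext_map_inc [linfun f _]lfunE diff_inc_mul.
Qed.

End Isomorphisms.

(** * The algebra defined by a code *)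

(* The triple ((a, b), c) stands for the matrix [[a, b], [0, c]]. *)
Definition triangular (k : fieldType) (R : algType k) : Type := (R * R * R)%type.

HB.instance Definition _ (k : fieldType) (R : algType k) :=
  GRing.Lmodule.copy (triangular R) (R * R * R)%type.

Section Triangular.

Variables (k : fieldType) (R : algType k).
Implicit Types A B C : triangular R.

Definition tri_one : triangular R := (1, 0, 1).
Definition tri_mul A B : triangular R :=
  (A.1.1 * B.1.1, A.1.1 * B.1.2 + A.1.2 * B.2, A.2 * B.2).

Lemma tri_ext A B : A.1.1 = B.1.1 -> A.1.2 = B.1.2 -> A.2 = B.2 -> A = B.
Proof. by case: A => [[a b] c]; case: B => [[a' b'] c'] /= -> -> ->. Qed.

Fact tri_mulA : associative tri_mul.
Proof.
move=> A B C; apply: tri_ext; rewrite /= ?mulrA //.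
by rewrite mulrDr mulrDl !mulrA addrA.
Qed.

Fact tri_mul1 : left_id tri_one tri_mul.
Proof. by move=> A; apply: tri_ext; rewrite /= ?mul1r // mul0r addr0. Qed.

Fact tri_1mul : right_id tri_one tri_mul.
Proof. by move=> A; apply: tri_ext; rewrite /= ?mulr1 // mulr0 add0r. Qed.

Fact tri_mulDl : left_distributive tri_mul +%R.
Proof.
move=> A B C; apply: tri_ext; [exact: mulrDl | | exact: mulrDl].
change ((A.1.1 + B.1.1) * C.1.2 + (A.1.2 + B.1.2) * C.2 =
        A.1.1 * C.1.2 + A.1.2 * C.2 + (B.1.1 * C.1.2 + B.1.2 * C.2)).
by rewrite !mulrDl addrACA.
Qed.

Fact tri_mulDr : right_distributive tri_mul +%R.
Proof.
move=> A B C; apply: tri_ext; [exact: mulrDr | | exact: mulrDr].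
change (A.1.1 * (B.1.2 + C.1.2) + A.1.2 * (B.2 + C.2) =
        A.1.1 * B.1.2 + A.1.2 * B.2 + (A.1.1 * C.1.2 + A.1.2 * C.2)).
by rewrite !mulrDr addrACA.
Qed.

Fact tri_one_neq0 : tri_one != 0.
Proof. by apply/eqP=> -[] /eqP; rewrite oner_eq0. Qed.

HB.instance Definition _ := GRing.Zmodule_isNzRing.Build (triangular R)
  tri_mulA tri_mul1 tri_1mul tri_mulDl tri_mulDr tri_one_neq0.

Fact tri_scaleAl (a : k) A B : a *: (A * B) = (a *: A : triangular R) * B.
Proof.
apply: tri_ext; [exact: scalerAl | | exact: scalerAl].
change (a *: (A.1.1 * B.1.2 + A.1.2 * B.2) = (a *: A.1.1) * B.1.2 + (a *: A.1.2) * B.2).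
by rewrite scalerDr !scalerAl.
Qed.
HB.instance Definition _ := GRing.Lmodule_isLalgebra.Build k (triangular R) tri_scaleAl.

Fact tri_scaleAr (a : k) A B : a *: (A * B) = A * (a *: B : triangular R).
Proof.
apply: tri_ext; [exact: scalerAr | | exact: scalerAr].
change (a *: (A.1.1 * B.1.2 + A.1.2 * B.2) = A.1.1 * (a *: B.1.2) + A.1.2 * (a *: B.2)).
by rewrite scalerDr !scalerAr.
Qed.
HB.instance Definition _ := GRing.Lalgebra_isAlgebra.Build k (triangular R) tri_scaleAr.

End Triangular.

Section Derivation.

Variables (k : fieldType) (V : vectType k) (delta : {linear V -> exterior V}).
Hypothesis delta2 : forall x, delta x \in ext_pow {:V} 2.
Local Notation E := (exterior V).
Local Notation inc := (ext_inc V).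
Implicit Types u v : E.

Lemma inc_anticomm x y : inc x * inc y = - (inc y * inc x).
Proof.
apply/eqP; rewrite -addr_eq0; apply/eqP.
by have := ext_inc_sq (x + y); rewrite linearD mulrDl !mulrDr !ext_inc_sq add0r addr0.
Qed.

(** Passing x across two generators costs two signs. This is what makes [tri_gen x] square to 0. *)
Lemma inc_comm2 x u : u \in ext_pow {:V} 2 -> u * inc x = inc x * u.
Proof.
suff: (ext_pow {:V} 2 <= 'C[inc x])%VS by move/subvP=> sC /sC/cent1vP.
rewrite /ext_pow expv2; apply/prodvP=> _ _ /memv_imgP[y _ ->] /memv_imgP[z _ ->].
by apply/cent1vP; rewrite mulrA (inc_anticomm x y) mulNr -!mulrA (inc_anticomm x z) mulrN opprK.
Qed.

(* d is a derivation exactly when u |-> [[(-1)^|u| u, d u], [0, u]] is multiplicative, so the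
   universal property of the exterior algebra, applied to triangular matrices, extends delta. *)
Definition tri_gen x : triangular E := (- inc x, delta x, inc x).

Fact tri_gen_linear : linear tri_gen.
Proof.
move=> a x y; rewrite /tri_gen; congr (_, _, _); rewrite /= ?linearP //.
Qed.
HB.instance Definition _ := GRing.isLinear.Build k V (triangular E) *:%R tri_gen tri_gen_linear.

Fact tri_gen_sq x : tri_gen x * tri_gen x = 0.
Proof.
rewrite -[_ * _]/(tri_mul _ _) /tri_mul /= ext_inc_sq mulrNN ext_inc_sq.
by rewrite inc_comm2 // mulNr addNr.
Qed.

Local Notation h := (ext_lift tri_gen).
Let hM : monoid_morphism h := ext_lift_monoid_morphism tri_gen_sq.

Definition grading u : E := (h u).1.1.
Definition derivation u : E := (h u).1.2.

Fact grading_linear : linear grading.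
Proof. by move=> a u v; rewrite /grading linearP. Qed.
HB.instance Definition _ := GRing.isLinear.Build k E E *:%R grading grading_linear.
Fact derivation_linear : linear derivation.
Proof. by move=> a u v; rewrite /derivation linearP. Qed.
HB.instance Definition _ := GRing.isLinear.Build k E E *:%R derivation derivation_linear.

(** The lower diagonal entry of the lift is an algebra map that fixes the generators. *)
Lemma ext_lift_diag u : (h u).2 = u.
Proof.
have f_lin : linear (fun u => (h u).2 : E) by move=> a v w; rewrite linearP.
pose F : {linear E -> E} := HB.pack (fun u => (h u).2 : E)
  (GRing.isLinear.Build k E E *:%R (fun u => (h u).2 : E) f_lin).
have FE v : linfun F v = (h v).2 by rewrite lfunE.
apply/eqP; rewrite -subr_eq0 -FE -[u in _ - u]id_lfunE -opp_lfunE -add_lfunE -memv_ker.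
apply: exterior_ind u => s; rewrite memv_ker add_lfunE opp_lfunE id_lfunE FE subr_eq0; apply/eqP.
elim: s => [|x s IHs]; first by rewrite big_nil hM.1.
by rewrite big_cons hM.2 /= ext_lift_inc IHs.
Qed.

Lemma gradingM u v : grading (u * v) = grading u * grading v.
Proof. by rewrite /grading hM.2. Qed.

Lemma derivationM u v : derivation (u * v) = grading u * derivation v + derivation u * v.
Proof. by rewrite /derivation hM.2 /= ext_lift_diag. Qed.

Lemma derivation_inc x : derivation (inc x) = delta x.
Proof. by rewrite /derivation ext_lift_inc. Qed.

Lemma derivation1 : derivation 1 = 0.
Proof. by rewrite /derivation hM.1. Qed.

Lemma grading_pow p u : u \in ext_pow {:V} p -> grading u = (-1) ^+ p * u.
Proof.
have kE q w : (w \in lker (linfun grading - (-1) ^+ q *: \1%VF)%R) = (grading w == (-1) ^+ q *: w).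
  by rewrite memv_ker add_lfunE opp_lfunE scale_lfunE id_lfunE lfunE subr_eq0.
suff: (ext_pow {:V} p <= lker (linfun grading - (-1) ^+ p *: \1%VF)%R)%VS.
  move/subvP=> sp /sp; rewrite kE => /eqP->.
  by rewrite -[in LHS]signr_odd -[in RHS]signr_odd scaler_sign mulr_sign.
elim: p {u} => [|p IHp].
  by rewrite /ext_pow expv0 -memvE kE scale1r /grading hM.1.
rewrite /ext_pow expvSl; apply/prodvP=> _ v /memv_imgP[x _ ->] /(subvP IHp).
rewrite !kE => /eqP gv; rewrite gradingM gv /grading ext_lift_inc /= mulNr -scalerAr.
by rewrite exprS mulN1r scaleNr.
Qed.

Lemma derivation_leibniz p u v : u \in ext_pow {:V} p ->
  derivation (u * v) = derivation u * v + (-1) ^+ p * u * derivation v.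
Proof. by move=> up; rewrite derivationM (grading_pow up) addrC. Qed.

Lemma derivation_degree p u : u \in ext_pow {:V} p -> derivation u \in ext_pow {:V} p.+1.
Proof.
have dE w : linfun derivation w = derivation w by rewrite lfunE.
suff: (ext_pow {:V} p <= linfun derivation @^-1: ext_pow {:V} p.+1)%VS.
  by move/subvP=> sp /sp; rewrite -memv_preim dE.
elim: p {u} => [|p IHp].
  by rewrite /ext_pow expv0 -memvE -memv_preim dE derivation1 mem0v.
rewrite {1}/ext_pow expvSl; apply/prodvP=> _ v /memv_imgP[x _ ->] vp.
move/(subvP IHp): (vp); rewrite -!memv_preim !dE derivationM derivation_inc => dv.
apply: memvD.
  rewrite (grading_pow (ext_inc_pow x)) expr1 mulN1r mulNr memvN.
  by rewrite /ext_pow expvSl memv_mul ?memv_img ?memvf.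
by rewrite /ext_pow -[p.+2]add2n expvD memv_mul.
Qed.

(** By induction over products x u: in d(d(x u)) the two terms (dx)(du) cancel, because dx has even
    degree. *)
Lemma derivation_sq0 : (forall x, derivation (delta x) = 0) ->
  forall u, derivation (derivation u) = 0.
Proof.
move=> d0 u; have dE w : linfun derivation w = derivation w by rewrite lfunE.
apply/eqP; rewrite -!dE -comp_lfunE -memv_ker; apply: exterior_ind u => s.
rewrite memv_ker comp_lfunE !dE; apply/eqP.
elim: s => [|x s IHs]; first by rewrite big_nil derivation1 linear0.
rewrite big_cons (derivation_leibniz _ (ext_inc_pow x)) derivation_inc linearD /=.
rewrite (derivation_leibniz _ (delta2 x)) d0 mul0r add0r sqrrN expr1n mul1r.
rewrite expr1 mulN1r mulNr linearN /= (derivation_leibniz _ (ext_inc_pow x)) IHs mulr0 addr0.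
by rewrite derivation_inc subrr.
Qed.

End Derivation.

Section FromCode.

Variables (k : fieldType) (V : vectType k).
Implicit Types e : seq V.

(** The inequalities make the given order of the basis witness minimality; requiring the empty form
    for the generators that occur gives d^2 = 0 and W_1 = V. *)
Definition admissible (c : seq (seq (nat * nat))) :=
  all (fun i => all (fun p => [&& p.1 < i, p.2 < i, nth [::] c p.1 == [::] & nth [::] c p.2 == [::]])%N
    (nth [::] c i)) (iota 0 (size c)).

Lemma admissibleP c i p : admissible c -> p \in nth [::] c i ->
  [/\ (p.1 < i)%N, (p.2 < i)%N, nth [::] c p.1 = [::] & nth [::] c p.2 = [::]].
Proof.
move=> adm; have [lti | lei] := ltnP i (size c); last by rewrite nth_default.
move: adm => /allP/(_ i); rewrite mem_iota => /(_ lti)/allP pc /pc.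
by case/and4P=> ? ? /eqP ? /eqP ?.
Qed.

Lemma realizable e c : basis_of fullv e -> size c = size e -> admissible c ->
  exists2 L : minimal_algebra k, \dim {:gens L} = size e & realizes L c.
Proof.
move=> be szc adm; have sze := basis_size be.
have [delta /(_ (basis_free be)) deltaE] :=
  linear_of_free e [seq code_form e f | f <- c].
have {}deltaE i : delta e`_i = code_form e (nth [::] c i).
  have [lti | lei] := ltnP i (size e); last first.
    by rewrite !nth_default ?szc // linear0 /code_form big_nil.
  rewrite -(nth_map 0 0) // deltaE ?size_map //.
  by rewrite (nth_map [::]) ?szc.
have bE x : x = \sum_i coord (in_tuple e) i x *: e`_i.
  by rewrite {1}[x](coord_basis (X := in_tuple e) be (memvf x)).
have delta2 x : delta x \in ext_pow {:V} 2.
  rewrite [x]bE linear_sum; apply: memv_suml => i _; rewrite linearZ /= memvZ // deltaE.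
  apply: memv_suml => p _; rewrite /ext_pow expv2 memv_mul ?memv_img ?memvf //.
have d0 x : derivation delta (delta x) = 0.
  rewrite [x]bE !linear_sum big1 // => i _; rewrite !linearZ /= deltaE linear_sum.
  rewrite big_seq big1 ?scaler0 // => p /(admissibleP adm)[_ _ c1 c2] /=.
  rewrite (derivation_leibniz delta2 _ (ext_inc_pow _)) !derivation_inc // !deltaE c1 c2.
  by rewrite /code_form big_nil mul0r mulr0 addr0.
pose D : 'End(exterior V) := linfun (derivation delta).
have DE u : D u = derivation delta u by rewrite lfunE.
have D1 p u : u \in ext_pow {:V} p -> D u \in ext_pow {:V} p.+1.
  by rewrite DE; apply: derivation_degree.
have D2 u : D (D u) = 0 by rewrite !DE; apply: derivation_sq0.
have D3 p q u v : u \in ext_pow {:V} p -> v \in ext_pow {:V} q ->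
    D (u * v) = D u * v + (-1) ^+ p * u * D v.
  by move=> up _; rewrite !DE; apply: derivation_leibniz.
have D4 : exists2 X : (\dim {:V}).-tuple V, basis_of {:V} X &
    forall i : 'I_(\dim {:V}), D (ext_inc V X`_i) \in ext_pow <<take i X>> 2.
  exists (Tuple (introT eqP sze)) => // i /=; rewrite DE derivation_inc // deltaE.
  rewrite /code_form big_seq; apply: memv_suml => p /(admissibleP adm)[p1 p2 _ _].
  have tk j : (j < i)%N -> ext_inc V e`_j \in (ext_inc V @: <<take i e>>)%VS.
    move=> ltj; rewrite memv_img // memv_span // -(nth_take _ ltj) mem_nth // size_take.
    by case: ifP => // _; rewrite sze (ltn_trans ltj).
  by rewrite /ext_pow expv2 memv_mul ?tk.
exists (MinimalAlgebra D1 D2 D3 D4) => //=.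
exists e => // i /=; by rewrite DE derivation_inc // deltaE.
Qed.

End FromCode.

Lemma realizes_filtration (k : fieldType) (L : minimal_algebra k) c :
  admissible c -> realizes L c -> char_filtration L 1 = fullv.
Proof.
move=> adm [e be eE]; apply/eqP; rewrite eqEsubv subvf /= -(span_basis be).
apply/span_subvP=> x /(nthP 0)[i lti <-].
rewrite -memv_preim comp_lfunE eE /code_form big_seq; apply: memv_suml.
move=> p /(admissibleP adm)[_ _ c1 c2]; rewrite /ext_pow expv2.
by apply: memv_mul; apply: memv_img; rewrite memv_ker comp_lfunE eE ?c1 ?c2 /code_form big_nil.
Qed.

Lemma codesP m c : c \in codes m ->
  [/\ (m + size c = 8)%N, nseq m [::] ++ c \in table
    & {in c, forall f, {in f, forall p, (p.1 < m)%N && (p.2 < m)%N}}].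
Proof.
have codes_ok : all (fun m => all (fun c => [&& m + size c == 8, nseq m [::] ++ c \in table
      & all (all (fun p => (p.1 < m) && (p.2 < m))) c]) (codes m))%N (iota 0 9) by vm_compute.
move=> cm; have lem : m \in iota 0 9.
  rewrite mem_iota /= add0n ltnS leqNgt; apply: contraTN cm => lt8.
  by case: m lt8 => [|[|[|[|[|[|[|[|[|m]]]]]]]]].
have /allP/(_ m lem)/allP/(_ c cm)/and3P[/eqP szc tc /allP pc] := codes_ok.
by split=> // f /pc/allP.
Qed.

(** * Every algebra of dimension 8 with W_1 = V realizes a code *)

Section Structure.

Variables (k : closedFieldType).
Hypothesis char_neq2 : 2%N \notin [pchar k].
Variable L : minimal_algebra k.
Hypothesis full1 : char_filtration L 1 = fullv.

Local Notation V := (gens L).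
Local Notation inc := (ext_inc V).
Local Notation W0 := (char_filtration L 0).
Local Notation m := (\dim W0).
Local Notation b := (vbasis W0).
Local Notation d := (diff_gens L).

Let of_row (u : 'rV[k]_m) : V := \sum_i u 0 i *: b`_i.

Fact of_row_linear : linear of_row.
Proof.
move=> a u v; rewrite /of_row scaler_sumr -big_split; apply: eq_bigr => i _.
by rewrite !mxE scalerDl scalerA.
Qed.
HB.instance Definition _ := GRing.isLinear.Build k 'rV[k]_m V *:%R of_row of_row_linear.

Lemma of_row_mem u : of_row u \in W0.
Proof. by apply: memv_suml => i _; rewrite memvZ // vbasis_mem // mem_nth ?size_tuple. Qed.

Lemma of_row_onto x : x \in W0 -> exists u, x = of_row u.
Proof.
move=> /coord_vbasis xE; exists (\row_i coord b i x).
by rewrite {1}xE; apply: eq_bigr => i _; rewrite mxE.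
Qed.

(** The factor 1/2 makes the matrix [wedge u v] correspond to the product of the vectors of W_0 with
    coordinates [u] and [v]. *)
Definition square (A : 'M[k]_m) : exterior V :=
  2%:R^-1 *: \sum_i \sum_j A i j *: (inc b`_i * inc b`_j).

Fact square_linear : linear square.
Proof.
move=> a A B; rewrite /square scalerA mulrC -scalerA -scalerDr; congr (_ *: _).
rewrite scaler_sumr -big_split; apply: eq_bigr => i _ /=.
rewrite scaler_sumr -big_split; apply: eq_bigr => j _ /=.
by rewrite !mxE scalerDl scalerA.
Qed.
HB.instance Definition _ := GRing.isLinear.Build k 'M[k]_m (exterior V) *:%R square square_linear.

Lemma two_square A : 2%:R *: square A = \sum_i \sum_j A i j *: (inc b`_i * inc b`_j).
Proof. exact: (scalerKV (two_neq0 char_neq2)). Qed.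

Lemma square_wedge u v : square (wedge u v) = inc (of_row u) * inc (of_row v).
Proof.
have outer (x y : 'rV[k]_m) : \sum_i \sum_j (x 0 i * y 0 j) *: (inc b`_i * inc b`_j) =
    inc (of_row x) * inc (of_row y).
  rewrite /of_row !linear_sum mulr_suml; apply: eq_bigr => i _.
  rewrite mulr_sumr; apply: eq_bigr => j _.
  by rewrite !linearZ /= -scalerAl -scalerAr scalerA.
apply: (scalerI (two_neq0 char_neq2)); rewrite two_square.
have -> : \sum_i \sum_j wedge u v i j *: (inc b`_i * inc b`_j) =
    inc (of_row u) * inc (of_row v) - inc (of_row v) * inc (of_row u).
  rewrite -!outer -sumrB; apply: eq_bigr => i _; rewrite -sumrB; apply: eq_bigr => j _.
  by rewrite mxE scalerBl [u 0 j * _]mulrC.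
rewrite [X in _ - X]inc_anticomm opprK -mulr2n.
by rewrite scaler_nat.
Qed.

(** In the coordinates of V, twice the element has coefficient matrix B^T A B, which is therefore
    both symmetric and antisymmetric, hence 0; the right inverse [B'] of [B] recovers A. *)
Lemma square_inj A : A^T = - A -> square A = 0 -> A = 0.
Proof.
move=> altA A0; pose B := \matrix_(i < m) vrow b`_i.
pose B' : 'M[k]_(\dim {:V}, m) := \matrix_(t, i) coord b i (vcoord t).
have BB' : B *m B' = 1%:M.
  apply/matrixP=> i j; rewrite !mxE.
  have <- : coord b j b`_i = (i == j)%:R.
    by rewrite coord_free ?(basis_free (vbasisP _)).
  rewrite [in RHS](vrow_sum b`_i) linear_sum; apply: eq_bigr => t _.
  by rewrite linearZ /= !mxE.
have qA : quad_form (B^T *m A *m B) = 0.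
  transitivity (2%:R *: square A); last by rewrite A0 scaler0.
  rewrite two_square.
  have -> : B^T *m A *m B = \sum_i \sum_j A i j *: ((vrow b`_i)^T *m vrow b`_j).
    apply/matrixP=> s t; rewrite summxE !mxE.
    under eq_bigr => j _ do rewrite !mxE mulr_suml.
    rewrite exchange_big; apply: eq_bigr => i _; rewrite summxE; apply: eq_bigr => j _.
    by rewrite !mxE big_ord1 !mxE; ring.
  rewrite linear_sum; apply: eq_bigr => i _; rewrite linear_sum; apply: eq_bigr => j _.
  by rewrite linearZ /= quad_form_mul.
have := quad_form_eq0 qA; rewrite !trmx_mul trmxK altA mulNmx mulmxN mulmxA => Y2.
have Y0 : B^T *m A *m B = 0.
  apply: (scalerI (two_neq0 char_neq2)); rewrite scaler0 scaler_nat mulr2n {1}Y2.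
  by rewrite addNr.
have : B'^T *m (B^T *m A *m B) *m B' = 0 by rewrite Y0 mulmx0 mul0mx.
by rewrite !mulmxA -trmx_mul -mulmxA BB' mulmx1 trmx1 mul1mx.
Qed.

Fact alt_linear : linear (fun A : 'M[k]_m => A^T + A).
Proof. by move=> a A B; rewrite linearP /= scalerDr addrACA. Qed.
Let altL : {linear 'M[k]_m -> 'M[k]_m} := HB.pack (fun A : 'M[k]_m => A^T + A)
  (GRing.isLinear.Build k 'M[k]_m 'M[k]_m *:%R (fun A : 'M[k]_m => A^T + A) alt_linear).

(** The subspace d(V) read as a space of alternating matrices, to which [alternating_classified] is
    applied. *)
Definition squares : {vspace 'M[k]_m} :=
  (lker (linfun altL) :&: linfun square @^-1: limg d)%VS.

Lemma squaresP A : reflect (A^T = - A /\ square A \in limg d) (A \in squares).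
Proof.
rewrite memv_cap memv_ker -memv_preim !lfunE /= addr_eq0.
by apply: (iffP andP) => -[/eqP-> ->].
Qed.

(** W_1 = V says that d(V) lies in the exterior square of W_0, every element of which comes from an
    alternating matrix. *)
Lemma square_squares : (linfun square @: squares)%VS = limg d.
Proof.
apply/eqP; rewrite eqEsubv; apply/andP; split.
  by apply/subvP=> _ /memv_imgP[A /squaresP[_ As] ->]; rewrite lfunE.
have sW2 : (ext_pow W0 2 <= linfun square @: lker (linfun altL))%VS.
  rewrite /ext_pow expv2; apply/prodvP=> _ _ /memv_imgP[x xW ->] /memv_imgP[y yW ->].
  have [u ->] := of_row_onto xW; have [v ->] := of_row_onto yW.
  rewrite -square_wedge; apply/memv_imgP; exists (wedge u v); last by rewrite lfunE.
  rewrite memv_ker lfunE /=; apply/eqP/matrixP=> s t; rewrite !mxE; ring.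
apply/subvP=> _ /memv_imgP[x _ ->].
have : x \in char_filtration L 1 by rewrite full1 memvf.
rewrite -memv_preim => /(subvP sW2)/memv_imgP[A altA dA].
rewrite dA memv_img // memv_cap altA -memv_preim -dA memv_img ?memvf //.
Qed.

Lemma dim_squares : (m + \dim squares = \dim {:V})%N.
Proof.
have <- := limg_ker_dim d fullv; rewrite capfv -square_squares limg_dim_eq //.
apply/eqP; rewrite -subv0; apply/subvP=> A; rewrite memv_cap => /andP[/squaresP[altA _]].
by rewrite memv_ker lfunE memv0 => /eqP A0; apply/eqP; apply: square_inj.
Qed.

Lemma structure_code : \dim {:V} = 8%N -> exists2 c, c \in table & realizes L c.
Proof.
move=> dimV; have [||c cm [g [szg fullg Ug]]] := alternating_classified (U := squares) char_neq2.
- by move=> A /squaresP[].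
- by rewrite dim_squares.
have [szc tc pc] := codesP cm.
have dimU : \dim squares = size c by apply/eqP; rewrite -(eqn_add2l m) dim_squares dimV szc.
have UE : squares = <<map (wform g) c>>%VS by apply: span_eqU; rewrite ?size_map.
(* A preimage under d of each form of the code; these complete a basis of ker d to a basis of V, in
   the order used by [table]. *)
pose x f := ((d^-1)%VF (square (wform g f))).
have dx f : f \in c -> d (x f) = square (wform g f).
  move=> fc; apply: limg_lfunVK.
  have /squaresP[_] : wform g f \in squares by rewrite UE memv_span // map_f.
  by [].
pose e := map of_row g ++ map x c.
have sze : size e = \dim {:V} by rewrite size_cat !size_map szg szc dimV.
have nth_of_row i : (i < m)%N -> e`_i = of_row g`_i.
  by move=> lti; rewrite nth_cat size_map szg lti (nth_map 0) ?szg.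
have d_of_row u : d (of_row u) = 0 by apply/eqP; rewrite -memv_ker of_row_mem.
have be : basis_of fullv e.
  rewrite basisEdim sze leqnn andbT; apply/subvP=> y _.
  have : d y \in limg d by rewrite memv_img ?memvf.
  rewrite -square_squares => /memv_imgP[A]; rewrite UE => /spanP[cs szcs ->].
  rewrite [linfun square _]lfunE /= => dy.
  have dlc : d (lc cs (map x c)) = square (lc cs (map (wform g) c)).
    elim: (c) cs dx {dy szcs} => [|f c' IHc] [|a cs] dx /=; rewrite ?linear0 //.
    rewrite !linearD !linearZ /= dx ?mem_head // IHc // => f' f'c.
    by rewrite dx // inE f'c orbT.
  have /of_row_onto[u yE] : y - lc cs (map x c) \in W0.
    by rewrite memv_ker linearB /= dlc -dy subrr.
  rewrite -[y](subrK (lc cs (map x c))) yE span_cat addrC memvD //.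
    by apply: subvP (addvSr _ _) _ _; rewrite lc_span.
  apply: subvP (addvSl _ _) _ _.
  have /spanP[cs' _ ->] := subvP fullg u (memvf u).
  elim: (g) cs' => [|v g' IHg] [|a cs'] /=; rewrite ?linear0 ?mem0v //.
  by rewrite linearD linearZ /= span_cons memv_add ?memvZ ?memv_line.
exists (nseq m [::] ++ c) => //; exists e => // i.
rewrite -[diff L _](comp_lfunE _ _ e`_i) -/d.
have [lti | lei] := ltnP i m.
  rewrite nth_of_row // [d _]d_of_row nth_cat size_nseq lti nth_nseq lti /code_form big_nil.
  by [].
rewrite [nth [::] _ i]nth_cat size_nseq ltnNge lei /= nth_cat size_map szg ltnNge lei /=.
have [ltc | lec] := ltnP (i - m) (size c); last first.
  by rewrite !nth_default ?size_map // linear0 /code_form big_nil.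
rewrite (nth_map [::]) // [d _]dx ?mem_nth //.
have : {in nth [::] c (i - m), forall p, (p.1 < m)%N && (p.2 < m)%N} by apply: pc; rewrite mem_nth.
elim: (nth _ c _) => [|p f IHf] pf; first by rewrite /code_form big_nil [LHS]linear0.
rewrite /code_form big_cons -/(code_form e f) -IHf => [|p' p'f]; last by rewrite pf // inE p'f orbT.
have /andP[p1 p2] := pf p (mem_head _ _).
by rewrite [LHS]linearD /= square_wedge !nth_of_row.
Qed.

End Structure.

(** * The 1 + 3 + 11 + 17 + 3 codes, for m = 8, 7, 6, 5, 4, and their separation *)

Lemma size_table : size table = 35%N.
Proof. by vm_compute. Qed.

Lemma table_invariant : all (fun c => [&& size c == 8, admissible c & all isSome (derivation_ranks c)])%N table
  && uniq (map derivation_ranks table).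
Proof. by vm_compute. Qed.

Lemma dim_rV8 (k : fieldType) : \dim {:'rV[k]_8} = 8%N.
Proof. by rewrite dimvf /dim /= mul1n. Qed.

(** Congruence in both directions makes the solution spaces equidimensional, and for each code
    dimension and rank add up to n * n. *)
Lemma derivation_rank_congruent (k : fieldType) n c c' al ga :
  2%N \notin [pchar k] -> 3%N \notin [pchar k] ->
  congruent k n c c' -> congruent k n c' c -> size c = n -> size c' = n ->
  isSome (derivation_rank al ga c) -> isSome (derivation_rank al ga c') ->
  derivation_rank al ga c = derivation_rank al ga c'.
Proof.
move=> char_neq2 char_neq3 cc' c'c szc szc'.
have := @dim_derivations k n char_neq2 char_neq3 al ga c.
have := @dim_derivations k n char_neq2 char_neq3 al ga c'.
case: (derivation_rank al ga c) => [r|] //; case: (derivation_rank al ga c') => [r'|] //.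
move=> /(_ _ szc' erefl) <- /(_ _ szc erefl).
have -> : \dim (derivations k n al ga c) = \dim (derivations k n al ga c').
  by apply/eqP; rewrite eqn_leq !derivations_congruent.
by move/addnI->.
Qed.

Lemma uniq_map_nth (T1 : Type) (T2 : eqType) (f : T1 -> T2) x0 s i j : uniq (map f s) ->
  (i < size s)%N -> (j < size s)%N -> f (nth x0 s i) = f (nth x0 s j) -> i = j.
Proof.
move=> us lti ltj fij; apply/eqP; rewrite -(nth_uniq (f x0) _ _ us) ?size_map //.
by rewrite !(nth_map x0) ?fij.
Qed.

Theorem theorem1 (k : closedFieldType)
    (char_neq2 : 2%N \notin [pchar k]) (char_neq3 : 3%N \notin [pchar k]) :
  exists A : 'I_35 -> minimal_algebra k,
    [/\ forall i, \dim {:gens (A i)} = 8%N /\ char_filtration (A i) 1 = fullv,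
        forall i j, isomorphic (A i) (A j) -> i = j
      & forall L : minimal_algebra k,
          \dim {:gens L} = 8%N -> char_filtration L 1 = fullv ->
          exists i, isomorphic L (A i)].
Proof.
have /andP[/allP tableP uniq_inv] := table_invariant.
have [code codeE] : exists code : 'I_35 -> _, forall i, code i = nth [::] table i.
  by exists (fun i => nth [::] table i).
have code_table i : code i \in table by rewrite codeE mem_nth // size_table.
have [A AP] : exists A : 'I_35 -> minimal_algebra k,
    forall i, \dim {:gens (A i)} = 8%N /\ realizes (A i) (code i).
  apply: (@fin_all_exists _ (fun=> minimal_algebra k)
    (fun i B => \dim {:gens B} = 8%N /\ realizes B (code i))) => i.
  have /and3P[/eqP szc adm _] := tableP _ (code_table i).
  have szb : size (code i) = size (vbasis {:'rV[k]_8}) by rewrite szc size_tuple dim_rV8.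
  have [L dimL rL] := realizable (vbasisP {:'rV[k]_8}) szb adm.
  by exists L; split; [rewrite dimL -szb | exact: rL].
exists A; split=> [i | i j isoA | L dimL fullL].
- have [dimA rA] := AP i; split; first exact: dimA.
  have /and3P[_ adm _] := tableP _ (code_table i); exact: realizes_filtration adm rA.
- have [_ rAi] := AP i; have [dimA rAj] := AP j.
  (* [A j] realizes both codes, so they are congruent in both directions. *)
  have rAij := realizes_iso isoA rAi.
  have cij := realizes_congruent rAij rAj; have cji := realizes_congruent rAj rAij.
  rewrite dimA in cij cji.
  have inv_eq : derivation_ranks (code i) = derivation_ranks (code j).
    have /and3P[/eqP szi _ /and4P[i1 i2 i3 _]] := tableP _ (code_table i).
    have /and3P[/eqP szj _ /and4P[j1 j2 j3 _]] := tableP _ (code_table j).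
    have rankE al ga := derivation_rank_congruent char_neq2 char_neq3 (al := al) (ga := ga) cij cji szi szj.
    exact: (f_equal3 (fun x y z => [:: x; y; z]) (rankE _ _ i1 j1) (rankE _ _ i2 j2) (rankE _ _ i3 j3)).
  rewrite !codeE in inv_eq; apply: val_inj.
  have lt35 (x : 'I_35) : (x < size table)%N by rewrite size_table ltn_ord.
  exact: (uniq_map_nth uniq_inv (lt35 i) (lt35 j) inv_eq).
have [c ct rL] := structure_code char_neq2 fullL dimL.
have lti : (index c table < 35)%N by rewrite -size_table index_mem.
exists (Ordinal lti); have [dimA rA] := AP (Ordinal lti).
apply: (iso_realizes rL); last by rewrite dimL dimA.
by rewrite codeE /= nth_index in rA.
Qed.
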